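(* Let $G$ be a connected Lie group with Lie algebra $\mathfrak g$, let $|\cdot|$ be an $\mathrm{Ad}$-invariant Finsler norm on $\mathfrak g$, and let $d$ be the induced bi-invariant distance on $G$. Let $B$ be an open ball around $0\in\mathfrak g$ for the Finsler norm such that $\exp|_B$ is a diffeomorphism onto its image $V\ni1$. Then $d(g,gh)=|(\exp|_B)^{-1}h|$ for any $h\in V$ and any $g\in G$. In particular the path $t\mapsto ge^{tv}$ is minimizing for $t\in[0,1]$ as long as $v\in B$, and $$d(e^{tx},e^{ty})=d(1,e^{ty}e^{-tx})=d(1,e^{\mathrm{BCH}(ty,-tx)})=|\mathrm{BCH}(ty,-tx)|$$ for any $x,y\in\mathfrak g$ and sufficiently small $t$. Moreover $$d(e^v,e^w)\le|w-v|\qquad\text{for all }v,w\in\mathfrak g,$$ and if $[v,w]=0$ and $w-v\in B$, then equality holds. If the norm is strictly convex and equality holds, then $[v,w]=0$.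
   Context: A Finsler norm on a finite-dimensional real vector space $\mathfrak g$ is a map $|\cdot|:\mathfrak g\to[0,\infty)$ with $|x+y|\le|x|+|y|$, $|\lambda x|=\lambda|x|$ for $\lambda\ge0$, and $|x|=0\iff x=0$ (possibly $|-x|\ne|x|$). It is $\mathrm{Ad}$-invariant if $|\mathrm{Ad}_g x|=|x|$ for all $g\in G$, $x\in\mathfrak g$. Write $e^x=\exp(x)$. The length of a rectifiable (absolutely continuous, with integrable speed) path $\alpha:[a,b]\to G$ is $\int_a^b|L_{\alpha(t)}^{-1}\alpha'(t)|\,dt$, where $L_g$ is the differential of left multiplication by $g$. The induced (possibly non-reversible) distance $d(g,h)$ is the infimum of the lengths of rectifiable paths from $g$ to $h$. A path is minimizing if its length equals the distance from its initial point to its endpoint. $\mathrm{BCH}(v,w)=\exp^{-1}(e^ve^w)=v+w+\frac12[v,w]+\cdots$ is the Baker-Campbell-Hausdorff series, defined for small $v,w$. The norm is strictly convex if for every $x\ne0$ the vector $x/|x|$ is an extreme point of the closed unit ball. *)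

(* Defs.v *)
From HB Require Import structures.
From mathcomp Require Import all_boot all_order all_algebra.
From mathcomp Require Import all_classical all_reals all_analysis.

Set Implicit Arguments.
Unset Strict Implicit.
Unset Printing Implicit Defensive.
Import Order.TTheory GRing.Theory Num.Theory.
Import numFieldNormedType.Exports.
Local Open Scope classical_set_scope.
Local Open Scope ring_scope.

(* C^k and C^oo maps on an open subset U of a finite-dimensional space. *)
Section Smooth.
Context {R : realType} {V W : normedModType R}.

Fixpoint Ck (k : nat) (U : set V) (f : V -> W) : Prop :=
  if k is k'.+1 then
    (forall x, U x -> differentiable f x) /\ (forall v, Ck k' U ('D_v f))
  else forall x, U x -> {for x, continuous f}.

Definition smooth (U : set V) (f : V -> W) : Prop := forall k, Ck k U f.

End Smooth.

Record chart (R : realType) (n : nat) (M : topologicalType) := Chart {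
  chart_fun :> M -> 'rV[R]_n;
  chart_inv : 'rV[R]_n -> M;
  chart_dom : set M;
  chart_cod : set 'rV[R]_n;
  chart_dom_open : open chart_dom;
  chart_cod_open : open chart_cod;
  chart_funS : set_fun chart_dom chart_cod chart_fun;
  chart_invS : set_fun chart_cod chart_dom chart_inv;
  chart_funK : {in chart_dom, cancel chart_fun chart_inv};
  chart_invK : {in chart_cod, cancel chart_inv chart_fun};
  chart_fun_continuous :
    forall p, chart_dom p -> {for p, continuous chart_fun};
  chart_inv_continuous :
    forall x, chart_cod x -> {for x, continuous chart_inv} }.

(* A smooth manifold of dimension n.  The smooth structure is the one of the
   atlas {chart_at p | p : M}; any atlas provides such a family.  The tangent
   space at p is identified with R^n through the chart chart_at p. *)
HB.mixin Record isSmoothManifold (R : realType) (n : nat) M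
    of Topological M := {
  manifold_hausdorff : hausdorff_space M;
  manifold_second_countable : @second_countable M;
  chart_at : M -> chart R n M;
  chart_at_dom : forall p, chart_dom (chart_at p) p;
  chart_at_compat : forall p q,
    smooth (chart_cod (chart_at p) `&`
            chart_inv (chart_at p) @^-1` chart_dom (chart_at q))
           (chart_at q \o chart_inv (chart_at p)) }.

#[short(type="smoothManifoldType")]
HB.structure Definition SmoothManifold (R : realType) (n : nat) :=
  { M of isSmoothManifold R n M & Topological M }.

Section Manifold.
Context {R : realType} {n : nat} {M : smoothManifoldType R n}.

Definition smooth_into {V : normedModType R} (U : set V) (f : V -> M) : Prop :=
  (forall x, U x -> {for x, continuous f}) /\
  forall p : M, smooth (U `&` f @^-1` chart_dom (chart_at p)) (chart_at p \o f).

Definition smooth_from {W : normedModType R} (A : set M) (f : M -> W) : Prop :=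
  forall p : M,
    smooth (chart_cod (chart_at p) `&` chart_inv (chart_at p) @^-1` A)
           (f \o chart_inv (chart_at p)).

Definition tangent_map (f : M -> M) (p : M) : 'rV[R]_n -> 'rV[R]_n :=
  'd (chart_at (f p) \o f \o chart_inv (chart_at p)) (chart_at p p).

Definition velocity (alpha : R -> M) (t : R) : 'rV[R]_n :=
  'D_1 (chart_at (alpha t) \o alpha : R^o -> 'rV[R]_n) t.

Definition diffeo_onto_image (B : set 'rV[R]_n) (f : 'rV[R]_n -> M) : Prop :=
  [/\ smooth_into B f, set_inj B f, open (f @` B)
    & smooth_from (f @` B) ('pinv_(fun=> 0) B f)].

End Manifold.

(* Smoothness of the product is smoothness on M x M in the product charts. *)
HB.mixin Record isLieGroup (R : realType) (n : nat) G
    of SmoothManifold R n G & Group G := {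
  mulg_smooth : forall p q : G,
    smooth_into (chart_cod (chart_at p) `*` chart_cod (chart_at q))
      (fun x => (chart_inv (chart_at p) x.1 * chart_inv (chart_at q) x.2)%g : G);
  invg_smooth : forall p : G,
    smooth_into (chart_cod (chart_at p))
      (fun x => (chart_inv (chart_at p) x)^-1%g : G) }.

#[short(type="lieGroupType")]
HB.structure Definition LieGroup (R : realType) (n : nat) :=
  { G of isLieGroup R n G & SmoothManifold R n G & Group G }.

Section AbsolutelyContinuous.
Context {R : realType} {W : normedModType R}.

Definition abs_continuous (a b : R) (f : R -> W) : Prop :=
  forall e, 0 < e -> exists2 d, 0 < d &
    forall s : seq (R * R),
      (forall I, I \in s -> [&& a <= I.1, I.1 <= I.2 & I.2 <= b]) ->
      pairwise (fun I J => (I.2 <= J.1) || (J.2 <= I.1)) s ->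
      \sum_(I <- s) (I.2 - I.1) < d -> \sum_(I <- s) `|f I.2 - f I.1| < e.

End AbsolutelyContinuous.

Section Norms.
Context {R : realType} {V : lmodType R}.

Record finsler_norm (N : V -> R) : Prop := FinslerNorm {
  finsler_ge0 : forall x, 0 <= N x;
  finsler_triangle : forall x y, N (x + y) <= N x + N y;
  finsler_homogeneous : forall (l : R) x, 0 <= l -> N (l *: x) = l * N x;
  finsler_eq0 : forall x, N x = 0 <-> x = 0 }.

Definition extreme_point (A : set V) (x : V) : Prop :=
  A x /\ forall y z (t : R), A y -> A z -> 0 < t < 1 ->
    x = t *: y + (1 - t) *: z -> y = x /\ z = x.

Definition strictly_convex (N : V -> R) : Prop :=
  forall x, x != 0 -> extreme_point [set y | N y <= 1] ((N x)^-1 *: x).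

End Norms.

(* The Lie algebra of G is the tangent space at 1, that is, R^n. *)
Section LieGroupTheory.
Context {R : realType} {n : nat} {G : lieGroupType R n}.
Implicit Types (g h : G) (v w : 'rV[R]_n) (alpha : R -> G) (N : 'rV[R]_n -> R).

Definition Ad g : 'rV[R]_n -> 'rV[R]_n :=
  tangent_map (fun h : G => (g * h * g^-1)%g) 1%g.

Definition Ad_invariant N : Prop := forall g v, N (Ad g v) = N v.

(* The left invariant vector field with value v at 1, read in the chart at 1:
   its value at x is the image of v by the differential at 1 of the left
   translation by the point of coordinates x. *)
Definition left_invariant_field v (x : 'rV[R]_n) : 'rV[R]_n :=
  let c : chart R n G := chart_at 1%g in
  'd (fun y => c (chart_inv c x * chart_inv c y)%g) (c 1%g) v.

Definition field_bracket (X Y : 'rV[R]_n -> 'rV[R]_n) (x : 'rV[R]_n) :=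
  'D_(X x) Y x - 'D_(Y x) X x.

Definition lie_bracket v w : 'rV[R]_n :=
  field_bracket (left_invariant_field v) (left_invariant_field w)
    ((chart_at 1%g : chart R n G) 1%g).

Definition one_parameter_subgroup (gamma : R -> G) v : Prop :=
  [/\ forall s t, gamma (s + t) = (gamma s * gamma t)%g,
      smooth_into [set: R^o] gamma
    & velocity gamma 0 = v].

Definition expG v : G :=
  xget (fun=> 1%g) [set gamma | one_parameter_subgroup gamma v] 1.

(* The Baker-Campbell-Hausdorff product, for the branch of exp^-1 with values
   in B. *)
Definition BCH (B : set 'rV[R]_n) v w : 'rV[R]_n :=
  'pinv_(fun=> 0) B expG (expG v * expG w)%g.

Definition speed N alpha (t : R) : R :=
  N (tangent_map (fun h : G => ((alpha t)^-1 * h)%g) (alpha t)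
       (velocity alpha t)).

Definition rectifiable N alpha (a b : R) : Prop :=
  [/\ {within `[a, b], continuous alpha},
      forall (p : G) (c d : R), a <= c -> c <= d -> d <= b ->
        alpha @` `[c, d] `<=` chart_dom (chart_at p) ->
        abs_continuous c d (chart_at p \o alpha)
    & lebesgue_measure.-integrable `[a, b] (EFin \o speed N alpha)].

Definition path_length N alpha (a b : R) : \bar R :=
  (\int[lebesgue_measure]_(t in `[a, b]) (speed N alpha t)%:E)%E.

Definition dist N g h : \bar R :=
  ereal_inf [set l | exists alpha : R -> G, exists a b : R,
    [/\ a <= b, rectifiable N alpha a b, alpha a = g, alpha b = h
      & l = path_length N alpha a b]].

Definition minimizing N alpha (a b : R) : Prop :=
  rectifiable N alpha a b /\
  path_length N alpha a b = dist N (alpha a) (alpha b).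

End LieGroupTheory.

(* Main.v *)
(* Write [ldiff f x] for the differential of [f : V -> G] at [x], brought back
   to the Lie algebra by a left translation.  From [e x = e (x/2) * e (x/2)],
   [ldiff e x] is the mean of [ldiff e (x/2)] and of its composite with
   [Ad (e (x/2))^-1]; as [Ad] preserves [N], [N (ldiff e (x/2^k) u)] increases
   with [k], and its limit is [N (ldiff e 0 u) = N u].  So [e] does not increase
   [N], and the path [t |-> e (v + t (w - v))] has length at most [N (w - v)].
   If [d (e v) (e w) = N u] with [u = w - v], that path cannot be shorter, so
   [N (ldiff e x u) = N u] for some [x = v + t u]; strict convexity then makes
   the two averaged vectors equal at every stage, hence [Ad (e (x/2^k))] fixes
   [u] for all [k >= 1], and [[x, u] = 0].

   For the lower bound, let [x] be the curve [log (g^-1 alpha)] of a path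
   [alpha] in the exponential ball.  The vector [ldiff e x x'] differs from [x']
   by a bracket [[x, z]], which is tangent to an [Ad]-orbit, on which [N] is
   constant: the derivative of [N x] is at most the speed of [alpha].  A path
   may leave the ball, so [N \o log] is truncated below [r] and extended by a
   constant.  For rectifiable paths the inequality is integrated by the
   fundamental theorem of calculus for absolutely continuous functions. *)
Require Import Defs.
From HB Require Import structures.
From mathcomp Require Import all_boot all_order all_algebra.
From mathcomp Require Import all_classical all_reals all_analysis.
From mathcomp Require Import ring lra.
Set Implicit Arguments.
Unset Strict Implicit.
Unset Printing Implicit Defensive.
Import Order.TTheory GRing.Theory Num.Theory.
Import numFieldNormedType.Exports.
Local Open Scope classical_set_scope.
Local Open Scope ring_scope.

(** * Absolutely continuous functions on an interval *)

(** Smoothness of [expG] is given only on the ball, and one-parameter subgroups are not known in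
    advance to exist in every direction: [expG] takes the junk value 1 where there is none, and
    injectivity on the ball is what rules this out. Beyond the ball, the same halving that gives the
    norm estimate also carries differentiability, and the continuity of [ldiff e], to the whole Lie
    algebra, without flows or power series. It yields the bracket correction [[x, z]] as well: on
    the quotient by the image of [[x, .]] every [Ad (e (t x))] acts trivially, so halving leaves the
    class of [ldiff e x u] unchanged, and the limit is the class of [u]. The bracket itself is
    defined by left invariant fields in one chart; it becomes the derivative of [Ad] through the
    second derivatives of the product at [(1, 1)] and their symmetry. The fundamental theorem of
    calculus comes from the Radon-Nikodym theorem, applied to the Stieltjes measures of the two
    monotone parts of the function, and from Lebesgue differentiation. *)

Section IntervalFamilies.
Context {R : realType}.
Implicit Types (s : seq (R * R)) (I J : R * R) (a b : R) (f : R -> R).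

(** The two side conditions that [abs_continuous] puts on a finite family, bundled into one
    hypothesis. *)
Definition itv_family a b s :=
  (forall I, I \in s -> [&& a <= I.1, I.1 <= I.2 & I.2 <= b]) /\
  pairwise (fun I J => (I.2 <= J.1) || (J.2 <= I.1)) s.

Definition total_length s := \sum_(I <- s) (I.2 - I.1).
Definition sum_increments f s := \sum_(I <- s) `|f I.2 - f I.1|.

(** Half-open on the left, like the intervals [ocitv] from which the Lebesgue and Stieltjes measures
    are built. *)
Definition itv_cover s (x : R) := exists2 I, I \in s & I.1 < x <= I.2.

Lemma itv_family_nil a b : itv_family a b [::].
Proof. by split. Qed.

Lemma itv_family_cons a b I s : itv_family a b (I :: s) <->
  [/\ [&& a <= I.1, I.1 <= I.2 & I.2 <= b],
      all (fun J => (I.2 <= J.1) || (J.2 <= I.1)) s & itv_family a b s].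
Proof.
rewrite /itv_family /= ; split.
  move=> [h /andP[h1 h2]]; split => //; first exact/h/mem_head.
  by split => // J Js; apply: h; rewrite in_cons Js orbT.
move=> [h1 h2 [h3 h4]]; split; last by rewrite h2 h4.
by move=> J; rewrite in_cons => /predU1P[->|/h3].
Qed.

Lemma itv_family_sub a b a' b' s : a' <= a -> b <= b' ->
  itv_family a b s -> itv_family a' b' s.
Proof.
move=> aa' bb' [h1 h2]; split => // I /h1 /and3P[h3 h4 h5]; apply/and3P; split => //.
  exact: le_trans h3.
exact: le_trans bb'.
Qed.

Lemma itv_family_cat a b s t : itv_family a b s -> itv_family a b t ->
  (forall I J, I \in s -> J \in t -> (I.2 <= J.1) || (J.2 <= I.1)) ->
  itv_family a b (s ++ t).
Proof.
move=> [hs ps] [ht pt] st; split.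
  by move=> I; rewrite mem_cat => /orP[/hs|/ht].
rewrite pairwise_cat ps pt !andbT; apply/allrelP => I J; exact: st.
Qed.

(** If [I] overlaps some [J] of [s], their hull [K] is no longer than the two together, so [K] is
    inserted into [rem J s] instead. The induction is on the size of the family, which drops. *)
Lemma itv_family_insert a b I s : [&& a <= I.1, I.1 <= I.2 & I.2 <= b] ->
  itv_family a b s -> exists s', [/\ itv_family a b s',
    total_length s' <= total_length s + (I.2 - I.1) &
    forall x, I.1 < x <= I.2 \/ itv_cover s x -> itv_cover s' x].
Proof.
move: {2}(size s) (leqnn (size s)) => n; elim: n s I => [|n IH] s I.
  rewrite leqn0 size_eq0 => /eqP -> hI _; exists [:: I]; split.
  - by apply/itv_family_cons; split => //; exact: itv_family_nil.
  - by rewrite /total_length big_nil big_seq1 add0r.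
  - move=> x [hx|[]//]; by exists I => //; rewrite mem_head.
move=> sn hI fs.
have [/allP dis|] := boolP (all (fun J => (I.2 <= J.1) || (J.2 <= I.1)) s).
  exists (I :: s); split.
  - by apply/itv_family_cons; split => //; exact/allP.
  - by rewrite /total_length big_cons addrC.
  - move=> x [hx|[J Js hJ]]; first by exists I => //; rewrite mem_head.
    by exists J => //; rewrite in_cons Js orbT.
rewrite -has_predC => /hasP[J Js /= hIJ].
have hJ := fs.1 _ Js.
pose K := (Num.min I.1 J.1, Num.max I.2 J.2).
have /and3P[I1 I2 I3] := hI; have /and3P[J1 J2 J3] := hJ.
have hK : [&& a <= K.1, K.1 <= K.2 & K.2 <= b].
  rewrite /K /=; case: (leP I.1 J.1) => ?; case: (leP I.2 J.2) => ?;
  by apply/and3P; split; lra.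
have ps := perm_to_rem Js.
have fr : itv_family a b (rem J s).
  split; first by move=> L /mem_rem; exact: fs.1.
  exact: subseq_pairwise (rem_subseq _ _) fs.2.
have sr : (size (rem J s) <= n)%N by rewrite size_rem// -ltnS prednK//; case: (s) Js.
have [s' [fs' ls' cs']] := IH _ _ sr hK fr.
exists s'; split => //.
  have -> : total_length s = (J.2 - J.1) + total_length (rem J s).
    by rewrite /total_length (perm_big _ ps)/= big_cons.
  move: ls'; have : K.2 - K.1 <= (I.2 - I.1) + (J.2 - J.1).
    move: hIJ; rewrite negb_or -!ltNge => /andP[h1 h2].
    rewrite /K /=; case: (leP I.1 J.1) => ?; case: (leP I.2 J.2) => ?; lra.
  by move: (total_length _) (total_length _) => *; lra.
move=> x hx; apply: cs'.
have hcase L : L \in s -> L = J \/ L \in rem J s.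
  by rewrite (perm_mem ps) in_cons => /predU1P[]; [left|right].
case: hx => [hx|[L /hcase[->|Lr] hL]].
- by left; rewrite /K /= gt_min le_max; case/andP: hx => -> ->.
- by left; rewrite /K /= gt_min le_max; case/andP: hL => -> ->; rewrite !orbT.
- by right; exists L.
Qed.

(** Absolute continuity speaks of non-overlapping families only, whereas the intervals covering a
    null set may overlap. Merging them loses no point and gains no length. *)
Lemma itv_family_merge a b s :
  (forall I, I \in s -> [&& a <= I.1, I.1 <= I.2 & I.2 <= b]) ->
  exists s', [/\ itv_family a b s', total_length s' <= total_length s &
    forall x, itv_cover s x -> itv_cover s' x].
Proof.
elim: s => [|I s IH] hs; first by exists [::]; split => //; exact: itv_family_nil.
have [|s1 [f1 l1 c1]] := IH.
  by move=> J Js; apply: hs; rewrite in_cons Js orbT.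
have [s2 [f2 l2 c2]] := itv_family_insert (hs _ (mem_head _ _)) f1.
exists s2; split => //.
  by rewrite (le_trans l2)// /total_length big_cons addrC lerD2l.
move=> x [J]; rewrite in_cons => /predU1P[-> hJ|Js hJ]; apply: c2; first by left.
by right; apply: c1; exists J.
Qed.

(** An interval on the wrong side of [t] degenerates to [(t, t)] and adds nothing to the sums, so
    none has to be removed. *)
Definition clipl (t : R) s := map (fun I => (Num.min I.1 t, Num.min I.2 t)) s.
Definition clipr (t : R) s := map (fun I => (Num.max I.1 t, Num.max I.2 t)) s.

Lemma itv_family_clipl a t b s : a <= t -> t <= b -> itv_family a b s -> itv_family a t (clipl t s).
Proof.
move=> at_ tb [h1 h2]; split.
  move=> _ /mapP[I /h1/and3P[? ? ?] ->] /=.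
  by case: (leP I.1 t) => ?; case: (leP I.2 t) => ?; apply/and3P; split; lra.
rewrite pairwise_map; apply: sub_pairwise h2 => I J /= /orP[] h; apply/orP.
  by left; rewrite le_min !ge_min h lexx ?orbT.
by right; rewrite le_min !ge_min h lexx ?orbT.
Qed.

Lemma itv_family_clipr a t b s : a <= t -> t <= b -> itv_family a b s -> itv_family t b (clipr t s).
Proof.
move=> at_ tb [h1 h2]; split.
  move=> _ /mapP[I /h1/and3P[? ? ?] ->] /=.
  by case: (leP I.1 t) => ?; case: (leP I.2 t) => ?; apply/and3P; split; lra.
rewrite pairwise_map; apply: sub_pairwise h2 => I J /= /orP[] h; apply/orP.
  by left; rewrite ge_max !le_max h lexx ?orbT.
by right; rewrite ge_max !le_max h lexx ?orbT.
Qed.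

Lemma sum_increments_clip a b t f s : itv_family a b s ->
  sum_increments f s <= sum_increments f (clipl t s) + sum_increments f (clipr t s).
Proof.
move=> [h1 _]; rewrite /sum_increments !big_map -big_split /= big_seq [leRHS]big_seq.
apply: ler_sum => I /h1 /and3P[_ I12 _].
case: (leP I.1 t) => h; case: (leP I.2 t) => h'; rewrite ?subrr ?normr0 ?addr0 ?add0r//.
- by rewrite addrC; apply: le_trans (ler_normD _ _); rewrite addrA subrK.
- by move: (le_trans I12 h'); rewrite leNgt h.
Qed.

Definition variation_on f a b := sup [set sum_increments f s | s in itv_family a b].

End IntervalFamilies.

(** * Total variation and the Jordan decomposition *)

Section Variation.
Context {R : realType}.
Implicit Types (s : seq (R * R)) (I J : R * R) (a b : R) (f : R -> R).

Lemma total_length_clip (t u : R) s : t <= u ->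
  (forall I, I \in s -> I.1 <= I.2) ->
  (forall I, I \in s -> (I.2 <= t) || (u <= I.1)) ->
  total_length s = total_length (clipl t s) + total_length (clipr u s).
Proof.
move=> tu hv h; rewrite /total_length !big_map -big_split /= big_seq [RHS]big_seq.
apply: eq_bigr => I Is; have := h _ Is; have := hv _ Is.
case: (leP I.1 t) => ?; case: (leP I.2 t) => ?; case: (leP I.1 u) => ?; case: (leP I.2 u) => ? /= *; lra.
Qed.

(** The first interval separates the others into those on its left and those on its right. The
    induction is on a bound for the size, because both clips of the tail have the size of the
    tail. *)
Lemma total_length_le a b s : a <= b -> itv_family a b s -> total_length s <= b - a.
Proof.
move: {2}(size s) (leqnn (size s)) => n; elim: n s a b => [|n IH] [|I s] a b //=.
- by move=> _ ab _; rewrite /total_length big_nil subr_ge0.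
- by move=> _ ab _; rewrite /total_length big_nil subr_ge0.
rewrite ltnS => sn ab /itv_family_cons[/and3P[I1 I2 I3] /allP dis fs].
have -> : total_length (I :: s) = (I.2 - I.1) + total_length s.
  by rewrite /total_length big_cons.
have := IH (clipl I.1 s) _ _ _ I1 (itv_family_clipl I1 (le_trans I2 I3) fs).
rewrite size_map => /(_ sn) h1.
have := IH (clipr I.2 s) _ _ _ I3 (itv_family_clipr (le_trans I1 I2) I3 fs).
rewrite size_map => /(_ sn) h2.
rewrite (total_length_clip I2); first lra.
  by move=> J /fs.1 /and3P[].
by move=> J /dis; rewrite orbC.
Qed.

Definition bounded_increments f a b :=
  exists M, forall s, itv_family a b s -> sum_increments f s <= M.

(** On an interval shorter than the [d] associated with the tolerance 1, all sums stay below 1;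
    finitely many steps of length [d / 2] exhaust [[a, b]]. *)
Lemma bounded_increments_abs_continuous a b f : a <= b -> abs_continuous a b f ->
  bounded_increments f a b.
Proof.
move=> ab /(_ 1 ltr01)[d d0 hd].
suff h k x y : a <= x -> x <= y -> y <= b -> y - x <= k%:R * (d / 2) ->
    bounded_increments f x y.
  have [k hk] : exists k, b - a <= k%:R * (d / 2).
    exists (Num.truncn ((b - a) / (d / 2))).+1.
    by rewrite -ler_pdivrMr ?divr_gt0// ltW// truncnS_gt.
  exact: h hk.
elim: k x y => [|k IH] x y ax xy yb hxy.
  exists 1 => s fs; apply/ltW/hd; try by apply: (itv_family_sub ax yb fs).1 || apply: (itv_family_sub ax yb fs).2.
  by apply: le_lt_trans (total_length_le xy fs) _; lra.
have [hlt|hge] := ltP (y - x) d.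
  exists 1 => s fs; have [f1 f2] := itv_family_sub ax yb fs; apply/ltW/hd => //.
  exact: le_lt_trans (total_length_le xy fs) _.
have xt : x <= x + d / 2 by lra.
have ty : x + d / 2 <= y by lra.
have [M hM] : bounded_increments f x (x + d / 2).
  exists 1 => s fs; have [f1 f2] := itv_family_sub ax (le_trans ty yb) fs; apply/ltW/hd => //.
  by apply: le_lt_trans (total_length_le xt fs) _; lra.
have [M' hM'] : bounded_increments f (x + d / 2) y.
  apply: IH => //; first lra.
  by move: hxy; rewrite -natr1 mulrDl; lra.
exists (M + M') => s fs; apply: (le_trans (sum_increments_clip (x + d / 2) f fs)).
by apply: lerD; [apply/hM/(itv_family_clipl _ ty fs)|apply/hM'/(itv_family_clipr xt _ fs)].
Qed.

Lemma bounded_increments_sub a b a' b' f : a <= a' -> b' <= b ->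
  bounded_increments f a b -> bounded_increments f a' b'.
Proof. by move=> h1 h2 [M hM]; exists M => s /(itv_family_sub h1 h2) /hM. Qed.

Lemma variation_on_ub a b f s : bounded_increments f a b -> itv_family a b s ->
  sum_increments f s <= variation_on f a b.
Proof.
move=> [M hM] fs; apply: ub_le_sup; last by exists s.
by exists M => _ [t /hM h <-].
Qed.

Lemma variation_on_approx a b f (e : R) : 0 < e -> bounded_increments f a b ->
  exists2 s, itv_family a b s & variation_on f a b - e < sum_increments f s.
Proof.
move=> e0 [M hM].
have [|_ [s fs <-] h] := @sup_adherent R [set sum_increments f s | s in itv_family a b] e e0.
  split; last by exists M => _ [t /hM h <-].
  by exists (sum_increments f [::]), [::] => //; exact: itv_family_nil.
by exists s.
Qed.

Lemma variation_onD a b c f : a <= b -> b <= c -> bounded_increments f a c ->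
  variation_on f a c = variation_on f a b + variation_on f b c.
Proof.
move=> ab bc bf.
have bf1 := bounded_increments_sub (lexx a) bc bf.
have bf2 := bounded_increments_sub ab (lexx c) bf.
apply/eqP; rewrite eq_le; apply/andP; split.
  apply/ler_addgt0Pr => e e0.
  have [s fs hs] := variation_on_approx e0 bf.
  have h1 := variation_on_ub bf1 (itv_family_clipl ab bc fs).
  have h2 := variation_on_ub bf2 (itv_family_clipr ab bc fs).
  have := sum_increments_clip b f fs; lra.
apply/ler_addgt0Pr => e e0; have e20 : 0 < e / 2 by lra.
have [s fs hs] := variation_on_approx e20 bf1.
have [t ft ht] := variation_on_approx e20 bf2.
have : sum_increments f (s ++ t) <= variation_on f a c.
  apply: variation_on_ub => //; apply: itv_family_cat.
  - exact: itv_family_sub fs.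
  - exact: itv_family_sub ft.
  - move=> I J /fs.1/and3P[_ _ h1] /ft.1/and3P[h2 _ _].
    by rewrite (le_trans h1 h2).
rewrite {1}/sum_increments big_cat /= -!/(sum_increments _ _); lra.
Qed.

Lemma variation_on_ge0 a b f : bounded_increments f a b -> 0 <= variation_on f a b.
Proof.
move=> bf; have := variation_on_ub bf (itv_family_nil a b).
by rewrite /sum_increments big_nil.
Qed.

Lemma variation_on_ge a b f : a <= b -> bounded_increments f a b ->
  `|f b - f a| <= variation_on f a b.
Proof.
move=> ab bf; have := @variation_on_ub _ _ _ [:: (a, b)] bf.
rewrite /sum_increments big_seq1; apply; apply/itv_family_cons; split => //=.
by rewrite !lexx ab.
Qed.

(** Inside each interval of a given family, choose a subfamily that almost attains the variation of
    [f] there. Together these form a family [L] of no greater total length, so a [d] that suits [f]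
    also suits its variation. In [key], each member of [L] is recorded to lie in a member of [s]:
    this keeps the concatenation non-overlapping in the induction. *)
Lemma abs_continuous_variation a b f : a <= b -> abs_continuous a b f ->
  abs_continuous a b (variation_on f a).
Proof.
move=> ab cf; have bf := bounded_increments_abs_continuous ab cf.
have key s : itv_family a b s -> forall e, 0 < e -> exists L,
  [/\ itv_family a b L, total_length L <= total_length s,
     (forall K, K \in L -> exists2 J, J \in s & (J.1 <= K.1) && (K.2 <= J.2)) &
     \sum_(I <- s) `|variation_on f a I.2 - variation_on f a I.1| <= sum_increments f L + e].
  elim: s => [|I s IH] fs e e0.
    by exists [::]; split => //; rewrite /sum_increments !big_nil add0r ltW.
  have /itv_family_cons[/and3P[I1 I2 I3] /allP dis fs'] := fs.
  have e20 : 0 < e / 2 by lra.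
  have [L [fL lL iL vL]] := IH fs' _ e20.
  have bfI := bounded_increments_sub I1 I3 bf.
  have bfI2 := bounded_increments_sub (lexx a) I3 bf.
  have [L' fL' vL'] := variation_on_approx e20 bfI.
  exists (L' ++ L); split.
  - apply: itv_family_cat => //; first exact: itv_family_sub fL'.
    move=> K K' /fL'.1 /and3P[? ? ?] /iL[J Js /andP[? ?]].
    by have /orP[] := dis _ Js => ?; apply/orP; [left|right]; lra.
  - have := total_length_le I2 fL'.
    rewrite /total_length big_cat big_cons /= -!/(total_length _); lra.
  - move=> K; rewrite mem_cat => /orP[/fL'.1/and3P[? ? ?]|/iL[J Js hJ]].
      by exists I; rewrite ?mem_head//; apply/andP.
    by exists J => //; rewrite in_cons Js orbT.
  - rewrite {1}/sum_increments big_cat big_cons /= -!/(sum_increments _ _).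
    rewrite (variation_onD I1 I2 bfI2) addrAC subrr add0r.
    rewrite ger0_norm ?variation_on_ge0//.
    have vI : variation_on f I.1 I.2 <= sum_increments f L' + e / 2 by lra.
    apply: le_trans (lerD vI vL) _; lra.
move=> e e0; have e20 : 0 < e / 2 by lra.
have e40 : 0 < e / 4 by lra.
have [d d0 hd] := cf _ e20; exists d => // s s1 s2 ld.
have [L [[f1 f2] lL _ vL]] := key _ (conj s1 s2) _ e40.
apply: le_lt_trans vL _.
have : sum_increments f L < e / 2 by apply: hd => //; exact: le_lt_trans lL ld.
lra.
Qed.

Lemma abs_continuousB a b f g : abs_continuous a b f -> abs_continuous a b g ->
  abs_continuous a b (f \- g).
Proof.
move=> cf cg e e0; have e20 : 0 < e / 2 by lra.
have [d d0 hd] := cf _ e20; have [d' d'0 hd'] := cg _ e20.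
exists (Num.min d d'); first by rewrite lt_min d0.
move=> s s1 s2; rewrite lt_min => /andP[l1 l2].
apply: le_lt_trans (_ : _ <= \sum_(I <- s) (`|f I.2 - f I.1| + `|g I.2 - g I.1|)) _.
  apply: ler_sum => I _ /=; apply: le_trans (ler_normB _ _).
  by rewrite le_eqVlt; apply/orP; left; apply/eqP; congr (`|_|); ring.
by rewrite big_split /= [e]splitr ltrD ?hd ?hd'.
Qed.

(** With [V] the variation counted from [a], the decomposition is [f = V - (V - f)]. *)
Lemma abs_continuous_monotone_decomposition a b f : a <= b -> abs_continuous a b f ->
  exists g h : R -> R, [/\ f = g \- h, abs_continuous a b g, abs_continuous a b h,
    {in `[a, b] &, {homo g : x y / x <= y}} & {in `[a, b] &, {homo h : x y / x <= y}}].
Proof.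
move=> ab cf; have bf := bounded_increments_abs_continuous ab cf.
have cV := abs_continuous_variation ab cf.
have hV x y : x \in `[a, b] -> y \in `[a, b] -> x <= y ->
    `|f y - f x| <= variation_on f a y - variation_on f a x.
  rewrite !in_itv /= => /andP[ax xb] /andP[ay yb] xy.
  rewrite (variation_onD ax xy (bounded_increments_sub (lexx a) yb bf)) addrAC subrr add0r.
  exact: variation_on_ge (bounded_increments_sub ax yb bf).
exists (variation_on f a), (variation_on f a \- f); split => //.
- by apply/funext => x /=; lra.
- exact: abs_continuousB.
- by move=> x y xi yi xy; have := hV _ _ xi yi xy; have := normr_ge0 (f y - f x); lra.
- move=> x y xi yi xy /=; have := hV _ _ xi yi xy; have := ler_norm (f y - f x); lra.
Qed.

End Variation.

(** * Densities of monotone absolutely continuous functions *)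

Section MonotoneAbsolutelyContinuous.
Context {R : realType}.
Local Notation mu := (@lebesgue_measure R).
Implicit Types (a b x y : R) (g : R -> R).

Definition clamp a b x := Num.max a (Num.min b x).

Lemma clamp_itv a b x : a <= b -> a <= clamp a b x <= b.
Proof.
by move=> ab; rewrite /clamp le_max lexx ge_max ab ge_min lexx.
Qed.

Lemma clamp_id a b x : a <= x <= b -> clamp a b x = x.
Proof. by move=> /andP[ax xb]; rewrite /clamp (min_idPr xb) (max_idPr ax). Qed.

Lemma clamp_lipschitz a b x y : a <= b -> x <= y -> 0 <= clamp a b y - clamp a b x <= y - x.
Proof.
move=> ab xy; rewrite /clamp; case: (leP b x) => ?; case: (leP b y) => ?;
case: (leP a b) => ?; case: (leP a x) => ?; case: (leP a y) => ?; apply/andP; split; lra.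
Qed.

Lemma abs_continuous1 a b g (e : R) : abs_continuous a b g -> 0 < e ->
  exists2 d, 0 < d & forall x y, a <= x -> x <= y -> y <= b -> y - x < d -> `|g y - g x| < e.
Proof.
move=> cg e0; have [d d0 hd] := cg _ e0; exists d => // x y ax xy yb xyd.
have := hd [:: (x, y)]; rewrite !big_seq1 /=; apply => //.
by move=> I; rewrite inE => /eqP -> /=; rewrite ax xy yb.
Qed.

Lemma measure_le_itv_cover (nu : {measure set (measurableTypeR R) -> \bar R}) (F : R -> R) (X : set R) s :
  (forall I, I \in s -> nu `]I.1, I.2]%classic = (F I.2 - F I.1)%:E) ->
  measurable X -> (forall x, X x -> itv_cover s x) ->
  (nu X <= (\sum_(I <- s) (F I.2 - F I.1))%:E)%E.
Proof.
elim: s X => [|I s IH] X hs mX cX.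
  have -> : X = set0 by apply/seteqP; split => // x /cX[].
  by rewrite measure0 big_nil.
have mI : measurable (`]I.1, I.2]%classic : set R) by exact: measurable_itv.
have -> : X = (X `&` `]I.1, I.2]%classic) `|` (X `\` `]I.1, I.2]%classic).
  by rewrite setUIDK.
rewrite big_cons EFinD; apply: (le_trans (measureU2 _ _ _)).
- exact: measurableI.
- exact: measurableD.
apply: leeD.
  rewrite -(hs I (mem_head _ _)); apply: le_measure; rewrite ?inE//.
  exact: measurableI.
apply: IH.
- by move=> J Js; apply: hs; rewrite in_cons Js orbT.
- exact: measurableD.
- move=> x [Xx nI]; have [J] := cX _ Xx.
  rewrite in_cons => /predU1P[-> hJ|Js hJ]; last by exists J.
  by exfalso; apply: nI; rewrite /= in_itv /= hJ.
Qed.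

(** Lebesgue measure is an infimum over countable covers by half-open intervals. Only finite partial
    sums are kept, since these are what absolute continuity can use. *)
Lemma null_set_cover (A : set R) (d : R) : mu A = 0%E -> 0 < d ->
  exists I : nat -> R * R, [/\ forall k, (I k).1 <= (I k).2,
    A `<=` \bigcup_k `](I k).1, (I k).2]%classic &
    forall n, \sum_(k < n) ((I k).2 - (I k).1) < d].
Proof.
move=> A0 d0.
have : (mu A < d%:E)%E by rewrite A0 lte_fin.
move=> /ereal_inf_lt[_ [F [mF AF] <-] Fd].
have /choice[I hI] : forall k, exists I : R * R, I.1 <= I.2 /\ F k = `]I.1, I.2]%classic.
  move=> k; have /ocitvP[->|[I I12 ->]] := mF k; last by exists I; rewrite ltW.
  by exists (0, 0); split => //=; rewrite set_itvoc0.
exists I; split => [k||n]; first by have [] := hI k.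
  by apply: (subset_trans AF) => x [k _]; rewrite (hI k).2; exists k.
rewrite -lte_fin; apply: le_lt_trans Fd.
apply: (@le_trans _ _ (\sum_(0 <= k < n) wlength idfun (F k))%E).
  rewrite big_mkord -sumEFin; apply: lee_sum => k _.
  by rewrite (hI k).2 wlength_itv_bnd //; exact: (hI k).1.
by apply: nneseries_lim_ge => k _ _; apply: wlength_ge0.
Qed.

(** Absolute continuity of [g] makes its Stieltjes measure vanish on Lebesgue null sets; the density
    is the Radon-Nikodym derivative. *)
Lemma monotone_abs_continuous_density a b g : a <= b ->
  {in `[a, b] &, {homo g : x y / x <= y}} -> abs_continuous a b g ->
  exists h : R -> R, mu.-integrable setT (EFin \o h) /\
    forall t, a <= t <= b -> \int[mu]_(x in `]a, t]) h x = g t - g a.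
Proof.
move=> ab ng cg.
(* A cumulative function lives on the whole line, so [g] is extended by constants outside
   [[a, b]]. *)
pose G := g \o clamp a b.
have ndG : nondecreasing G.
  move=> x y xy; apply: ng; rewrite ?in_itv ?clamp_itv//.
  by have := clamp_lipschitz ab xy; lra.
have rcG : right_continuous G.
  move=> x; apply/cvgrPdist_lt => e e0.
  have [d d0 hd] := abs_continuous1 cg e0.
  near=> y; rewrite distrC.
  have xy : x <= y by near: y; exact: nbhs_right_ge.
  have yd : y - x < d.
    by rewrite ltrBlDl; near: y; apply: nbhs_right_lt; rewrite ltrDl.
  have /andP[h1 h2] := clamp_lipschitz ab xy.
  have /andP[h3 _] := clamp_itv x ab; have /andP[_ h4] := clamp_itv y ab.
  by apply: hd => //; [lra|exact: le_lt_trans yd].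
pose Gc : cumulative R R := HB.pack G (isCumulative.Build R _ R G ndG rcG).
pose nu := lebesgue_stieltjes_measure Gc.
have nuI p q : p <= q -> nu `]p, q]%classic = (G q - G p)%:E.
  move=> pq; rewrite /nu /lebesgue_stieltjes_measure /measure_extension.
  by rewrite measurable_mu_extE/=; [rewrite wlength_itv_bnd|exact: is_ocitv].
have mD : measurable (`]a, b]%classic : set (measurableTypeR R)) by exact: measurable_itv.
have nuD : (nu `]a, b]%classic < +oo)%E by rewrite nuI // ltry.
pose nu' : {finite_measure set (measurableTypeR R) -> \bar R} := 
  @mfrestr _ (measurableTypeR R) R _ nu mD nuD.
have nu'E (E : set R) : nu' E = nu (E `&` `]a, b]%classic) by [].
have dom : nu' `<< mu.
  apply/null_content_dominatesP => A mA A0.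
  apply/eqP; rewrite eq_le measure_ge0 andbT nu'E.
  set E := A `&` _.
  have mE : measurable E by exact: measurableI.
  apply/lee_addgt0Pr => e e0; rewrite add0e.
  have [d d0 hd] := cg _ e0.
  have [I [I12 AI Id]] := null_set_cover A0 d0.
  (* The cover is countable but absolute continuity handles finite families: [E] is exhausted by its
     parts in the first [n] intervals, and the bound passes to the limit by continuity of [nu] from
     below. *)
  pose En n := E `&` \bigcup_(k in `I_n) `](I k).1, (I k).2]%classic.
  have mEn n : measurable (En n).
    apply: measurableI => //; apply: bigcup_measurable => k _; exact: measurable_itv.
  have UEn : \bigcup_n En n = E.
    apply/seteqP; split => [x [n _ []]//|x Ex].
    have [k _ xk] := AI _ Ex.1; exists k.+1 => //; split => //; by exists k => /=.
  have : (nu \o En) n @[n --> \oo] --> nu E.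
    rewrite -UEn; apply: nondecreasing_cvg_mu => //.
      by rewrite UEn.
    move=> m n mn; apply/subsetPset => x [Ex [k km xk]]; split => //; exists k => //=.
    exact: leq_trans mn.
  move=> /cvg_lim <-//; apply: lime_le.
    apply/cvg_ex; exists (nu E); rewrite -UEn; apply: nondecreasing_cvg_mu => //.
      by rewrite UEn.
    move=> m n mn; apply/subsetPset => x [Ex [k km xk]]; split => //; exists k => //=.
    exact: leq_trans mn.
  near=> n; rewrite /=.
  pose s := [seq (clamp a b (I k).1, clamp a b (I k).2) | k <- iota 0 n].
  have [|s' [[f1 f2] ls' cs']] := @itv_family_merge _ a b s.
    move=> _ /mapP[k _ ->] /=.
    have := clamp_lipschitz ab (I12 k); have := clamp_itv (I k).1 ab.
    by have := clamp_itv (I k).2 ab; move=> /andP[? ?] /andP[? ?] /andP[? ?]; apply/and3P; split; lra.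
  have ls : total_length s < d.
    apply: le_lt_trans (Id n); rewrite /total_length big_map.
    rewrite -(big_mkord xpredT (fun k => (I k).2 - (I k).1)) /index_iota subn0.
    by apply: ler_sum => k _ /=; case/andP: (clamp_lipschitz ab (I12 k)).
  have GE J : J \in s' -> G J.2 - G J.1 = g J.2 - g J.1.
    by move=> /f1/and3P[? ? ?]; rewrite /G /= !clamp_id//; apply/andP; split; lra.
  apply: le_trans (@measure_le_itv_cover nu G _ s' _ (mEn n) _) _.
  - by move=> J /f1/and3P[_ J12 _]; exact: nuI.
  - move=> x [[_ +] [k /= kn]]; rewrite /= !in_itv /= => /andP[ax xb] /andP[Ix xI]; apply: cs'.
    exists (clamp a b (I k).1, clamp a b (I k).2).
      by apply/mapP; exists k => //; rewrite mem_iota.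
    by rewrite /= /clamp gt_max ax gt_min Ix orbT le_max le_min xb xI orbT.
  rewrite lee_fin; apply: le_trans (ltW (hd s' f1 f2 (le_lt_trans ls' ls))).
  rewrite big_seq [leRHS]big_seq; apply: ler_sum => J Js'.
  by rewrite GE// ler_norm.
have [h [h0 hfin hint hE]] := radon_nikodym_sigma_finite dom.
exists (fine \o h).
have hh : EFin \o (fine \o h) = h by apply/funext => x /=; rewrite fineK.
split; first by rewrite hh.
move=> t /andP[at_ tb]; rewrite /Rintegral.
under eq_integral do rewrite /= fineK//.
rewrite -hE; last exact: measurable_itv.
rewrite nu'E (_ : _ `&` _ = `]a, t]%classic); last first.
  apply/seteqP; split => x /=; rewrite !in_itv/=; first by case.
  by move=> /andP[-> xt]; rewrite xt (le_trans xt).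
by rewrite nuI //= /G /= !clamp_id ?lexx// at_ tb.
Unshelve. all: by end_near. Qed.

End MonotoneAbsolutelyContinuous.

(** * The fundamental theorem of calculus and comparison with an integral *)

Section AbsolutelyContinuousFTC.
Context {R : realType}.
Local Notation mu := (@lebesgue_measure R).
Implicit Types (a b x : R).

Lemma abs_continuous_density a b (f : R -> R) : a <= b -> abs_continuous a b f ->
  exists h : R -> R, mu.-integrable setT (EFin \o h) /\
    forall t, a <= t <= b -> \int[mu]_(x in `]a, t]) h x = f t - f a.
Proof.
move=> ab cf.
have [g [k [-> cg ck ng nk]]] := abs_continuous_monotone_decomposition ab cf.
have [hg [ig Hg]] := monotone_abs_continuous_density ab ng cg.
have [hk [ik Hk]] := monotone_abs_continuous_density ab nk ck.
exists (hg \- hk); split.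
  rewrite (_ : EFin \o _ = (EFin \o hg) \- (EFin \o hk))%E; last exact/funext.
  exact: integrableB.
move=> t tab; have mI : measurable (`]a, t]%classic : set R) by exact: measurable_itv.
rewrite RintegralB//; [|exact: integrableS ig|exact: integrableS ik].
by rewrite Hg // Hk //=; ring.
Qed.

Lemma near_itv_oo a b x : a < x < b -> \forall y \near x, a < y < b.
Proof.
by move=> /andP[ax xb]; near=> y; apply/andP; split; near: y; [exact: lt_nbhsr|exact: lt_nbhsl].
Unshelve. all: by end_near. Qed.

Lemma abs_continuous_ftc a b (f : R -> R) : a <= b -> abs_continuous a b f ->
  exists h : R -> R, [/\ mu.-integrable setT (EFin \o h),
    forall t, a <= t <= b -> \int[mu]_(x in `]a, t]) h x = f t - f a &
    {ae mu, forall x, a < x < b -> is_derive x 1 f (h x)}].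
Proof.
move=> ab cf; have [h [ih hE]] := abs_continuous_density ab cf; exists h; split => //.
have loch : locally_integrable setT h.
  by apply: open_integrable_locally => //; exact: openT.
have := @FTC1 R h (BRight a) _ loch; case.
  by move=> y; apply: integrableS ih => //; exact: measurable_itv.
move=> N [mN N0 hN]; exists N; split => //; apply: subset_trans hN.
apply: subsetC => x /= hx /andP[ax xb].
have [|dF F'] := hx; first by rewrite lte_fin.
apply: (@near_eq_is_derive _ _ _ (fun y => f a + \int[mu]_(t in `]a, y]) h t)).
  near=> y; rewrite hE ?(addrC (f a)) ?subrK//.
  have /andP[ay yb] : a < y < b by near: y; apply: near_itv_oo; rewrite ax xb.
  by rewrite !ltW.
have hd : is_derive x 1 (fun y => \int[mu]_(t in `]a, y]) h t) (h x).
  by apply: DeriveDef => //; rewrite -derive1E.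
by rewrite -[h x]add0r; apply: is_deriveD.
Unshelve. all: by end_near. Qed.

(** As [f] is derivable almost everywhere and is recovered from its derivative, the bound by [g] is
    only asked at points of derivability. *)
Lemma abs_continuous_le_integral a b (f g : R -> R) : a <= b -> abs_continuous a b f ->
  mu.-integrable `[a, b] (EFin \o g) ->
  {ae mu, forall x, a < x < b -> derivable f x 1 -> 'D_1 f x <= g x} ->
  ((f b - f a)%:E <= \int[mu]_(x in `[a, b]) (g x)%:E)%E.
Proof.
move=> ab cf ig fg; have [h [ih hE hD]] := abs_continuous_ftc ab cf.
have mI : measurable (`]a, b[%classic : set R) by exact: measurable_itv.
have ih' : mu.-integrable `]a, b[ (EFin \o h) by exact: integrableS ih.
have ig' : mu.-integrable `]a, b[ (EFin \o g).
  by apply: integrableS ig => //; exact: subset_itv_oo_cc.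
rewrite -hE ?ab ?lexx//.
rewrite -Rintegral_itv_bndo_bndc// /Rintegral fineK; last exact: integrable_fin_num.
rewrite -integral_itv_bndo_bndc; last first.
  by case/integrableP: ig => + _; apply: measurable_funS => //; apply: subset_itvl; rewrite bnd_simp.
rewrite -integral_itv_obnd_cbnd; last by case/integrableP: ig'.
have hg : {ae mu, forall x, x \in `]a, b[ -> h x <= g x}.
  move: hD fg; apply: filterS2; first exact: (ae_filter_ringOfSetsType mu).
  by move=> x hx + xab; rewrite in_itv in xab; have dx := hx xab; rewrite derive_val => ->.
have id : mu.-integrable `]a, b[ (fun x => `|(g x)%:E - (h x)%:E|%E).
  by apply: integrable_abse; apply: integrableB ig' ih'.
(* The inequality [h <= g] holds almost everywhere only; there [g = h + |g - h|], and the second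
   term has nonnegative integral. *)
have -> : (\int[mu]_(x in `]a, b[) (g x)%:E =
    \int[mu]_(x in `]a, b[) ((h x)%:E + `|(g x)%:E - (h x)%:E|))%E.
  apply: ae_eq_integral => //.
  - by case/integrableP: ig'.
  - by apply: measurable_int; apply: integrableD ih' id.
  - move: hg; apply: filterS; first exact: (ae_filter_ringOfSetsType mu).
    move=> x hx /= xab; rewrite -EFinD ger0_norm ?subr_ge0 ?hx//.
    by rewrite (addrC (h x)) subrK.
rewrite integralD//.
by rewrite leeDl// integral_ge0.
Qed.

Lemma abs_continuous_ae_derivable n a b (f : R -> 'rV[R]_n) : a <= b -> abs_continuous a b f ->
  {ae mu, forall x, a < x < b -> derivable f x 1}.
Proof.
move=> ab cf.
have hf (i : 'I_n) : {ae mu, forall x, a < x < b -> derivable (fun t => f t 0 i) x 1}.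
  have cfi : abs_continuous a b (fun t => f t 0 i).
    move=> e e0; have [d d0 hd] := cf _ e0; exists d => // s s1 s2 s3.
    apply: le_lt_trans (hd s s1 s2 s3); apply: ler_sum => I _.
    rewrite [leRHS]/Num.Def.normr/= mx_normrE.
    apply: le_trans; last by apply: le_bigmax; exact: (ord0, i).
    by rewrite !mxE.
  have [h [_ _]] := abs_continuous_ftc ab cfi.
  apply: filterS; first exact: (ae_filter_ringOfSetsType mu).
  by move=> x hx xab; have := hx xab => -[].
have := @filter_forall R _ (fun i x => a < x < b -> derivable (fun t => f t 0 i) x 1)
  _ (ae_filter_ringOfSetsType mu) hf.
apply: filterS; first exact: (ae_filter_ringOfSetsType mu).
by move=> x hx xab; apply/derivable_mxP => i j; rewrite ord1; exact: hx.
Qed.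

End AbsolutelyContinuousFTC.

(** * Differential calculus *)

Section Calculus.
Context {R : realType}.

Lemma is_derive_line (V W : normedModType R) (f : V -> W) (y a : V) (s : R) d :
  is_derive (y + s *: a) a f d -> is_derive s (1 : R) (fun t : R => f (y + t *: a)) d.
Proof.
move=> [df <-].
have E : (fun h : R => h^-1 *: (((fun t : R => f (y + t *: a)) \o shift s) (h *: (1 : R)) - f (y + s *: a)))
    = (fun h => h^-1 *: ((f \o shift (y + s *: a)) (h *: a) - f (y + s *: a))).
  apply/funext => h /=; congr (_ *: (f _ - _)).
  by rewrite scaler1 scalerDl addrCA.
split; first by rewrite /derivable E.
by rewrite /derive E.
Qed.

Lemma derivable_line (V W : normedModType R) (f : V -> W) (y a : V) (s : R) :
  derivable f (y + s *: a) a -> is_derive s (1 : R) (fun t : R => f (y + t *: a)) ('D_a f (y + s *: a)).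
Proof. by move=> df; apply: is_derive_line; split. Qed.

Lemma mean_value_real (f df : R -> R) (a b : R) : a < b ->
  (forall x, a <= x <= b -> is_derive x 1 f (df x)) ->
  exists2 c, a < c < b & f b - f a = df c * (b - a).
Proof.
move=> ab hd; have [||c] := @MVT R f df a b ab.
- by move=> x; rewrite in_itv /= => /andP[? ?]; apply: hd; rewrite !ltW.
- apply: derivable_within_continuous => x; rewrite in_itv /= => hx.
  by have [] := hd _ hx.
by rewrite in_itv /= => cab E; exists c.
Qed.

(* Both mixed derivatives are approximated by the second difference
   [f (z + h a + h b) - f (z + h a) - f (z + h b) + f z] divided by [h ^ 2]. *)
Lemma second_difference (V : normedModType R) (f : V -> R) (z a b : V) (e : R) : 0 < e ->
  (\forall x \near z, derivable f x a /\ derivable ('D_a f) x b) ->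
  {for z, continuous ('D_b ('D_a f))} ->
  \forall h \near (0 : R)^'+,
    `|(f (z + h *: a + h *: b) - f (z + h *: a) - f (z + h *: b) + f z) / h ^+ 2
      - 'D_b ('D_a f) z| < e.
Proof.
move=> e0 hd hc.
have hn : \forall x \near z, [/\ derivable f x a, derivable ('D_a f) x b &
    `|'D_b ('D_a f) x - 'D_b ('D_a f) z| < e].
  near=> x; split; [by have [] : derivable f x a /\ derivable ('D_a f) x b by near: x..|].
  by rewrite distrC; near: x; move/cvgrPdist_lt : hc; apply.
have [d d0 hb] : exists2 d : R, 0 < d & forall x, ball z d x ->
    [/\ derivable f x a, derivable ('D_a f) x b & `|'D_b ('D_a f) x - 'D_b ('D_a f) z| < e].
  by move/nbhs_ballP: hn => [d /= d0 hb]; exists d.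
(* When [h * M < d], the parallelogram spanned at [z] by [h a] and [h b] lies in the ball of radius
   [d]; the 1 keeps [M] positive. *)
pose M := `|a| + `|b| + 1.
have M0 : 0 < M by rewrite ltr_wpDl// addr_ge0.
near=> h.
have h0 : 0 < h by near: h; exact: nbhs_right_gt.
have hM : h * M < d.
  rewrite -ltr_pdivlMr//; near: h; apply: nbhs_right_lt; exact: divr_gt0.
have inb s t : 0 <= s <= h -> 0 <= t <= h -> ball z d (z + s *: a + t *: b).
  move=> /andP[s0 sh] /andP[t0 th].
  rewrite -ball_normE /ball_ /= -addrA opprD addNKr normrN.
  apply: le_lt_trans hM; apply: le_trans (ler_normD _ _) _; rewrite !normrZ !ger0_norm//.
  rewrite /M !mulrDr mulr1 -addrA lerD// ?ler_wpM2r//.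
  by rewrite (le_trans (_ : _ <= h * `|b|))// ?ler_wpM2r// lerDl ltW.
have h1 : 0 <= h <= h by rewrite lexx ltW.
have h2 : 0 <= (0 : R) <= h by rewrite lexx ltW.
(* The second difference is an increment of [phi]. The mean value theorem along [a], then along [b],
   turns it into [h ^ 2] times a mixed derivative at a point of the parallelogram. *)
pose phi s := f (z + h *: b + s *: a) - f (z + s *: a).
have zs s t : z + t *: b + s *: a = z + s *: a + t *: b by rewrite addrAC.
have [s /andP[s0 sh]] : exists2 s, 0 < s < h & phi h - phi 0 =
    ('D_a f (z + h *: b + s *: a) - 'D_a f (z + s *: a)) * (h - 0).
  apply: (mean_value_real (df := fun s => 'D_a f (z + h *: b + s *: a) - 'D_a f (z + s *: a))); first exact: h0.
  move=> s hs; apply: is_deriveB; apply: derivable_line.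
    have [D1 _ _] := hb _ (inb s h hs h1); by rewrite zs.
  have [D1 _ _] := hb _ (inb s 0 hs h2); by move: D1; rewrite scale0r addr0.
move=> Es; have s01 : 0 <= s <= h by rewrite !ltW.
have [t /andP[t0 th] Et] : exists2 t, 0 < t < h &
    'D_a f (z + s *: a + h *: b) - 'D_a f (z + s *: a + 0 *: b) = 'D_b ('D_a f) (z + s *: a + t *: b) * (h - 0).
  apply: (mean_value_real (f := fun t => 'D_a f (z + s *: a + t *: b))
    (df := fun t => 'D_b ('D_a f) (z + s *: a + t *: b))); first exact: h0.
  move=> t ht; apply: derivable_line.
  by have [_ D1 _] := hb _ (inb s t s01 ht).
have -> : f (z + h *: a + h *: b) - f (z + h *: a) - f (z + h *: b) + f z = phi h - phi 0.
  by rewrite /phi zs scale0r !addr0; ring.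
rewrite Es zs; move: Et; rewrite scale0r addr0 subr0 => ->.
rewrite expr2 -mulrA mulfK ?mulf_neq0 ?gt_eqF//.
have t01 : 0 <= t <= h by rewrite !ltW.
by have [_ _ D1] := hb _ (inb s t s01 t01).
Unshelve. all: by end_near. Qed.

Lemma schwarz_real (V : normedModType R) (f : V -> R) (z a b : V) :
  (\forall x \near z, [/\ derivable f x a, derivable f x b,
     derivable ('D_a f) x b & derivable ('D_b f) x a]) ->
  {for z, continuous ('D_b ('D_a f))} -> {for z, continuous ('D_a ('D_b f))} ->
  'D_b ('D_a f) z = 'D_a ('D_b f) z.
Proof.
move=> hd c1 c2; apply/eqP; rewrite -subr_eq0 -normr_eq0 eq_le normr_ge0 andbT.
apply/ler_addgt0Pr => e e0; rewrite add0r; have e20 : 0 < e / 2 by lra.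
have h1 : \forall x \near z, derivable f x a /\ derivable ('D_a f) x b.
  by apply: filterS hd => x [].
have h2 : \forall x \near z, derivable f x b /\ derivable ('D_b f) x a.
  by apply: filterS hd => x [].
have n1 := second_difference e20 h1 c1.
have n2 := second_difference e20 h2 c2.
have [h [hA]] := @filter_ex _ _ _ _ (filterI n1 n2).
(* The second difference is symmetric in [a] and [b], so both estimates concern the same quotient
   [X]. *)
rewrite (addrAC _ _ (- f (z + h *: a))) (addrAC z) => hB.
move: hA hB; set X := (_ / _); set A := 'D_b _ z; set B := 'D_a _ z => hA hB.
rewrite -(subrKA X); apply: le_trans (ler_normD _ _) _.
by rewrite [e]splitr distrC; exact: lerD (ltW hA) (ltW hB).
Qed.

End Calculus.

(** * Smooth maps: differentials, symmetry of second derivatives, Lipschitz bounds *)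

Section SmoothMaps.
Context {R : realType}.

Lemma diff_near_eq (V W : normedModType R) (f g : V -> W) x :
  (\forall y \near x, f y = g y) -> differentiable f x ->
  differentiable g x /\ 'd g x = 'd f x :> (V -> W).
Proof.
move=> fg df.
have H : g \o shift x = cst (g x) + 'd f x +o_ (0 : V) id.
  apply/eqaddoP => e e0; have /eqaddoP/(_ e e0) := diff_locally df.
  have fg0 : \forall y \near (0 : V), f (y + x) = g (y + x).
    by move: fg; rewrite (near_shift 0 x) subr0.
  by apply: filterS2 fg0 => y E; rewrite /= !fctE /= E (nbhs_singleton fg).
have E : 'd g x = 'd f x :> (V -> W).
  by apply: diff_unique => //; exact: diff_continuous.
by split => //; apply/diff_locallyP; rewrite E; split => //; exact: diff_continuous.
Qed.

Lemma diff_near_id (V : normedModType R) (h : V -> V) x :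
  (\forall y \near x, y = h y) -> forall w, 'd h x w = w.
Proof.
move=> E w; have [|_ ->] := @diff_near_eq _ _ id h x E; first exact: ex_diff.
by rewrite diff_val.
Qed.

Lemma diff_comp_near_eq (U V W : normedModType R) (f : U -> V) (g : V -> W) (h : U -> W) x y :
  f x = y -> (\forall z \near x, g (f z) = h z) -> differentiable f x -> differentiable g y ->
  differentiable h x /\ forall u, 'd h x u = 'd g y ('d f x u).
Proof.
move=> <- E df dg; have dc := differentiable_comp df dg.
have [d e] := @diff_near_eq _ _ (g \o f) h x E dc; split; first exact: d.
by move=> u; rewrite e diff_comp.
Qed.

Lemma diff_comp_is_diff (U V W : normedModType R) (f df : U -> V) (g : V -> W) x y :
  f x = y -> is_diff x f df -> differentiable g y ->
  differentiable (fun z => g (f z)) x /\ forall u, 'd (fun z => g (f z)) x u = 'd g y (df u).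
Proof.
move=> <- [d <-] dg; split; first exact: (differentiable_comp d dg).
by move=> u; rewrite -[LHS]/('d (g \o f) x u) (diff_comp d dg).
Qed.

Lemma is_derive0P (W : normedModType R) (f : R -> W) (d : W) :
  is_derive (0 : R) (1 : R) f d <-> (fun h => h^-1 *: (f h - f 0)) @ 0^' --> d.
Proof.
have E : (fun h => h^-1 *: (f h - f 0)) = (fun h : R => h^-1 *: ((f \o shift 0) (h *: (1 : R)) - f 0)).
  by apply/funext => h; rewrite /= addr0 -[h *: 1]/(h * 1) mulr1.
rewrite E; split; first by move=> [h <-]; exact: h.
by move=> h; split; [apply/cvg_ex; exists d|apply: cvg_lim].
Qed.

Lemma cvg_to_eq (T : Type) (U : topologicalType) (F : set_system T) (f g : T -> U) (a b : U) :
  Filter F -> (\forall t \near F, f t = g t) -> a = b -> f @ F --> a -> g @ F --> b.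
Proof. by move=> FF fg <-; apply: cvg_trans; exact: near_eq_cvg. Qed.

Lemma cvg_sum (T : Type) (V : normedModType R) (F : set_system T) (FF : Filter F) n
    (f : 'I_n -> T -> V) (a : 'I_n -> V) :
  (forall i, f i @ F --> a i) -> (fun t => \sum_i f i t) @ F --> \sum_i a i.
Proof.
move=> h; elim: (index_enum _) => [|i r IH].
  by rewrite big_nil; under eq_fun do rewrite big_nil; exact: cvg_cst.
by rewrite big_cons; under eq_fun do rewrite big_cons; exact: cvgD.
Qed.

Lemma Ck_differentiable (V W : normedModType R) k (U : set V) (f : V -> W) x :
  Ck k.+1 U f -> U x -> differentiable f x.
Proof. by move=> [h _]; exact: h. Qed.

Lemma Ck_derive (V W : normedModType R) k (U : set V) (f : V -> W) v :
  Ck k.+1 U f -> Ck k U ('D_v f).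
Proof. by move=> [_ h]; exact: h. Qed.

Lemma Ck_continuous (V W : normedModType R) k (U : set V) (f : V -> W) x :
  Ck k U f -> U x -> {for x, continuous f}.
Proof.
case: k => [h|k h Ux]; first exact: h.
exact/differentiable_continuous/(Ck_differentiable h).
Qed.

Lemma Ck_scale (V W : normedModType R) k (U : set V) (f : V -> W) (m : R) :
  Ck k U f -> Ck k [set x | U (m *: x)] (fun x => f (m *: x)).
Proof.
elim: k f => [|k IH] f.
  move=> h x Ux; apply: continuous_comp; [exact: scaler_continuous|exact: h].
move=> [h1 h2]; split=> [x Ux|v].
  apply: (@differentiable_comp _ _ _ _ ( *:%R m) f); last exact: h1.
  exact: differentiableZ.
have -> : 'D_v (fun x => f (m *: x)) = (fun x => 'D_(m *: v) f (m *: x)).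
  apply/funext => x.
  have E : (fun h : R => h^-1 *: (((fun y => f (m *: y)) \o shift x) (h *: v) - f (m *: x)))
      = (fun h => h^-1 *: ((f \o shift (m *: x)) (h *: (m *: v)) - f (m *: x))).
    apply/funext => h /=; congr (_ *: (f _ - _)).
    by rewrite scalerDr !scalerA mulrC.
  by rewrite /derive E.
exact: IH (h2 _).
Qed.

Lemma derive_coord (V : normedModType R) n (f : V -> 'rV[R]_n) x v i :
  derivable f x v ->
  derivable (fun y => f y 0 i) x v /\ 'D_v (fun y => f y 0 i) x = ('D_v f x) 0 i.
Proof.
move=> df; rewrite derive_mx// mxE; split=> //.
by move: df => /derivable_mxP; apply.
Qed.

Lemma near_eq_continuous (V W : topologicalType) (f g : V -> W) x :
  (\forall y \near x, f y = g y) -> {for x, continuous f} -> {for x, continuous g}.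
Proof.
move=> fg cf; suff : g @ x --> f x by rewrite (nbhs_singleton fg).
exact: cvg_trans (near_eq_cvg fg) cf.
Qed.

Lemma schwarz (V : normedModType R) n (U : set V) (f : V -> 'rV[R]_n) z a b :
  open U -> U z -> Ck 2 U f -> 'D_b ('D_a f) z = 'D_a ('D_b f) z.
Proof.
move=> oU Uz cf; apply/rowP => i.
pose fi x := f x 0 i.
have D1 x v : U x -> derivable fi x v /\ 'D_v fi x = ('D_v f x) 0 i.
  move=> Ux; apply: derive_coord.
  exact/diff_derivable/(Ck_differentiable cf).
have D2 x v w : U x -> derivable ('D_v fi) x w /\ 'D_w ('D_v fi) x = ('D_w ('D_v f) x) 0 i.
  move=> Ux.
  have dd : derivable ('D_v f) x w.
    exact/diff_derivable/(Ck_differentiable (Ck_derive v cf)).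
  have E : \forall y \near x, (fun y => 'D_v f y 0 i) y = 'D_v fi y.
    have := open_nbhs_nbhs (conj oU Ux); apply: filterS => y Uy.
    by rewrite (D1 y v Uy).2.
  have [d1 d2] := derive_coord i dd; split; first exact: near_eq_derivable E d1.
  by rewrite -d2; apply: near_eq_derive; apply: filterS E => y ->.
have nU : \forall x \near z, U x by exact: open_nbhs_nbhs (conj oU Uz).
have cD v w : {for z, continuous ('D_w ('D_v fi))}.
  apply: (@near_eq_continuous _ _ (fun x => ('D_w ('D_v f) x) 0 i)).
    by move: nU; apply: filterS => y Uy; rewrite (D2 y v w Uy).2.
  have c2 : {for z, continuous ('D_w ('D_v f))}.
    by apply: (@Ck_continuous _ _ 0 U) Uz; exact/Ck_derive/Ck_derive.
  exact: (continuous_comp c2 (@coord_continuous _ _ _ _ _ _)).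
suff e3 : 'D_b ('D_a fi) z = 'D_a ('D_b fi) z.
  exact: etrans (esym (D2 z a b Uz).2) (etrans e3 (D2 z b a Uz).2).
apply: schwarz_real.
- apply: filterS nU => x Ux.
  by split; [exact: (D1 x a Ux).1|exact: (D1 x b Ux).1|exact: (D2 x a b Ux).1|exact: (D2 x b a Ux).1].
- exact: cD.
- exact: cD.
Qed.

Lemma norm_coord n (v : 'rV[R]_n) i : `|v 0 i| <= `|v|.
Proof.
rewrite [leRHS]/Num.Def.normr/= mx_normrE.
by apply: le_trans; last by apply: le_bigmax; exact: (ord0, i).
Qed.

Lemma norm_rV_le n (v : 'rV[R]_n) (K : R) : 0 <= K -> (forall i, `|v 0 i| <= K) -> `|v| <= K.
Proof.
move=> K0 h; rewrite [leLHS]/Num.Def.normr/= mx_normrE.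
by rewrite (bigmax_le _ K0)//= => -[i j] _ /=; rewrite ord1.
Qed.

Lemma mean_value_le n (f df : R -> 'rV[R]_n) (a b K : R) : a <= b -> 0 <= K ->
  (forall t, a <= t <= b -> is_derive t (1 : R) f (df t)) ->
  (forall t, a <= t <= b -> `|df t| <= K) -> `|f b - f a| <= K * (b - a).
Proof.
rewrite le_eqVlt => /predU1P[<-|ab] K0 hd hK; first by rewrite !subrr normr0 mulr0.
apply: norm_rV_le; first by rewrite mulr_ge0// subr_ge0 ltW.
move=> i.
have [t /andP[h1 h2]] : exists2 t, a < t < b & f b 0 i - f a 0 i = df t 0 i * (b - a).
  apply: (mean_value_real (f := fun t => f t 0 i) (df := fun t => df t 0 i)) => // t /hd [d1 <-].
  by have [e1 e2] := derive_coord i d1; split.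
have tab : a <= t <= b by rewrite !ltW.
rewrite !mxE => ->.
have ba0 : 0 <= b - a by rewrite subr_ge0 ltW.
rewrite normrM (ger0_norm ba0) ler_wpM2r//.
by apply: le_trans (hK _ tab); exact: norm_coord.
Qed.

Lemma diff_rV_expand (W : normedModType R) n (f : 'rV[R]_n -> W) x v : differentiable f x ->
  'd f x v = \sum_i v 0 i *: 'D_(delta_mx 0 i) f x.
Proof.
move=> df; rewrite [in LHS](row_sum_delta v) linear_sum; apply: eq_bigr => i _.
by rewrite linearZ /= deriveE.
Qed.

Lemma diff_pairr_expand (V W : normedModType R) n (f : V * 'rV[R]_n -> W) z w : differentiable f z ->
  'd f z (0, w) = \sum_i w 0 i *: 'D_(0, delta_mx 0 i) f z.
Proof.
move=> df.
have -> : ((0, w) : V * 'rV[R]_n) = \sum_i w 0 i *: ((0, delta_mx 0 i) : V * 'rV[R]_n).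
  rewrite [in LHS](row_sum_delta w).
  elim/big_ind2 : _ => // [x1 x2 y1 y2 <- <-|i _].
    by rewrite /GRing.add /= /add_pair /= addr0.
  by rewrite /GRing.scale /= /scale_pair /= scaler0.
rewrite linear_sum; apply: eq_bigr => i _.
by rewrite linearZ /= deriveE.
Qed.

Lemma diff_pairl_expand (V W : normedModType R) n (f : 'rV[R]_n * V -> W) z w : differentiable f z ->
  'd f z (w, 0) = \sum_i w 0 i *: 'D_(delta_mx 0 i, 0) f z.
Proof.
move=> df.
have -> : ((w, 0) : 'rV[R]_n * V) = \sum_i w 0 i *: ((delta_mx 0 i, 0) : 'rV[R]_n * V).
  rewrite [in LHS](row_sum_delta w).
  elim/big_ind2 : _ => // [x1 x2 y1 y2 <- <-|i _].
    by rewrite /GRing.add /= /add_pair /= addr0.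
  by rewrite /GRing.scale /= /scale_pair /= scaler0.
rewrite linear_sum; apply: eq_bigr => i _.
by rewrite linearZ /= deriveE.
Qed.

(** [Ck] gives continuity of derivatives in a fixed direction. Expanding the direction in the
    standard basis of the finite-dimensional factor lets point and direction vary together. *)
Lemma diff_pairr_cvg (V W : normedModType R) n (U : set (V * 'rV[R]_n)) (f : V * 'rV[R]_n -> W)
    (T : Type) (F : set_system T) (FF : Filter F) (z : T -> V * 'rV[R]_n) (w : T -> 'rV[R]_n) z0 w0 :
  open U -> U z0 -> Ck 1 U f -> z @ F --> z0 -> w @ F --> w0 ->
  (fun t => 'd f (z t) (0, w t)) @ F --> 'd f z0 (0, w0).
Proof.
move=> oU Uz cf zz ww.
have nU : \forall t \near F, U (z t) by apply: zz; exact: open_nbhs_nbhs.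
have E : \forall t \near F, \sum_i (w t) 0 i *: 'D_(0, delta_mx 0 i) f (z t) = 'd f (z t) (0, w t).
  apply: filterS nU => t Ut; exact: (esym (diff_pairr_expand (w t) (Ck_differentiable cf Ut))).
apply: (cvg_to_eq FF E (esym (diff_pairr_expand w0 (Ck_differentiable cf Uz)))).
apply: cvg_sum => i; apply: cvgZ.
  exact: cvg_comp ww (@coord_continuous _ _ _ _ _ _).
have c0 : {for z0, continuous ('D_(0, delta_mx 0 i) f)}.
  exact: (@Ck_continuous _ _ 0 _ _ _ (Ck_derive _ cf)).
exact: cvg_comp zz c0.
Qed.

Lemma diff_pairl_cvg (V W : normedModType R) n (U : set ('rV[R]_n * V)) (f : 'rV[R]_n * V -> W)
    (T : Type) (F : set_system T) (FF : Filter F) (z : T -> 'rV[R]_n * V) (w : T -> 'rV[R]_n) z0 w0 :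
  open U -> U z0 -> Ck 1 U f -> z @ F --> z0 -> w @ F --> w0 ->
  (fun t => 'd f (z t) (w t, 0)) @ F --> 'd f z0 (w0, 0).
Proof.
move=> oU Uz cf zz ww.
have nU : \forall t \near F, U (z t) by apply: zz; exact: open_nbhs_nbhs.
have E : \forall t \near F, \sum_i (w t) 0 i *: 'D_(delta_mx 0 i, 0) f (z t) = 'd f (z t) (w t, 0).
  apply: filterS nU => t Ut; exact: (esym (diff_pairl_expand (w t) (Ck_differentiable cf Ut))).
apply: (cvg_to_eq FF E (esym (diff_pairl_expand w0 (Ck_differentiable cf Uz)))).
apply: cvg_sum => i; apply: cvgZ.
  exact: cvg_comp ww (@coord_continuous _ _ _ _ _ _).
have c0 : {for z0, continuous ('D_(delta_mx 0 i, 0) f)}.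
  exact: (@Ck_continuous _ _ 0 _ _ _ (Ck_derive _ cf)).
exact: cvg_comp zz c0.
Qed.

(** Near [z] each partial derivative has norm at most 1 more than at [z]. Summing these bounds gives
    the constant, by the mean value inequality along segments of the ball. *)
Lemma locally_lipschitz n m (U : set 'rV[R]_n) (f : 'rV[R]_n -> 'rV[R]_m) z :
  open U -> U z -> Ck 1 U f ->
  exists L d : R, [/\ 0 <= L, 0 < d, ball z d `<=` U &
    forall x y, ball z d x -> ball z d y -> `|f x - f y| <= L * `|x - y|].
Proof.
move=> oU Uz cf.
pose M := \sum_(i < n) (`|'D_(delta_mx 0 i) f z| + 1).
have hn : \forall x \near z, U x /\ forall i : 'I_n, `|'D_(delta_mx 0 i) f x| <= `|'D_(delta_mx 0 i) f z| + 1.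
  apply: filterI; first exact: open_nbhs_nbhs (conj oU Uz).
  apply: (@filter_forall _ _ (fun i x => `|'D_(delta_mx 0 i) f x| <= `|'D_(delta_mx 0 i) f z| + 1) (nbhs z)) => i.
  have : {for z, continuous ('D_(delta_mx 0 i) f)}.
    exact: (@Ck_continuous _ _ 0 U _ _ (Ck_derive _ cf)).
  move/cvgrPdist_le => /(_ 1 ltr01); apply: filterS => x hx.
  by rewrite -lerBlDl; apply: le_trans hx; rewrite distrC; exact: lerB_dist.
have [d d0 hb] : exists2 d : R, 0 < d & forall x, ball z d x ->
    U x /\ forall i : 'I_n, `|'D_(delta_mx 0 i) f x| <= `|'D_(delta_mx 0 i) f z| + 1.
  by move/nbhs_ballP: hn => [d /= d0 hb]; exists d.
have M0 : 0 <= M by apply: sumr_ge0 => i _; exact: addr_ge0.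
exists M, d; split => //; first by move=> x /hb[].
move=> x y bx by_.
have hseg t : 0 <= t <= 1 -> ball z d (y + t *: (x - y)).
  move=> /andP[t0 t1]; move: bx by_; rewrite -!ball_normE /ball_ /= => bx by_.
  have -> : z - (y + t *: (x - y)) = t *: (z - x) + (1 - t) *: (z - y).
    rewrite scalerBr scalerBl scale1r !scalerBr.
    rewrite !opprD !opprK !addrA; apply/rowP => i; rewrite !mxE; ring.
  apply: le_lt_trans (ler_normD _ _) _; rewrite !normrZ !ger0_norm ?subr_ge0//.
  (* The strict inequality used below for the term in [t] needs [t > 0]. *)
  have [->|tn0] := eqVneq t 0; first by rewrite mul0r add0r subr0 mul1r.
  have : t * `|z - x| < t * d by rewrite ltr_pM2l// lt0r tn0.
  have : (1 - t) * `|z - y| <= (1 - t) * d by rewrite ler_wpM2l ?subr_ge0// ltW.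
  move: (t * `|z - x|) ((1 - t) * `|z - y|) => A B; lra.
have := @mean_value_le m (fun t => f (y + t *: (x - y)))
  (fun t => 'd f (y + t *: (x - y)) (x - y)) 0 1 (M * `|x - y|) ler01.
rewrite scale1r scale0r addr0 subr0 mulr1 (_ : y + (x - y) = x); last by rewrite addrC subrK.
apply.
- exact: mulr_ge0.
- move=> t ht; have dft : differentiable f (y + t *: (x - y)).
    by apply: Ck_differentiable cf _; case: (hb _ (hseg _ ht)).
  have := derivable_line (@diff_derivable _ _ _ _ _ (x - y) dft); rewrite deriveE//.
- move=> t ht; have [Ut ht'] := hb _ (hseg _ ht).
  rewrite diff_rV_expand; last exact: Ck_differentiable cf _.
  apply: le_trans (ler_norm_sum _ _ _) _; rewrite /M mulr_suml; apply: ler_sum => i _.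
  by rewrite normrZ mulrC ler_pM// norm_coord.
Qed.

End SmoothMaps.

(** * Translations in charts *)

Section GroupCharts.
Context {R : realType} {n : nat} {G : lieGroupType R n}.
Implicit Types (p q s g h x y : G).
Local Notation dom p := (chart_dom (chart_at (p : G))).
Local Notation cod p := (chart_cod (chart_at (p : G))).
Local Notation cinv p := (chart_inv (chart_at (p : G))).

Lemma chartK p x : dom p x -> cinv p (chart_at p x) = x.
Proof. by move=> px; exact: (@chart_funK _ _ _ (chart_at p) x (mem_set px)). Qed.

Lemma chart_invVK p u : cod p u -> chart_at p (cinv p u) = u.
Proof. by move=> pu; exact: (@chart_invK _ _ _ (chart_at p) u (mem_set pu)). Qed.

Lemma chart_codP p x : dom p x -> cod p (chart_at p x).
Proof. exact: (@chart_funS _ _ _ (chart_at p)). Qed.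

Lemma chart_domP p u : cod p u -> dom p (cinv p u).
Proof. exact: (@chart_invS _ _ _ (chart_at p)). Qed.

Lemma near_dom p x : dom p x -> \forall y \near x, dom p y.
Proof. by move=> px; apply: open_nbhs_nbhs; split => //; exact: chart_dom_open. Qed.

Lemma near_cod p u : cod p u -> \forall v \near u, cod p v.
Proof. by move=> px; apply: open_nbhs_nbhs; split => //; exact: chart_cod_open. Qed.

Lemma chart_cont p x : dom p x -> {for x, continuous (chart_at p)}.
Proof. exact: chart_fun_continuous. Qed.

Lemma chart_inv_cont p u : cod p u -> {for u, continuous (cinv p)}.
Proof. exact: chart_inv_continuous. Qed.

(** The Lie group structure states continuity of the product in chart coordinates; here it is
    brought back to [G], for arbitrary filters. *)
Lemma mulg_cvg (T : Type) (F : set_system T) {FF : Filter F} (a b : T -> G) g h :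
  a @ F --> g -> b @ F --> h -> (fun t => a t * b t)%g @ F --> (g * h)%g.
Proof.
move=> ag bh.
have dg := chart_at_dom g; have dh := chart_at_dom h.
have [cm _] := mulg_smooth g h.
have c1 : (chart_at g \o a) @ F --> chart_at g g.
  exact: cvg_comp ag (chart_cont dg).
have c2 : (chart_at h \o b) @ F --> chart_at h h.
  exact: cvg_comp bh (chart_cont dh).
have c3 : (fun t => (chart_at g (a t), chart_at h (b t))) @ F --> (chart_at g g, chart_at h h).
  exact: cvg_pair c1 c2.
have c4 := cm (chart_at g g, chart_at h h) (conj (chart_codP dg) (chart_codP dh)).
have := cvg_comp _ _ c3 c4; rewrite /= !chartK//; apply: cvg_trans.
apply: near_eq_cvg.
have na : \forall t \near F, dom g (a t) by apply: ag; exact: near_dom.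
have nb : \forall t \near F, dom h (b t) by apply: bh; exact: near_dom.
by apply: filterS2 na nb => t ? ? /=; rewrite !chartK.
Qed.

Lemma invg_cvg (T : Type) (F : set_system T) {FF : Filter F} (a : T -> G) g :
  a @ F --> g -> (fun t => (a t)^-1)%g @ F --> (g^-1)%g.
Proof.
move=> ag; have dg := chart_at_dom g.
have [cm _] := invg_smooth g.
have c1 : (chart_at g \o a) @ F --> chart_at g g.
  exact: cvg_comp ag (chart_cont dg).
have c4 := cm (chart_at g g) (chart_codP dg).
have := cvg_comp _ _ c1 c4; rewrite /= !chartK//; apply: cvg_trans.
apply: near_eq_cvg.
have na : \forall t \near F, dom g (a t) by apply: ag; exact: near_dom.
by apply: filterS na => t ? /=; rewrite !chartK.
Qed.

Lemma mulgl_cvg (T : Type) (F : set_system T) {FF : Filter F} (b : T -> G) g h :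
  b @ F --> h -> (fun t => g * b t)%g @ F --> (g * h)%g.
Proof. by move=> bh; apply: (@mulg_cvg _ F FF (cst g) b) => //; exact: cvg_cst. Qed.

Lemma mulgr_cvg (T : Type) (F : set_system T) {FF : Filter F} (a : T -> G) g h :
  a @ F --> g -> (fun t => a t * h)%g @ F --> (g * h)%g.
Proof. by move=> ag; apply: (@mulg_cvg _ F FF a (cst h)) => //; exact: cvg_cst. Qed.

Definition mul_dom p q s : set ('rV[R]_n * 'rV[R]_n) :=
  (cod p `*` cod q) `&` (fun z => cinv p z.1 * cinv q z.2)%g @^-1` dom s.

(** The differentials of left and right translations are the partial differentials of this map,
    which is how their dependence on the group element is controlled. *)
Definition mul_chart p q s (z : 'rV[R]_n * 'rV[R]_n) : 'rV[R]_n :=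
  chart_at s (cinv p z.1 * cinv q z.2)%g.

Lemma mul_dom_open p q s : open (mul_dom p q s).
Proof.
rewrite openE => z [zpq zs]; rewrite /interior; apply: filterI.
  by exists (cod p, cod q) => //=; case: zpq => ? ?; split; exact: near_cod.
have [cm _] := mulg_smooth p q.
exact: (cm z zpq (dom s) (near_dom zs)).
Qed.

Lemma mul_chart_Ck p q s k : Ck k (mul_dom p q s) (mul_chart p q s).
Proof. by have [_ h] := mulg_smooth p q; exact: h. Qed.

Lemma mul_dom_chart p q s x y : dom p x -> dom q y -> dom s (x * y)%g ->
  mul_dom p q s (chart_at p x, chart_at q y).
Proof.
move=> px qy sxy; split; first by split; exact: chart_codP.
by rewrite /preimage /= !chartK.
Qed.

Lemma mul_chart_differentiable p q s z : mul_dom p q s z -> differentiable (mul_chart p q s) z.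
Proof. exact: (Ck_differentiable (mul_chart_Ck p q s 1)). Qed.

Lemma near_mul_dom p q s z : mul_dom p q s z -> \forall w \near z, mul_dom p q s w.
Proof. by move=> h; apply: open_nbhs_nbhs; split => //; exact: mul_dom_open. Qed.

Definition left_chart g q s (u : 'rV[R]_n) : 'rV[R]_n := chart_at s (g * cinv q u)%g.
Definition right_chart h p s (u : 'rV[R]_n) : 'rV[R]_n := chart_at s (cinv p u * h)%g.

Lemma left_chartE g q s p u : dom p g -> left_chart g q s u = mul_chart p q s (chart_at p g, u).
Proof. by move=> pg; rewrite /mul_chart /= chartK. Qed.

Lemma right_chartE h p s q u : dom q h -> right_chart h p s u = mul_chart p q s (u, chart_at q h).
Proof. by move=> pg; rewrite /mul_chart /= chartK. Qed.

Lemma is_diff_left_chart g q s p u : dom p g -> cod q u -> dom s (g * cinv q u)%g ->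
  differentiable (left_chart g q s) u /\
  (forall w, 'd (left_chart g q s) u w = 'd (mul_chart p q s) (chart_at p g, u) (0, w)).
Proof.
move=> pg qu sgu.
have zd : mul_dom p q s (chart_at p g, u).
  by split; [split => //; exact: chart_codP|rewrite /preimage /= chartK].
have -> : left_chart g q s = mul_chart p q s \o (fun u => (chart_at p g, u)).
  by apply/funext => v; rewrite (left_chartE _ _ _ pg).
have dm := mul_chart_differentiable zd.
have dp : is_diff u (fun u : 'rV[R]_n => (chart_at p g, u)) (fun w => (0, w)).
  by apply: is_diff_eq.
split; first exact: differentiable_comp.
by move=> w; rewrite diff_comp//= diff_val.
Qed.

Lemma is_diff_right_chart h p s q u : dom q h -> cod p u -> dom s (cinv p u * h)%g ->
  differentiable (right_chart h p s) u /\
  (forall w, 'd (right_chart h p s) u w = 'd (mul_chart p q s) (u, chart_at q h) (w, 0)).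
Proof.
move=> pg qu sgu.
have zd : mul_dom p q s (u, chart_at q h).
  by split; [split => //; exact: chart_codP|rewrite /preimage /= chartK].
have -> : right_chart h p s = mul_chart p q s \o (fun u => (u, chart_at q h)).
  by apply/funext => v; rewrite (right_chartE _ _ _ pg).
have dm := mul_chart_differentiable zd.
have dp : is_diff u (fun u : 'rV[R]_n => (u, chart_at q h)) (fun w => (w, 0)).
  by apply: is_diff_eq.
split; first exact: differentiable_comp.
by move=> w; rewrite diff_comp//= diff_val.
Qed.

(** The translating element varies too: read in the chart at its limit [g0], it becomes the first
    argument of [mul_chart], and continuity of a partial differential applies. *)
Lemma left_diff_cvg (T : Type) (F : set_system T) {FF : Filter F}
    (g : T -> G) (u w : T -> 'rV[R]_n) q s g0 u0 w0 :
  g @ F --> g0 -> u @ F --> u0 -> w @ F --> w0 -> cod q u0 -> dom s (g0 * cinv q u0)%g ->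
  (fun t => 'd (left_chart (g t) q s) (u t) (w t)) @ F --> 'd (left_chart g0 q s) u0 w0.
Proof.
move=> gg uu ww qu sg.
have dg := chart_at_dom g0.
have zd : mul_dom g0 q s (chart_at g0 g0, u0).
  by split; [split => //; exact: chart_codP|rewrite /preimage /= chartK].
pose z t := (chart_at g0 (g t), u t).
have cz : z @ F --> (chart_at g0 g0, u0).
  have c1 : (chart_at g0 \o g) @ F --> chart_at g0 g0.
    exact: cvg_comp gg (chart_cont dg).
  exact: cvg_pair c1 uu.
have ng : \forall t \near F, dom g0 (g t) by apply: gg; exact: near_dom.
have nz : \forall t \near F, mul_dom g0 q s (z t) by apply: cz; exact: near_mul_dom.
have E : \forall t \near F, 'd (mul_chart g0 q s) (z t) (0, w t) = 'd (left_chart (g t) q s) (u t) (w t).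
  apply: filterS2 ng nz => t dt zt.
  have sd : dom s (g t * cinv q (u t))%g by have := zt.2; rewrite /preimage /= chartK.
  exact: (esym ((is_diff_left_chart dt zt.1.2 sd).2 (w t))).
apply: (cvg_to_eq FF E (esym ((is_diff_left_chart dg qu sg).2 w0))).
exact: (diff_pairr_cvg FF (@mul_dom_open g0 q s) zd (mul_chart_Ck g0 q s 1) cz ww).
Qed.

Lemma right_diff_cvg (T : Type) (F : set_system T) {FF : Filter F}
    (h : T -> G) (u w : T -> 'rV[R]_n) p s h0 u0 w0 :
  h @ F --> h0 -> u @ F --> u0 -> w @ F --> w0 -> cod p u0 -> dom s (cinv p u0 * h0)%g ->
  (fun t => 'd (right_chart (h t) p s) (u t) (w t)) @ F --> 'd (right_chart h0 p s) u0 w0.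
Proof.
move=> hh uu ww pu sh.
have dh := chart_at_dom h0.
have zd : mul_dom p h0 s (u0, chart_at h0 h0).
  by split; [split => //; exact: chart_codP|rewrite /preimage /= chartK].
pose z t := (u t, chart_at h0 (h t)).
have cz : z @ F --> (u0, chart_at h0 h0).
  have c1 : (chart_at h0 \o h) @ F --> chart_at h0 h0.
    exact: cvg_comp hh (chart_cont dh).
  exact: cvg_pair uu c1.
have nh : \forall t \near F, dom h0 (h t) by apply: hh; exact: near_dom.
have nz : \forall t \near F, mul_dom p h0 s (z t) by apply: cz; exact: near_mul_dom.
have E : \forall t \near F, 'd (mul_chart p h0 s) (z t) (w t, 0) = 'd (right_chart (h t) p s) (u t) (w t).
  apply: filterS2 nh nz => t dt zt.
  have sd : dom s (cinv p (u t) * h t)%g by have := zt.2; rewrite /preimage /= chartK.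
  exact: (esym ((is_diff_right_chart dt zt.1.1 sd).2 (w t))).
apply: (cvg_to_eq FF E (esym ((is_diff_right_chart dh pu sh).2 w0))).
exact: (diff_pairl_cvg FF (@mul_dom_open p h0 s) zd (mul_chart_Ck p h0 s 1) cz ww).
Qed.

End GroupCharts.

(** * Left logarithmic differentials *)

Section LogarithmicDifferential.
Context {R : realType} {n : nat} {G : lieGroupType R n}.
Implicit Types (p q s g h : G) (V : normedModType R).
Local Notation dom p := (chart_dom (chart_at (p : G))).
Local Notation cod p := (chart_cod (chart_at (p : G))).
Local Notation cinv p := (chart_inv (chart_at (p : G))).
Local Notation c := (chart_at (1%g : G)).
Local Notation o := (chart_at (1%g : G) 1%g).

Lemma dom11 : dom 1%g (1%g : G). Proof. exact: chart_at_dom. Qed.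
Lemma cod1o : cod 1%g o. Proof. exact/chart_codP/dom11. Qed.
Lemma cinv1o : cinv 1%g o = 1%g. Proof. exact/chartK/dom11. Qed.

Lemma cvg_cinv1 : cinv 1%g @ o --> (1%g : G).
Proof. by rewrite -[X in _ --> X]cinv1o; exact: (chart_inv_cont cod1o). Qed.

Definition conj_chart g (u : 'rV[R]_n) : 'rV[R]_n := c (g * cinv 1%g u * g^-1)%g.

Lemma conj_charto g : conj_chart g o = o.
Proof. by rewrite /conj_chart cinv1o mulg1 mulgV. Qed.

Lemma AdE g : Ad g = 'd (conj_chart g) o :> ('rV[R]_n -> 'rV[R]_n).
Proof. by rewrite /Ad /tangent_map mulg1 mulgV. Qed.

(** Conjugation is factored through a chart around [g]. This writes [Ad g] as a composite of
    differentials of translations, whose continuity in [g] is already known. *)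
Lemma diff_conj_chart g p : dom p g ->
  differentiable (conj_chart g) o /\
  forall w, Ad g w = 'd (right_chart g^-1%g p 1%g) (chart_at p g) ('d (left_chart g 1%g p) o w).
Proof.
move=> pg.
have dgo : dom p (g * cinv 1%g o)%g by rewrite cinv1o mulg1.
have [d1 e1] := is_diff_left_chart pg cod1o dgo.
have lo : left_chart g 1%g p o = chart_at p g by rewrite /left_chart cinv1o mulg1.
have d1p : dom 1%g (cinv p (chart_at p g) * g^-1)%g by rewrite chartK// mulgV; exact: dom11.
have [d2 e2] := is_diff_right_chart (chart_at_dom g^-1%g) (chart_codP pg) d1p.
have E : \forall u \near o, right_chart g^-1%g p 1%g (left_chart g 1%g p u) = conj_chart g u.
  have cg : (fun u => g * cinv 1%g u)%g @ o --> g.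
    by have := mulgl_cvg (g := g) cvg_cinv1; rewrite mulg1; apply.
  have : \forall u \near o, dom p (g * cinv 1%g u)%g by apply: cg; exact: near_dom.
  by apply: filterS => u hu; rewrite /right_chart /left_chart chartK.
by rewrite AdE; exact: (diff_comp_near_eq lo E d1 d2).
Qed.

Lemma Ad_is_linear g : linear (Ad g).
Proof. by move=> a u v; rewrite AdE linearP. Qed.

HB.instance Definition _ g := GRing.isLinear.Build R 'rV[R]_n 'rV[R]_n _ (Ad g) (Ad_is_linear g).

Lemma Ad_cvg (T : Type) (F : set_system T) {FF : Filter F} (g : T -> G) (w : T -> 'rV[R]_n) g0 w0 :
  g @ F --> g0 -> w @ F --> w0 -> (fun t => Ad (g t) (w t)) @ F --> Ad g0 w0.
Proof.
move=> gg ww; have dg := chart_at_dom g0.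
have ng : \forall t \near F, dom g0 (g t) by apply: gg; exact: near_dom.
have E : \forall t \near F, 'd (right_chart (g t)^-1%g g0 1%g) (chart_at g0 (g t))
    ('d (left_chart (g t) 1%g g0) o (w t)) = Ad (g t) (w t).
  by apply: filterS ng => t dt; exact: (esym ((diff_conj_chart dt).2 (w t))).
apply: (cvg_to_eq FF E (esym ((diff_conj_chart dg).2 w0))).
have cgg : (chart_at g0 \o g) @ F --> chart_at g0 g0 by exact: cvg_comp gg (chart_cont dg).
have dgo : dom g0 (g0 * cinv 1%g o)%g by rewrite cinv1o mulg1.
have co : (fun _ : T => o) @ F --> o by exact: cvg_cst.
have dgi : dom 1%g (cinv g0 (chart_at g0 g0) * g0^-1)%g by rewrite chartK// mulgV; exact: dom11.
exact: (right_diff_cvg (invg_cvg gg) cgg (left_diff_cvg gg co ww cod1o dgo) (chart_codP dg) dgi).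
Qed.

(** For [f] continuous at [x] the quotient is close to 1, so the chart at 1 alone tests
    differentiability at every point, with values of the differential in the Lie algebra. *)
Definition log_quot V (f : V -> G) (x y : V) : 'rV[R]_n := c ((f x)^-1 * f y)%g.

Record gdiff V (f : V -> G) (x : V) : Prop := GDiff {
  gdiff_cont : {for x, continuous f};
  gdiff_diff : differentiable (log_quot f x) x }.

Fact ldiff_key : unit. Proof. by []. Qed.
(* Locked because unification otherwise unfolds differentials. *)
Definition ldiff := locked_with ldiff_key
  (fun V (f : V -> G) (x u : V) => 'd (log_quot f x) x u).

Lemma ldiffE V (f : V -> G) (x u : V) : ldiff f x u = 'd (log_quot f x) x u.
Proof. by rewrite /ldiff unlock. Qed.

Lemma ldiff_is_linear V (f : V -> G) (x : V) : linear (ldiff f x).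
Proof. by move=> a u v; rewrite !ldiffE linearP. Qed.

HB.instance Definition _ V (f : V -> G) (x : V) :=
  GRing.isLinear.Build R V 'rV[R]_n _ (ldiff f x) (ldiff_is_linear f x).

Lemma log_quotxx V (f : V -> G) x : log_quot f x x = o.
Proof. by rewrite /log_quot mulVg. Qed.

Lemma near_log_quot V (f : V -> G) x : {for x, continuous f} ->
  \forall y \near x, dom 1%g ((f x)^-1 * f y)%g.
Proof.
move=> cf; have c1 : (fun y => (f x)^-1 * f y)%g @ x --> 1%g.
  by rewrite -(mulVg (f x)); apply: mulg_cvg => //; exact: cvg_cst.
by apply: c1; apply: near_dom; exact: dom11.
Qed.

Lemma near_log_quotK V (f : V -> G) x : {for x, continuous f} ->
  \forall y \near x, f y = (f x * cinv 1%g (log_quot f x y))%g.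
Proof.
move=> /near_log_quot; apply: filterS => y dy.
by rewrite /log_quot chartK// mulVKg.
Qed.

(** Together with [diff_chart_gdiff], it translates between [gdiff] and the charts in which
    smoothness and rectifiability are stated. *)
Lemma gdiff_chart V (f : V -> G) x p : {for x, continuous f} -> dom p (f x) ->
  differentiable (chart_at p \o f) x ->
  gdiff f x /\ forall u, ldiff f x u =
    'd (left_chart (f x)^-1%g p 1%g) (chart_at p (f x)) ('d (chart_at p \o f) x u).
Proof.
move=> cf pf df.
have E : \forall y \near x, left_chart (f x)^-1%g p 1%g ((chart_at p \o f) y) = log_quot f x y.
  have : \forall y \near x, dom p (f y) by apply: cf; exact: near_dom.
  by apply: filterS => y dy; rewrite /= /left_chart chartK.
have d1 : dom 1%g ((f x)^-1 * cinv p (chart_at p (f x)))%g by rewrite chartK// mulVg; exact: dom11.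
have [d2 _] := is_diff_left_chart (chart_at_dom (f x)^-1%g) (chart_codP pf) d1.
have [d3 e3] := diff_comp_near_eq erefl E df d2; split; first by split; [exact: cf|exact: d3].
by move=> u; rewrite ldiffE; exact: e3.
Qed.

Lemma diff_chart_gdiff V (f : V -> G) x p : gdiff f x -> dom p (f x) ->
  differentiable (chart_at p \o f) x /\
  forall u, 'd (chart_at p \o f) x u = 'd (left_chart (f x) 1%g p) o (ldiff f x u).
Proof.
move=> [cf df] pf.
have E : \forall y \near x, left_chart (f x) 1%g p (log_quot f x y) = (chart_at p \o f) y.
  by apply: filterS (near_log_quotK cf) => y E1; rewrite /left_chart -E1.
have dgo : dom p (f x * cinv 1%g o)%g by rewrite cinv1o mulg1.
have [d2 _] := is_diff_left_chart pf cod1o dgo.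
have [d3 e3] := diff_comp_near_eq (log_quotxx f x) E df d2.
by split; [exact: d3|move=> u; rewrite ldiffE; exact: e3].
Qed.

Lemma diff_left_chart1 (w : 'rV[R]_n) : 'd (left_chart (1%g : G) 1%g 1%g) o w = w.
Proof.
have E : \forall u \near o, u = left_chart (1%g : G) 1%g 1%g u.
  by apply: filterS (near_cod cod1o) => u uc; rewrite /left_chart mul1g chart_invVK.
exact: diff_near_id E w.
Qed.

Lemma diff_right_chart1 (w : 'rV[R]_n) : 'd (right_chart (1%g : G) 1%g 1%g) o w = w.
Proof.
have E : \forall u \near o, u = right_chart (1%g : G) 1%g 1%g u.
  by apply: filterS (near_cod cod1o) => u uc; rewrite /right_chart mulg1 chart_invVK.
exact: diff_near_id E w.
Qed.

Lemma mul_dom1 : mul_dom (1%g : G) 1%g 1%g (o, o).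
Proof. by apply: mul_dom_chart; rewrite ?mulg1; exact: dom11. Qed.

Lemma diff_mul_chart1 (a b : 'rV[R]_n) : 'd (mul_chart (1%g : G) 1%g 1%g) (o, o) (a, b) = a + b.
Proof.
have -> : (a, b) = (a, 0) + (0, b) :> 'rV[R]_n * 'rV[R]_n.
  by rewrite /GRing.add /= /add_pair /= addr0 add0r.
rewrite linearD; congr (_ + _).
- rewrite -[RHS]diff_right_chart1; apply: esym.
  by apply: (is_diff_right_chart dom11 cod1o _).2; rewrite cinv1o mulg1; exact: dom11.
- rewrite -[RHS]diff_left_chart1; apply: esym.
  by apply: (is_diff_left_chart dom11 cod1o _).2; rewrite cinv1o mulg1; exact: dom11.
Qed.

Lemma gdiff_comp V (V' : normedModType R) (phi : V -> V') (f : V' -> G) x :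
  differentiable phi x -> gdiff f (phi x) ->
  gdiff (f \o phi) x /\ forall u, ldiff (f \o phi) x u = ldiff f (phi x) ('d phi x u).
Proof.
move=> dphi [cf df].
have E : log_quot (f \o phi) x = log_quot f (phi x) \o phi by [].
have cphi := differentiable_continuous dphi.
split; last by move=> u; rewrite !ldiffE E (diff_comp dphi df).
split; first exact: (continuous_comp cphi cf).
by rewrite E; exact: differentiable_comp dphi df.
Qed.

Lemma gdiff_comp_is_diff V (V' : normedModType R) (phi dphi : V -> V') (f : V' -> G) x :
  is_diff x phi dphi -> gdiff f (phi x) ->
  gdiff (f \o phi) x /\ forall u, ldiff (f \o phi) x u = ldiff f (phi x) (dphi u).
Proof.
move=> [d e] df; have [d1 l1] := gdiff_comp d df; split; first exact: d1.
by move=> u; rewrite -e; exact: l1.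
Qed.

Lemma gdiff_conj V (f : V -> G) x g : gdiff f x ->
  gdiff (fun y => g * f y * g^-1)%g x /\
  forall u, ldiff (fun y => g * f y * g^-1)%g x u = Ad g (ldiff f x u).
Proof.
move=> [cf df].
have cf' : {for x, continuous (fun y => g * f y * g^-1)%g}.
  exact: (mulgr_cvg (h := g^-1%g) (mulgl_cvg (g := g) cf)).
have E : \forall y \near x, conj_chart g (log_quot f x y) = log_quot (fun y => g * f y * g^-1)%g x y.
  apply: filterS (near_log_quot cf) => y dy.
  rewrite /= /conj_chart /log_quot chartK//; congr (c _).
  by rewrite !invgM invgK -!mulgA mulKg.
have d1 := (diff_conj_chart (chart_at_dom g)).1.
have [d3 e3] := diff_comp_near_eq (log_quotxx f x) E df d1.
by split; [split; [exact: cf'|exact: d3]|move=> u; rewrite AdE !ldiffE; exact: e3].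
Qed.

(** Relative to its value at [x], the product is the quotient of [f] conjugated by [(k x)^-1], times
    the quotient of [k]. Both factors equal 1 at [x], and the differential of the product at
    [(1, 1)] is the sum. *)
Lemma gdiff_mul V (f k : V -> G) x : gdiff f x -> gdiff k x ->
  gdiff (fun y => f y * k y)%g x /\
  forall u, ldiff (fun y => f y * k y)%g x u = Ad (k x)^-1%g (ldiff f x u) + ldiff k x u.
Proof.
move=> df [ck dk].
have cfk : {for x, continuous (fun y => f y * k y)%g}.
  exact: (mulg_cvg (gdiff_cont df) ck).
have [[cf' df'] lf'] := gdiff_conj (k x)^-1%g df.
set f' := (fun y => _ * f y * _)%g in cf' df' lf'.
have E : \forall y \near x, mul_chart (1%g : G) 1%g 1%g (log_quot f' x y, log_quot k x y)
    = log_quot (fun y => f y * k y)%g x y.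
  apply: filterS2 (near_log_quot cf') (near_log_quot ck) => y d1 d2.
  rewrite /= /mul_chart /= /log_quot !chartK//; congr (c _).
  by rewrite /f' !invgM !invgK -!mulgA !mulVKg.
have dm := mul_chart_differentiable mul_dom1.
have dp : is_diff x (fun y => (log_quot f' x y, log_quot k x y))
    (fun u => ('d (log_quot f' x) x u, 'd (log_quot k x) x u)).
  by apply: is_diff_pair; apply: differentiableP.
have lxx : (log_quot f' x x, log_quot k x x) = (o, o) by rewrite !log_quotxx.
have [d3 e3] := diff_comp_near_eq (f := fun y => (log_quot f' x y, log_quot k x y)) lxx E
  (@ex_diff _ _ _ _ _ _ _ dp) dm.
split; first by split; [exact: cfk|exact: d3].
move=> u; rewrite ldiffE -lf'.
have e4 : 'd (fun y => (log_quot f' x y, log_quot k x y)) x u = (ldiff f' x u, ldiff k x u).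
  by rewrite (@diff_val _ _ _ _ _ _ _ dp) !ldiffE.
apply: etrans (e3 u) _; apply: etrans (congr1 _ e4) _; exact: diff_mul_chart1.
Qed.

Lemma gdiff_translate V (f : V -> G) x g : gdiff f x ->
  gdiff (fun y => g * f y)%g x /\
  forall u, ldiff (fun y => g * f y)%g x u = ldiff f x u.
Proof.
have E : log_quot (fun y => g * f y)%g x = log_quot f x.
  by apply/funext => y; rewrite /log_quot invgM -mulgA mulKg.
move=> [cf df]; split; last by move=> u; rewrite !ldiffE E.
by split; [exact: (mulgl_cvg (g := g) cf)|rewrite E].
Qed.

Lemma Ad1 (w : 'rV[R]_n) : Ad (1%g : G) w = w.
Proof.
rewrite AdE; have E : \forall u \near o, u = conj_chart (1%g : G) u.
  by apply: filterS (near_cod cod1o) => u uc; rewrite /conj_chart mul1g invg1 mulg1 chart_invVK.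
exact: diff_near_id E w.
Qed.

Lemma AdM g h (w : 'rV[R]_n) : Ad (g * h)%g w = Ad g (Ad h w).
Proof.
have E : \forall u \near o, conj_chart g (conj_chart h u) = conj_chart (g * h)%g u.
  have ch : (fun u => h * cinv 1%g u * h^-1)%g @ o --> 1%g.
    by have := mulgr_cvg (h := h^-1%g) (mulgl_cvg (g := h) cvg_cinv1); rewrite mulg1 mulgV; apply.
  have : \forall u \near o, dom 1%g (h * cinv 1%g u * h^-1)%g by apply: ch; apply: near_dom; exact: dom11.
  apply: filterS => u hu; rewrite /= /conj_chart chartK//; congr (c _).
  by rewrite invgM !mulgA.
have dg := (diff_conj_chart (chart_at_dom g)).1.
have dh := (diff_conj_chart (chart_at_dom h)).1.
rewrite !AdE; exact: (diff_comp_near_eq (conj_charto h) E dh dg).2.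
Qed.

End LogarithmicDifferential.

(** The supremum of the [x] with [P a x] can be passed by the local hypothesis unless it is [b].
    This serves relations that can only be checked on short pieces of a curve. *)
Lemma itv_local_to_global (R : realType) (P : R -> R -> Prop) (a b : R) : a <= b ->
  (forall s t u, P s t -> P t u -> P s u) ->
  (forall t, a <= t <= b -> exists2 d, 0 < d & forall s u, a <= s -> s <= u -> u <= b ->
     `|s - t| < d -> `|u - t| < d -> P s u) ->
  P a b.
Proof.
move=> ab Ptrans Ploc.
pose S := [set x | a <= x <= b /\ P a x].
have Paa : P a a.
  have [|d d0 h] := Ploc a; first by rewrite lexx ab.
  by apply: h; rewrite ?subrr ?normr0.
have supS : has_sup S.
  by split; [exists a; split => //; rewrite lexx|exists b => x [/andP[]]].
pose t := sup S.
have at_ : a <= t by apply: ub_le_sup; [case: supS|split => //; rewrite lexx].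
have tb : t <= b by apply: ge_sup; [case: supS|move=> x [/andP[]]].
have [|d d0 hd] := Ploc t; first by rewrite at_.
have [s [/andP[as_ sb] Pas] ts] := sup_adherent d0 supS.
have st : s <= t by apply: ub_le_sup; [case: supS|split => //; rewrite as_].
pose u := Num.min b (t + d / 2).
have d20 : 0 < d / 2 by lra.
have tu : t <= u by rewrite /u le_min tb; lra.
have ub : u <= b by rewrite /u ge_min lexx.
have ut2 : u <= t + d / 2 by rewrite /u ge_min lexx orbT.
have Pau : P a u.
  apply: Ptrans Pas _; apply: hd => //; first by lra.
    by rewrite ltr_norml; apply/andP; split; rewrite -/t in ts; lra.
  by rewrite ltr_norml; apply/andP; split; lra.
have ut : u <= t by apply: ub_le_sup; [case: supS|split => //; apply/andP; split; lra].
suff <- : u = b by [].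
move: ut; rewrite /u; case: (leP b (t + d / 2)) => // _ ?; lra.
Qed.

(** * Homomorphisms from the line: regularity and uniqueness *)

Section OneParameterSubgroups.
Context {R : realType} {n : nat} {G : lieGroupType R n}.
Implicit Types (g h : G) (f k : R -> G).

Lemma ldiff0_cst f : (forall t, gdiff f t) -> (forall t, ldiff f t 1 = 0) -> forall s t, f s = f t.
Proof.
move=> df lf; suff H s t : s <= t -> f s = f t.
  by move=> s t; have [/H|/ltW/H] := leP s t.
move=> st; apply: (@itv_local_to_global R (fun s t => f s = f t) s t st); first by move=> ? ? ? -> ->.
move=> t0 _; have dp := chart_at_dom (f t0).
have /nbhs_ballP[d /= d0 hd] : \forall y \near t0, chart_dom (chart_at (f t0)) (f y).
  by apply: (gdiff_cont (df t0)); exact: near_dom.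
exists d => // x y _ xy _ xd yd.
have inb z : x <= z <= y -> chart_dom (chart_at (f t0)) (f z).
  move=> /andP[xz zy]; apply: hd; rewrite /ball /= distrC.
  move: xd yd; rewrite !ltr_norml => /andP[? ?] /andP[? ?]; apply/andP; split; lra.
have hder z : x <= z <= y -> is_derive z (1 : R) (chart_at (f t0) \o f) (cst 0 z).
  move=> /inb dz; have [d1 e1] := diff_chart_gdiff (df z) dz.
  split; first exact: diff_derivable d1.
  by rewrite (deriveE _ d1) e1 lf linear0.
have := @mean_value_le R n (chart_at (f t0) \o f) (cst 0) x y 0 xy (lexx 0) hder.
rewrite mul0r normr_le0 subr_eq0 => H.
have /eqP Exy : chart_at (f t0) (f y) == chart_at (f t0) (f x) by apply: H => z _; rewrite normr0.
by rewrite -(chartK (inb x _)) ?lexx ?xy// -(chartK (inb y _)) ?lexx ?xy// Exy.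
Qed.

Definition hom f := forall s t, f (s + t) = (f s * f t)%g.

Lemma hom0 f : hom f -> f 0 = 1%g.
Proof. by move=> hf; have := hf 0 0; rewrite addr0 => E; rewrite -(mulVg (f 0)) {3}E mulKg. Qed.

Lemma homN f t : hom f -> f (- t) = (f t)^-1%g.
Proof.
by move=> hf; have := hf (- t) t; rewrite addNr hom0// => E; rewrite -(mulgK (f t) (f (- t))) -E mul1g.
Qed.

Lemma hom_gdiff f : hom f -> gdiff f 0 -> forall t, gdiff f t /\ forall u, ldiff f t u = ldiff f 0 u.
Proof.
move=> hf df t.
pose phi (y : R) : R := y - t.
have d0 : is_diff t ((id : R -> R) - cst t) (id - 0) by exact: is_diffB.
have dphi : is_diff t phi id by apply: (is_diff_eq d0); rewrite subr0.
have phit : phi t = 0 by rewrite /phi subrr.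
have df' : gdiff f (phi t) by rewrite phit.
have [d1 l1] := gdiff_comp_is_diff dphi df'.
have E : (fun y => f t * (f \o phi) y)%g = f.
  by apply/funext => y; rewrite /= -hf /phi addrC subrK.
have := gdiff_translate (f t) d1; rewrite E => -[d2 l2]; split; first exact d2.
move=> u; rewrite l2; apply: etrans (l1 u) _.
by clear -phit; rewrite phit.
Qed.

(** [f t] commutes with every [f y], so conjugation by it leaves the curve [f] unchanged. *)
Lemma hom_Ad f t u : hom f -> gdiff f 0 -> Ad (f t) (ldiff f 0 u) = ldiff f 0 u.
Proof.
move=> hf df; have [_ l1] := gdiff_conj (f t) df.
rewrite -l1; congr (ldiff _ 0 u); apply/funext => y.
by rewrite -hf -homN// -hf addrAC subrr add0r.
Qed.

Lemma gdiff_opp f t : gdiff f (- t) ->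
  gdiff (fun s => f (- s)) t /\ forall u, ldiff (fun s => f (- s)) t u = ldiff f (- t) (- u).
Proof.
move=> df; have dphi : is_diff t (fun s : R => - s) -%R by exact: is_diffN.
exact: (gdiff_comp_is_diff dphi df).
Qed.

(** With [v] the common velocity, the curve [f s * k (- s)] has logarithmic derivative
    [Ad (k s) v - v], which vanishes by [hom_Ad]; so it stays at its initial value 1. *)
Lemma hom_unique f k : hom f -> hom k -> gdiff f 0 -> gdiff k 0 ->
  ldiff f 0 1 = ldiff k 0 1 -> f =1 k.
Proof.
move=> hf hk df dk E t.
have dft := hom_gdiff hf df; have dkt := hom_gdiff hk dk.
have D s : gdiff (fun s => f s * k (- s))%g s /\ ldiff (fun s => f s * k (- s))%g s 1 = 0.
  have [d1 l1] := gdiff_opp (dkt (- s)).1.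
  have [d2 l2] := gdiff_mul (dft s).1 d1; split; first exact d2.
  have e1 := etrans (l1 1) ((dkt (- s)).2 (-1)); rewrite linearN in e1.
  have e2 := etrans ((dft s).2 1) E.
  apply: etrans (l2 1) _; rewrite e1 e2 -(homN _ hk) opprK.
  by rewrite (hom_Ad _ _ hk dk) subrr.
have := ldiff0_cst (fun s => (D s).1) (fun s => (D s).2) t 0.
rewrite oppr0 !hom0// mulg1 homN// => H.
by rewrite -(mulgVK (k t) (f t)) H mul1g.
Qed.

Lemma one_parameter_subgroup_hom (gamma : R -> G) v : one_parameter_subgroup gamma v ->
  [/\ hom gamma, gdiff gamma 0 & ldiff gamma 0 1 = v].
Proof.
move=> [hg [cg sg] vg]; have g0 := hom0 hg.
have c0 : {for (0 : R), continuous gamma} := cg 0 I.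
have d0 : differentiable (chart_at 1%g \o gamma : R -> 'rV[R]_n) 0.
  apply: (Ck_differentiable (sg 1%g 1)); split => //=.
  by rewrite /preimage /= g0; exact: dom11.
have dg : chart_dom (chart_at 1%g) (gamma 0) by rewrite g0; exact: dom11.
have [d1 l1] := gdiff_chart c0 dg d0; split; [exact hg|exact d1|].
rewrite l1 g0 invg1 diff_left_chart1 -(deriveE _ d0).
by rewrite -vg /velocity g0.
Qed.

Lemma one_parameter_subgroup_scale (gamma : R -> G) v m :
  one_parameter_subgroup gamma v -> one_parameter_subgroup (fun t => gamma (m * t)) (m *: v).
Proof.
move=> ops; have [hg dg lg] := one_parameter_subgroup_hom ops.
case: ops => [_ [cg sg] vg].
have cm (x : R) : {for x, continuous (fun t : R => m * t)} by exact: mulrl_continuous.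
split; first by move=> s t; rewrite mulrDr hg.
  split=> [x _|p k].
    have cgx : {for (m * x : R), continuous gamma} := cg (m * x) I.
    exact: (continuous_comp (cm x) cgx).
  exact: (Ck_scale m (sg p k)).
have dphi : is_diff (0 : R) (fun t : R => m * t) ( *%R m) by exact: is_diff_scaler.
have dg' : gdiff gamma (m * 0) by rewrite mulr0.
have [d1 l1] := gdiff_comp_is_diff dphi dg'.
have g0 : gamma (m * 0) = 1%g by rewrite mulr0 hom0.
have dp : chart_dom (chart_at 1%g) ((gamma \o (fun t : R => m * t)) 0) by rewrite /= g0; exact: dom11.
have [d2 l2] := diff_chart_gdiff d1 dp.
rewrite /velocity g0 (deriveE _ d2) l2 /= g0 diff_left_chart1 l1.
rewrite mulr0 -[m * 1]/(m *: (1 : R)).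
by rewrite linearZ /= lg.
Qed.

Lemma one_parameter_subgroup0 : one_parameter_subgroup (fun _ => 1%g : G) 0.
Proof.
split; first by move=> s t; rewrite mulg1.
  split=> [x _|p k]; first exact: cvg_cst.
  have Ck_cst j (W : normedModType R) (U : set R^o) (a : W) : Ck j U (cst a : R^o -> W).
    elim: j W a => [|j IH] W a; first by move=> x _; exact: cvg_cst.
    split; first by move=> x _; exact: differentiable_cst.
    move=> v; have -> : 'D_v (cst a : R^o -> W) = cst 0 by apply/funext => x; exact: derive_cst.
    exact: IH.
  exact: Ck_cst.
by rewrite /velocity; exact: derive_cst.
Qed.

End OneParameterSubgroups.

(** * The Lie bracket as the derivative of Ad *)

Section AdjointDerivative.
Context {R : realType} {n : nat} {G : lieGroupType R n}.
Local Notation dom p := (chart_dom (chart_at (p : G))).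
Local Notation cod p := (chart_cod (chart_at (p : G))).
Local Notation cinv p := (chart_inv (chart_at (p : G))).
Local Notation o := (chart_at (1%g : G) 1%g).
Local Notation m := (mul_chart (1%g : G) 1%g 1%g).

Lemma linear_pair_sub (L1 L2 : {linear ('rV[R]_n * 'rV[R]_n)%type -> 'rV[R]_n}) :
  linear (fun y : 'rV[R]_n => L1 (0, y) - L2 (y, 0)).
Proof.
move=> a y z.
have -> : ((0, a *: y + z) : 'rV[R]_n * 'rV[R]_n) = a *: (0, y) + (0, z).
  by rewrite -[RHS]/((a *: 0 + 0, a *: y + z)) scaler0 addr0.
have -> : ((a *: y + z, 0) : 'rV[R]_n * 'rV[R]_n) = a *: (y, 0) + (z, 0).
  by rewrite -[RHS]/((a *: y + z, a *: 0 + 0)) scaler0 addr0.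
by rewrite (linearP L1) (linearP L2) scalerBr opprD addrACA.
Qed.

Lemma diff_pairB (W : normedModType R) (K : 'rV[R]_n * 'rV[R]_n -> W) z (a b : 'rV[R]_n) :
  'd K z (a, - b) = 'd K z (a, 0) - 'd K z (0, b).
Proof.
have -> : (a, - b) = (a, 0) - (0, b) :> 'rV[R]_n * 'rV[R]_n.
  by rewrite -[RHS]/((a - 0, 0 - b)) subr0 sub0r.
by rewrite linearB.
Qed.

Lemma diff_slice (W : normedModType R) (K : 'rV[R]_n * 'rV[R]_n -> W) (x y : 'rV[R]_n) :
  differentiable K (x, y) ->
  differentiable (fun u => K (u, y)) x /\ forall a, 'd (fun u => K (u, y)) x a = 'd K (x, y) (a, 0).
Proof.
move=> dK.
have dp : is_diff x (fun u : 'rV[R]_n => (u, y)) (fun w => (w, 0)) by exact: is_diff_eq.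
exact: (diff_comp_is_diff erefl dp dK).
Qed.

Lemma differentiable_derive_mul a : differentiable ('D_a m) (o, o).
Proof. exact: (Ck_differentiable (Ck_derive a (mul_chart_Ck _ _ _ 2)) mul_dom1). Qed.

Lemma left_invariant_fieldE v u :
  left_invariant_field (G := G) v u = 'd (left_chart (cinv 1%g u) 1%g 1%g) o v.
Proof. by []. Qed.

(** The field is a partial derivative of the product in coordinates, so the bracket becomes an
    expression in the second derivatives of [m] at [(o, o)]. *)
Lemma near_left_invariant_field v :
  \forall u \near o, 'D_(0, v) m (u, o) = left_invariant_field (G := G) v u.
Proof.
apply: filterS (near_cod cod1o) => u uc.
have du : dom 1%g (cinv 1%g u) by exact: chart_domP.
have duo : dom 1%g (cinv 1%g u * cinv 1%g o)%g by rewrite cinv1o mulg1.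
have [_ e] := is_diff_left_chart du cod1o duo.
have dmu : differentiable m (u, o).
  apply: mul_chart_differentiable; split; first by split; [exact: uc|exact: cod1o].
  exact: duo.
rewrite (deriveE _ dmu); apply: esym; have := e v; rewrite chart_invVK//.
Qed.

Lemma left_invariant_fieldo v : left_invariant_field (G := G) v o = v.
Proof.
rewrite -(nbhs_singleton (near_left_invariant_field v)).
rewrite (deriveE _ (mul_chart_differentiable mul_dom1)).
by apply: etrans (diff_mul_chart1 _ _) _; rewrite add0r.
Qed.

Lemma derive_left_invariant_field v w :
  differentiable (left_invariant_field (G := G) w) o /\
  'd (left_invariant_field (G := G) w) o v = 'd ('D_(0, w) m) (o, o) (v, 0).
Proof.
have [d e] := diff_slice (differentiable_derive_mul (0, w)).
have [d1 e1] := diff_near_eq (near_left_invariant_field w) d.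
by split; [exact: d1|rewrite e1; exact: e].
Qed.

Lemma lie_bracketE v w : lie_bracket (G := G) v w =
  'd ('D_(0, w) m) (o, o) (v, 0) - 'd ('D_(0, v) m) (o, o) (w, 0).
Proof.
have [d1 e1] := derive_left_invariant_field v w.
have [d2 e2] := derive_left_invariant_field w v.
rewrite /lie_bracket /field_bracket !left_invariant_fieldo.
congr (_ - _); [exact: (etrans (deriveE v d1) e1)|exact: (etrans (deriveE w d2) e2)].
Qed.

Lemma diff_derive_mulC v w :
  'd ('D_(w, 0) m) (o, o) (0, v) = 'd ('D_(0, v) m) (o, o) (w, 0).
Proof.
have S := schwarz (w, 0) (0, v) (@mul_dom_open _ _ G 1%g 1%g 1%g) mul_dom1 (mul_chart_Ck (1%g : G) 1%g 1%g 2).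
exact: (etrans (esym (deriveE _ (differentiable_derive_mul (w, 0))))
  (etrans S (deriveE _ (differentiable_derive_mul (0, v))))).
Qed.

Lemma lie_bracketC v w : lie_bracket (G := G) v w = - lie_bracket (G := G) w v.
Proof. by rewrite !lie_bracketE opprB. Qed.

Lemma lie_bracket_linear x : linear (lie_bracket (G := G) x).
Proof.
have E y : lie_bracket (G := G) x y =
    'd ('D_(x, 0) m) (o, o) (0, y) - 'd ('D_(0, x) m) (o, o) (y, 0).
  by rewrite lie_bracketE; congr (_ - _); apply: esym; exact: diff_derive_mulC.
move=> a y z; rewrite !E.
exact: (linear_pair_sub ('d ('D_(x, 0) m) (o, o)) ('d ('D_(0, x) m) (o, o)) a y z).
Qed.

HB.instance Definition _ x := GRing.isLinear.Build R 'rV[R]_n 'rV[R]_n _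
  (lie_bracket (G := G) x) (lie_bracket_linear x).

(** Since [m (u, o) = u] near [o], the second derivative in the left variable alone vanishes. *)
Lemma derive_mul_left v w : 'd ('D_(w, 0) m) (o, o) (v, 0) = 0.
Proof.
have [d e] := diff_slice (differentiable_derive_mul (w, 0)).
rewrite -e.
have E : \forall u \near o, 'D_(w, 0) m (u, o) = cst w u.
  apply: filterS (near_cod cod1o) => u uc.
  have duo : dom 1%g (cinv 1%g u * cinv 1%g o)%g by rewrite cinv1o mulg1; exact: chart_domP.
  have dmu : differentiable m (u, o).
    apply: mul_chart_differentiable; split; first by split; [exact: uc|exact: cod1o].
    exact: duo.
  rewrite (deriveE _ dmu).
  have [d1 e1] := diff_slice dmu; rewrite -e1; apply: diff_near_id.
  apply: filterS (near_cod uc) => y yc; rewrite /mul_chart /= cinv1o mulg1 chart_invVK//.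
have [_ e3] := diff_near_eq E d.
by rewrite -e3 diff_cst.
Qed.

(** In coordinates [Ad (f t) w] is the left partial differential of [m] at [(x t, x (- t))], applied
    to the value [Y t] of the left invariant field of [w]. Splitting [Y t = w + (Y t - w)] gives
    [E1 + E2]. The derivative of [E1] is a mixed second derivative of [m], with a minus sign from
    [x (- t)]; that of [E2] is the derivative of the field. Their sum is [lie_bracketE], after
    Schwarz. *)
Lemma is_derive_Ad (f : R -> G) w : hom f -> gdiff f 0 ->
  is_derive (0 : R) (1 : R) (fun t => Ad (f t) w) (lie_bracket (G := G) (ldiff f 0 1) w).
Proof.
move=> hf df; set v := ldiff f 0 1.
have f0 := hom0 hf.
pose x (t : R) : 'rV[R]_n := chart_at (1%g : G) (f t).
have x0 : x 0 = o by rewrite /x f0.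
have df0 : dom 1%g (f 0) by rewrite f0; exact: dom11.
have [dx ex] := diff_chart_gdiff df df0.
have ex1 : 'd x 0 1 = v by apply: etrans (ex 1) _; rewrite f0; exact: diff_left_chart1.
have dxN : is_derive (0 : R) (1 : R) (fun t => x (- t)) (- v).
  have dN : is_diff (0 : R) (fun s : R => - s) -%R by exact: is_diffN.
  have xN0 : - (0 : R) = 0 by rewrite oppr0.
  have [d e] := diff_comp_is_diff xN0 dN dx.
  split; first exact: diff_derivable d.
  rewrite (deriveE _ d); apply: etrans (e 1) _.
  by rewrite linearN ex1.
pose z t := (x t, x (- t)).
have z0 : z 0 = (o, o) by rewrite /z oppr0 x0.
have dz : differentiable z 0.
  by apply: differentiable_pair => //; apply/derivable1_diffP; case: dxN.
have dz1 : 'd z 0 1 = (v, - v).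
  rewrite diff_pair //=; last by apply/derivable1_diffP; case: dxN.
  congr (_, _); first exact: ex1.
  rewrite -deriveE; first by case: dxN.
  by apply/derivable1_diffP; case: dxN.
have cz : {for (0 : R), continuous z} by exact: differentiable_continuous.
pose Y t := left_invariant_field (G := G) w (x t).
have Y0 : Y 0 = w by rewrite /Y x0 left_invariant_fieldo.
pose B := 'd ('D_(0, w) m) (o, o) (v, 0).
have dY : is_derive (0 : R) (1 : R) Y B.
  have [d1 e1] := derive_left_invariant_field v w.
  have [d e] := diff_comp_is_diff x0 (differentiableP dx) d1.
  split; first exact: diff_derivable d.
  by rewrite (deriveE _ d); apply: etrans (e 1) _; rewrite ex1.
pose E1 t := 'D_(w, 0) m (z t).
have dE1 : is_derive (0 : R) (1 : R) E1 (- 'd ('D_(0, v) m) (o, o) (w, 0)).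
  have [d e] := diff_comp_is_diff z0 (differentiableP dz) (differentiable_derive_mul (w, 0)).
  split; first exact: diff_derivable d.
  rewrite (deriveE _ d); apply: etrans (e 1) _.
  rewrite dz1; apply: etrans (diff_pairB _ _ _ _) _.
  apply: etrans (f_equal2 (fun a b => a - b) (derive_mul_left v w) (diff_derive_mulC v w)) _.
  exact: sub0r.
(* The vector [Y t - w] vanishes at 0, so the difference quotient of [E2] is the differential
   applied to that of [Y]: its limit only uses continuity of the first derivatives of [m]. *)
pose E2 t := 'd m (z t) (Y t - w, 0).
have dE2 : is_derive (0 : R) (1 : R) E2 B.
  have E20 : E2 0 = 0 by rewrite /E2 Y0 subrr; exact: linear0.
  have zc : z @ 0^' --> (o, o).
    by rewrite -z0; apply: cvg_trans cz; apply: cvg_app; exact: cvg_within.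
  have Yc := (is_derive0P Y B).1 dY; rewrite Y0 in Yc.
  have H := diff_pairl_cvg _ (@mul_dom_open _ _ G 1%g 1%g 1%g) mul_dom1 (mul_chart_Ck (1%g : G) 1%g 1%g 1) zc Yc.
  apply/(is_derive0P E2 B); rewrite E20.
  have eB : 'd m (o, o) (B, 0) = B by apply: etrans (diff_mul_chart1 _ _) _; rewrite addr0.
  have eh (h : R) : 'd m (z h) (h^-1 *: (Y h - w), 0) = h^-1 *: (E2 h - 0).
    rewrite subr0 /E2 -linearZ; congr ('d m (z h) _).
    by rewrite /GRing.scale /= /scale_pair /= scaler0.
  rewrite -[X in _ --> X]eB -(funext eh); apply: H.
have nE : \forall t \near (0 : R), E1 t + E2 t = Ad (f t) w.
  have n1 : \forall t \near (0 : R), dom 1%g (f t).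
    by apply: (gdiff_cont df); apply: near_dom.
  have n2 : \forall t \near (0 : R), dom 1%g (f t)^-1%g.
    have := invg_cvg (gdiff_cont df); rewrite f0 invg1 => H.
    by apply: H; apply: near_dom; exact: dom11.
  apply: filterS2 n1 n2 => t d1 d2.
  have xN : chart_at (1%g : G) (f t)^-1%g = x (- t) by rewrite /x (homN _ hf).
  have dtt : dom 1%g (cinv 1%g (x t) * (f t)^-1)%g by rewrite /x chartK// mulgV; exact: dom11.
  have [_ er] := is_diff_right_chart d2 (chart_codP d1) dtt.
  have e0 := (diff_conj_chart d1).2 w.
  have YE : 'd (left_chart (f t) 1%g 1%g) o w = Y t.
    apply: etrans _ (esym (left_invariant_fieldE w (x t))).
    exact: (congr1 (fun g => 'd (left_chart g 1%g 1%g) o w) (esym (chartK d1))).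
  have e1 := etrans (er _) (f_equal2 (fun a b => 'd m (x t, a) (b, 0)) xN YE).
  apply: etrans _ (esym (etrans e0 e1)).
  have dmz : differentiable m (z t).
    have dff : dom 1%g (f t * (f t)^-1)%g by rewrite mulgV; exact: dom11.
    have := mul_dom_chart d1 d2 dff; rewrite xN; exact: mul_chart_differentiable.
  have e2 : 'd m (z t) (w, 0) + E2 t = 'd m (z t) (Y t, 0).
    rewrite /E2 -linearD; congr ('d m (z t) _).
    by rewrite -[LHS]/((w + (Y t - w), 0 + 0)) addr0 addrC subrK.
  exact: (etrans (congr1 (fun a => a + E2 t) (deriveE (w, 0) dmz)) e2).
apply: (near_eq_is_derive nE).
have -> : lie_bracket (G := G) v w = - 'd ('D_(0, v) m) (o, o) (w, 0) + B.
  by rewrite lie_bracketE addrC.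
exact: is_deriveD dE1 dE2.
Qed.

End AdjointDerivative.

(** * Finsler norms *)

Section FinslerNorms.
Context {R : realType} {n : nat}.
Implicit Types (x y v w : 'rV[R]_n) (N : 'rV[R]_n -> R).

Lemma linear_rV_continuous (W : normedModType R) (L : {linear 'rV[R]_n -> W}) : continuous L.
Proof.
move=> x.
have E v : L v = \sum_i v 0 i *: L (delta_mx 0 i).
  by rewrite [in LHS](row_sum_delta v) linear_sum; apply: eq_bigr => i _; rewrite linearZ.
have c i : {for x, continuous (fun v : 'rV[R]_n => v 0 i)} by exact: coord_continuous.
have H i := @cvgZr_tmp R W 'rV[R]_n (nbhs x) (nbhs_filter x) (fun v : 'rV[R]_n => v 0 i)
  (x 0 i) (L (delta_mx 0 i)) (c i).
exact: (cvg_to_eq (nbhs_filter x) (nearW _ (fun t => esym (E t))) (esym (E x)) (cvg_sum (nbhs_filter x) H)).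
Qed.

Lemma linear_rV_cvg (W : normedModType R) (L : {linear 'rV[R]_n -> W})
    (T : Type) (F : set_system T) {FF : Filter F} (x : T -> 'rV[R]_n) x0 :
  x @ F --> x0 -> (fun t => L (x t)) @ F --> L x0.
Proof. by move=> xx; exact: (cvg_comp x L xx (@linear_rV_continuous W L x0)). Qed.

Lemma linear_is_derive m (L : {linear 'rV[R]_n -> 'rV[R]_m}) (f : R -> 'rV[R]_n) t d :
  is_derive t (1 : R) f d -> is_derive t (1 : R) (fun s => L (f s)) (L d).
Proof.
move=> [df <-]; have df' := (derivable1_diffP f t).1 df.
have dL : is_diff (f t) L L.
  split; first by apply: linear_differentiable; exact: linear_rV_continuous.
  by apply: diff_lin; exact: linear_rV_continuous.
have [d1 e1] := diff_comp_is_diff erefl (differentiableP df') (@ex_diff _ _ _ _ _ _ _ dL).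
split; first exact: diff_derivable d1.
rewrite (deriveE _ d1); apply: etrans (e1 1) _.
by rewrite (@diff_val _ _ _ _ _ _ _ dL) deriveE.
Qed.

Context (N : 'rV[R]_n -> R) (NF : finsler_norm N).

Lemma finsler0 : N 0 = 0.
Proof. exact/(finsler_eq0 NF). Qed.

Lemma finsler_gt0 x : x != 0 -> 0 < N x.
Proof.
move=> x0; rewrite lt0r (finsler_ge0 NF) andbT.
by apply: contra x0 => /eqP /(finsler_eq0 NF) ->.
Qed.

Lemma finsler_sum (I : Type) (s : seq I) (f : I -> 'rV[R]_n) :
  N (\sum_(i <- s) f i) <= \sum_(i <- s) N (f i).
Proof.
elim: s => [|i s IH]; first by rewrite !big_nil finsler0.
by rewrite !big_cons (le_trans (finsler_triangle NF _ _))// lerD2l.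
Qed.

(** [N] is homogeneous for nonnegative scalars only; a negative [a] is paid for by [N (- x)]. *)
Lemma finslerZ_le (a : R) x : N (a *: x) <= `|a| * (N x + N (- x)).
Proof.
have [a0|a0] := leP 0 a.
  by rewrite (finsler_homogeneous NF)// (ger0_norm a0) ler_wpM2l// lerDl (finsler_ge0 NF).
have a1 : 0 <= - a by rewrite oppr_ge0 ltW.
have -> : a *: x = (- a) *: (- x) by rewrite scaleNr scalerN opprK.
by rewrite (ltr0_norm a0) (finsler_homogeneous NF)// ler_wpM2l// lerDr (finsler_ge0 NF).
Qed.

Definition finsler_bound := \sum_(i < n) (N (delta_mx 0 i) + N (- delta_mx 0 i)).

Lemma finsler_bound_ge0 : 0 <= finsler_bound.
Proof. by apply: sumr_ge0 => i _; rewrite addr_ge0// (finsler_ge0 NF). Qed.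

Lemma finsler_le x : N x <= finsler_bound * `|x|.
Proof.
rewrite [in leLHS](row_sum_delta x); apply: le_trans (finsler_sum _ _) _.
rewrite /finsler_bound mulr_suml; apply: ler_sum => i _.
apply: le_trans (finslerZ_le _ _) _; rewrite mulrC ler_wpM2l ?norm_coord//.
by rewrite addr_ge0// (finsler_ge0 NF).
Qed.

Lemma finsler_dist x y : `|N x - N y| <= finsler_bound * `|x - y|.
Proof.
have h u v : N u - N v <= finsler_bound * `|u - v|.
  rewrite lerBlDl; apply: le_trans (lerD (lexx _) (finsler_le _)).
  by apply: le_trans (finsler_triangle NF _ _); rewrite addrC subrK.
by rewrite ler_norml h lerNl opprB (le_trans (h _ _))// distrC.
Qed.

Lemma finsler_continuous : continuous N.
Proof.
suff H (x : 'rV[R]_n) : N y @[y --> nbhs x] --> N x by exact: H.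
apply/(@cvgrPdist_le _ _ _ (nbhs x) (nbhs_filter x)) => e e0.
have C0 : 0 < finsler_bound + 1 by rewrite ltr_wpDl// finsler_bound_ge0.
near=> y; apply: le_trans (finsler_dist _ _) _.
apply: (@le_trans _ _ ((finsler_bound + 1) * `|x - y|)).
  by rewrite ler_wpM2r// lerDl.
rewrite mulrC -ler_pdivlMr//; near: y.
by apply: cvgr_dist_le; [exact: cvg_id|exact: divr_gt0].
Unshelve. all: by end_near. Qed.

Lemma finsler_cvg (T : Type) (F : set_system T) {FF : Filter F} (x : T -> 'rV[R]_n) x0 :
  x @ F --> x0 -> (fun t => N (x t)) @ F --> N x0.
Proof.
have c : N y @[y --> x0] --> N x0 by exact: finsler_continuous.
by move=> xx; apply: cvg_trans c; exact: (cvg_app N xx).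
Qed.

Lemma finsler_ball_open (r : R) : open [set x | N x < r].
Proof.
apply: (@open_comp _ _ N [set y | y < r]); last exact: open_lt.
by move=> x _; exact: finsler_continuous.
Qed.

(** The constant is the minimum of [N] on the compact unit sphere. In dimension 0 the sphere is
    empty and any positive constant will do. *)
Lemma finsler_ge : exists2 k, 0 < k & forall x, k * `|x| <= N x.
Proof.
have [[x0 x01]|] := pselect (exists x0 : 'rV[R]_n, x0 != 0); last first.
  move=> h; exists 1 => // x; have [->|x0] := eqVneq x 0; last by case: h; exists x.
  by rewrite normr0 mulr0 finsler0.
pose S := [set x : 'rV[R]_n | `|x| = 1].
have S0 : S !=set0.
  exists (`|x0|^-1 *: x0); rewrite /S /= normrZ normfV normr_id mulVf// normr_eq0//.
have cS : compact S.
  apply: bounded_closed_compact.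
    by exists 1; split => // M M1 x /= ->; exact: ltW.
  have -> : S = Num.norm @^-1` [set 1] by [].
  apply: (@closed_comp _ _ (Num.norm : 'rV[R]_n -> R) [set 1]); last exact: closed_eq.
  by move=> x _; exact: norm_continuous.
have [x1 Sx1 hx1] := @compact_EVT_min _ _ N S S0 cS (continuous_subspaceT finsler_continuous).
have x1n : x1 != 0 by apply/eqP => E; move: Sx1; rewrite inE /S /= E normr0 => /eqP; rewrite eq_sym oner_eq0.
exists (N x1); first exact: finsler_gt0.
move=> x; have [->|xn] := eqVneq x 0; first by rewrite normr0 mulr0 finsler0.
have xp : 0 < `|x| by rewrite normr_gt0.
have : N x1 <= N (`|x|^-1 *: x).
  by apply: hx1; rewrite inE /S /= normrZ normfV normr_id mulVf// gt_eqF.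
rewrite (finsler_homogeneous NF) ?invr_ge0// mulrC => h.
by rewrite -ler_pdivlMr// (le_trans h)// mulrC.
Qed.

Lemma finsler_ball_compact (r : R) : compact [set x | N x <= r].
Proof.
have [k k0 hk] := finsler_ge.
apply: bounded_closed_compact; last first.
  have -> : [set x | N x <= r] = N @^-1` [set y | y <= r] by [].
  apply: (@closed_comp _ _ N [set y | y <= r]); last exact: closed_le.
  by move=> x _; exact: finsler_continuous.
exists (r / k); split => [|M rM x /= Nx]; first exact: num_real.
by apply: le_trans (ltW rM); rewrite ler_pdivlMr// mulrC (le_trans (hk x)).
Qed.

End FinslerNorms.

(** * The exponential *)

Section Exponential.
Context {R : realType} {n : nat} {G : lieGroupType R n}.
Context (N : 'rV[R]_n -> R) (NF : finsler_norm N) (r : R) (r_gt0 : 0 < r).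
Context (expB : diffeo_onto_image (M := G) [set x | N x < r] expG).
Implicit Types (g h : G) (v w x y u : 'rV[R]_n).
Local Notation e := (@expG R n G).
Local Notation dom p := (chart_dom (chart_at (p : G))).

Lemma scale_into_ball v : exists2 l : R, 0 < l & N (l *: v) < r.
Proof.
have Nv := finsler_ge0 NF v.
have p0 : 0 < N v + 1 by lra.
exists (r / (2 * (N v + 1))); first by rewrite divr_gt0// mulr_gt0.
rewrite (finsler_homogeneous NF); last by rewrite ltW// divr_gt0// mulr_gt0.
rewrite mulrAC ltr_pdivrMr ?mulr_gt0// ltr_pM2l//; lra.
Qed.

(* A vector of the ball without one-parameter subgroup is sent to [1] by the
   junk value of [expG], and so is its half: this contradicts injectivity. *)
Lemma exists_one_parameter_subgroup v : exists gamma : R -> G, one_parameter_subgroup gamma v.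
Proof.
have [->|v0] := eqVneq v 0; first by exists (fun _ => 1%g); exact: one_parameter_subgroup0.
have [l l0 hl] := scale_into_ball v.
have back (k : R) (gamma : R -> G) : k != 0 -> one_parameter_subgroup gamma (k *: v) ->
    exists gamma : R -> G, one_parameter_subgroup gamma v.
  move=> k0 hg; exists (fun t => gamma (k^-1 * t)).
  by have := one_parameter_subgroup_scale k^-1 hg; rewrite scalerA mulVf// scale1r.
have none (k : R) : k != 0 -> ~ (exists gamma : R -> G, one_parameter_subgroup gamma v) -> e (k *: v) = 1%g.
  move=> k0 h; rewrite /expG xgetPN// => gamma hg; apply: h; exact: back hg.
apply: contrapT => h.
have ln0 : l != 0 by rewrite gt_eqF.
have l2n0 : l / 2 != 0 by rewrite mulf_neq0// invr_eq0 pnatr_eq0.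
have [_ inj _ _] := expB.
have : l *: v = (l / 2) *: v.
  apply: inj.
  - by rewrite inE.
  - rewrite inE /=; apply: le_lt_trans hl; rewrite mulrC -scalerA.
    have h2 : 0 <= 2^-1 :> R by lra.
    rewrite (finsler_homogeneous NF _ h2).
    by have := finsler_ge0 NF (l *: v); lra.
  - by rewrite !none.
move/eqP; rewrite -subr_eq0 -scalerBl scaler_eq0 (negPf v0) orbF => /eqP; lra.
Qed.

(** [expG] chooses a subgroup separately for each vector [t *: v]. Uniqueness identifies the one
    chosen for [t *: v], at time 1, with the one chosen for [v], at time [t]. *)
Lemma exp_one_parameter_subgroup v :
  [/\ hom (fun t => e (t *: v)), gdiff (fun t : R => e (t *: v)) 0
    & ldiff (fun t : R => e (t *: v)) 0 1 = v].
Proof.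
have ops w : one_parameter_subgroup (xget (fun=> 1%g) [set gamma | one_parameter_subgroup gamma w] : R -> G) w.
  have [gamma hg] := exists_one_parameter_subgroup w.
  exact: (@xgetPex _ _ [set gamma | one_parameter_subgroup gamma w] (ex_intro _ gamma hg)).
pose gam w : R -> G := xget (fun=> 1%g) [set gamma | one_parameter_subgroup gamma w].
have E : (fun t => e (t *: v)) = gam v.
  apply/funext => t.
  have [h1 d1 l1] := one_parameter_subgroup_hom (ops (t *: v)).
  have [h2 d2 l2] := one_parameter_subgroup_hom (one_parameter_subgroup_scale t (ops v)).
  have := hom_unique h1 h2 d1 d2 (etrans l1 (esym l2)) 1.
  by rewrite mulr1.
by rewrite E; exact: one_parameter_subgroup_hom (ops v).
Qed.

Lemma exp_hom v : hom (fun t => e (t *: v)).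
Proof. by have [] := exp_one_parameter_subgroup v. Qed.

Lemma gdiff_exp_line v : gdiff (fun t : R => e (t *: v)) 0.
Proof. by have [] := exp_one_parameter_subgroup v. Qed.

Lemma ldiff_exp_line v : ldiff (fun t : R => e (t *: v)) 0 1 = v.
Proof. by have [] := exp_one_parameter_subgroup v. Qed.

Lemma exp_unique (f : R -> G) v t : hom f -> gdiff f 0 -> ldiff f 0 1 = v -> f t = e (t *: v).
Proof.
move=> hf df lf.
exact: (hom_unique hf (exp_hom v) df (gdiff_exp_line v) (etrans lf (esym (ldiff_exp_line v))) t).
Qed.

Lemma exp0 : e 0 = 1%g.
Proof. by have := hom0 (exp_hom 0); rewrite /= scale0r. Qed.

Lemma expN v : e (- v) = (e v)^-1%g.
Proof. by have := homN 1 (exp_hom v); rewrite scaleN1r scale1r. Qed.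

Lemma exp_half v : (e (2^-1 *: v) * e (2^-1 *: v))%g = e v.
Proof.
have h : 2^-1 + 2^-1 = 1 :> R by lra.
by have := exp_hom v 2^-1 2^-1; rewrite h scale1r => ->.
Qed.

Lemma exp_conj g v : (g * e v * g^-1)%g = e (Ad g v).
Proof.
have [d l] := gdiff_conj g (gdiff_exp_line v).
have h : hom (fun t : R => g * e (t *: v) * g^-1)%g.
  move=> s t; rewrite (exp_hom v) -!mulgA; congr (_ * (_ * _))%g.
  by rewrite mulKg.
have := exp_unique 1 h d (etrans (l 1) (congr1 (Ad g) (ldiff_exp_line v))).
by rewrite !scale1r.
Qed.

Lemma is_derive_Ad_exp v w :
  is_derive (0 : R) (1 : R) (fun t : R => Ad (e (t *: v)) w) (lie_bracket (G := G) v w).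
Proof.
have := is_derive_Ad w (exp_hom v) (gdiff_exp_line v).
by rewrite ldiff_exp_line.
Qed.

Lemma gdiff_exp_ball x : N x < r -> gdiff e x.
Proof.
move=> xr; have [[ce se] _ _ _] := expB.
have cx : {for x, continuous e} := ce x xr.
have dx : differentiable (chart_at (e x) \o e) x.
  by apply: (Ck_differentiable (se (e x) 1)); split => //; exact: chart_at_dom.
exact: (gdiff_chart cx (chart_at_dom (e x)) dx).1.
Qed.

Lemma gdiff_half (f : 'rV[R]_n -> G) x : gdiff f (2^-1 *: x) ->
  gdiff (fun y => f (2^-1 *: y)) x /\
  forall u, ldiff (fun y => f (2^-1 *: y)) x u = 2^-1 *: ldiff f (2^-1 *: x) u.
Proof.
move=> df; have dZ : is_diff x (fun y : 'rV[R]_n => 2^-1 *: y) ( *:%R 2^-1) by exact: is_diff_scaler.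
have [d l] := gdiff_comp_is_diff dZ df; split; first exact d.
by move=> u; apply: etrans (l u) _; rewrite linearZ.
Qed.

Lemma exp_halfE : (fun y => e (2^-1 *: y) * e (2^-1 *: y))%g = e.
Proof. by apply/funext => y; exact: exp_half. Qed.

Lemma gdiff_exp_half x : gdiff e (2^-1 *: x) -> gdiff e x.
Proof.
move=> /gdiff_half[d _]; rewrite -exp_halfE; exact: (gdiff_mul d d).1.
Qed.

(** Repeated halving brings any vector into the ball: properties known there by hypothesis spread to
    the whole Lie algebra through [exp_half]. *)
Lemma ball_half_ind (P : 'rV[R]_n -> Prop) :
  (forall x, N x < r -> P x) -> (forall x, P (2^-1 *: x) -> P x) -> forall x, P x.
Proof.
move=> hB hS x.
have [k hk] : exists k : nat, N ((2^-1) ^+ k *: x) < r.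
  have c : (fun k : nat => (2^-1 : R) ^+ k * N x) @ \oo --> 0 * N x.
    apply: cvgM; last exact: cvg_cst.
    by apply: cvg_expr; rewrite ger0_norm ?invr_ge0// invf_lt1// ltr1n.
  rewrite mul0r in c.
  have [k _ hk] : \forall k \near \oo, (2^-1 : R) ^+ k * N x < r.
    by apply: (cvgr_lt 0) c _ r_gt0.
  exists k; rewrite (finsler_homogeneous NF) ?exprn_ge0 ?invr_ge0//.
  exact: (hk k (leqnn k)).
elim: k x hk => [|k IH] x; first by rewrite expr0 scale1r; exact: hB.
by rewrite exprSr -scalerA => /IH; exact: hS.
Qed.

Lemma gdiff_exp x : gdiff e x.
Proof. by elim/ball_half_ind: x => x; [exact: gdiff_exp_ball|exact: gdiff_exp_half]. Qed.

Lemma exp_continuous : continuous e.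
Proof. by move=> x; exact: gdiff_cont (gdiff_exp x). Qed.

Lemma ldiff_exp_half x u : ldiff e x u =
  2^-1 *: (Ad (e (2^-1 *: x))^-1%g (ldiff e (2^-1 *: x) u) + ldiff e (2^-1 *: x) u).
Proof.
have [d l] := gdiff_half (gdiff_exp (2^-1 *: x)).
have [_ lm] := gdiff_mul d d.
have := lm u; rewrite exp_halfE l => ->.
by rewrite linearZ scalerDr.
Qed.

Lemma ldiff_exp_comp (f : R -> 'rV[R]_n) t d : is_derive t (1 : R) f d ->
  gdiff (fun s => e (f s)) t /\ ldiff (fun s => e (f s)) t 1 = ldiff e (f t) d.
Proof.
move=> [df <-]; have df' := (derivable1_diffP f t).1 df.
have [d1 l1] := gdiff_comp df' (gdiff_exp (f t)); split; first exact d1.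
by apply: etrans (l1 1) _; rewrite (deriveE _ df').
Qed.

Lemma ldiff_exp0 u : ldiff e 0 u = u.
Proof.
have df : is_derive (0 : R) (1 : R) (fun t : R => t *: u) u.
  apply/is_derive0P; rewrite scale0r.
  apply: (@cvg_trans _ ((fun _ : R => u) @ 0^')); last exact: cvg_cst.
  apply: near_eq_cvg; near=> h; rewrite subr0 scalerA mulVf ?scale1r//.
  by near: h; exact: nbhs_dnbhs_neq.
have [_ l] := ldiff_exp_comp df.
by rewrite -[RHS](ldiff_exp_line u) l scale0r.
Unshelve. all: by end_near. Qed.

(** On the ball this is smoothness of [e] read in the chart at [e x0]; elsewhere it follows from
    [ldiff_exp_half]. The map [x] stays general in the induction so that the hypothesis applies to
    half of it. *)
Lemma ldiff_exp_cvg x0 u (T : Type) (F : set_system T) {FF : Filter F} (x : T -> 'rV[R]_n) :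
  x @ F --> x0 -> (fun t => ldiff e (x t) u) @ F --> ldiff e x0 u.
Proof.
elim/ball_half_ind: x0 x => x0 H x xx0; last first.
  have xh : (fun t => 2^-1 *: x t) @ F --> 2^-1 *: x0.
    by apply: cvgZ => //; exact: cvg_cst.
  have cD := H _ xh.
  have ce : (fun t => e (2^-1 *: x t)) @ F --> e (2^-1 *: x0).
    exact: cvg_comp xh (@exp_continuous _).
  have cA := Ad_cvg (invg_cvg ce) cD.
  have Eh t := esym (ldiff_exp_half (x t) u).
  have c2 : (fun _ : T => 2^-1 : R) @ F --> (2^-1 : R) by exact: cvg_cst.
  exact: (cvg_to_eq FF (nearW _ Eh) (esym (ldiff_exp_half x0 u)) (cvgZ c2 (cvgD (cA FF FF) cD))).
have ce : (fun t => e (x t)) @ F --> e x0 by exact: cvg_comp xx0 (@exp_continuous _).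
have dp := chart_at_dom (e x0).
have [[_ se] _ _ _] := expB.
have nB : \forall t \near F, N (x t) < r.
  have oB : open [set x | N x < r] by exact: finsler_ball_open.
  exact: (xx0 _ (open_nbhs_nbhs (conj oB H))).
have nd : \forall t \near F, dom (e x0) (e (x t)) by apply: ce; exact: near_dom.
have key y : N y < r -> dom (e x0) (e y) -> ldiff e y u =
    'd (left_chart (e y)^-1%g (e x0) 1%g) (chart_at (e x0) (e y)) ('D_u (chart_at (e x0) \o e) y).
  move=> yr dy; have dc : differentiable (chart_at (e x0) \o e) y.
    by apply: (Ck_differentiable (se (e x0) 1)); split.
  by rewrite ((gdiff_chart (gdiff_cont (gdiff_exp y)) dy dc).2 u) (deriveE _ dc).
have E : \forall t \near F, 'd (left_chart (e (x t))^-1%g (e x0) 1%g) (chart_at (e x0) (e (x t)))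
    ('D_u (chart_at (e x0) \o e) (x t)) = ldiff e (x t) u.
  by apply: filterS2 nB nd => t h1 h2; exact: (esym (key _ h1 h2)).
apply: (cvg_to_eq FF E (esym (key _ H dp))).
have cc : (fun t => chart_at (e x0) (e (x t))) @ F --> chart_at (e x0) (e x0).
  exact: cvg_comp ce (chart_cont dp).
have cD0 : {for x0, continuous ('D_u (chart_at (e x0) \o e))}.
  by apply: (@Ck_continuous _ _ _ 0 _ _ _ (Ck_derive u (se (e x0) 1))); split.
have cD : (fun t => 'D_u (chart_at (e x0) \o e) (x t)) @ F --> 'D_u (chart_at (e x0) \o e) x0.
  exact: cvg_comp xx0 cD0.
apply: (left_diff_cvg (invg_cvg ce) cc cD (chart_codP dp)).
by rewrite chartK// mulVg; exact: dom11.
Qed.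

End Exponential.

(** * Elementary facts on curves of vectors *)

Section VectorCurves.
Context {R : realType} {n : nat}.

Lemma derive0_cst (f : R -> 'rV[R]_n) : (forall t, is_derive t (1 : R) f 0) -> forall s t, f s = f t.
Proof.
move=> df; suff H s t : s <= t -> f s = f t.
  by move=> s t; have [/H|/ltW/H] := leP s t.
move=> st; have h0 (z : R) : s <= z <= t -> `|0 : 'rV[R]_n| <= 0 by rewrite normr0.
have := @mean_value_le R n f (fun _ => 0) s t 0 st (lexx 0) (fun z _ => df z) h0.
by rewrite mul0r normr_le0 subr_eq0 => /eqP.
Qed.

Lemma is_derive_translate (W : normedModType R) (f : R -> W) (t : R) d :
  is_derive (0 : R) (1 : R) (fun h => f (h + t)) d <-> is_derive t (1 : R) f d.
Proof.
have E : (fun h : R => h^-1 *: ((f \o shift t) (h *: (1 : R)) - f t)) =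
  (fun h : R => h^-1 *: (((fun h => f (h + t)) \o shift 0) (h *: (1 : R)) - f (0 + t))).
  by apply/funext => h /=; rewrite addr0 add0r.
split=> [[h1 h2]|[h1 h2]]; split.
- by rewrite /derivable E.
- by rewrite /derive E.
- by rewrite /derivable -E.
- by rewrite /derive -E.
Qed.

Lemma cvg_half_powers (x : 'rV[R]_n) : (fun k => (2^-1 : R) ^+ k *: x) @ \oo --> (0 : 'rV[R]_n).
Proof.
rewrite -(scale0r x); apply: cvgZr_tmp.
by apply: cvg_expr; rewrite ger0_norm ?invr_ge0// invf_lt1// ltr1n.
Qed.

End VectorCurves.

(** * The differential of the exponential: contraction, Gauss lemma, equality case, commuting
    vectors *)

Section ExponentialGeometry.
Context {R : realType} {n : nat} {G : lieGroupType R n}.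
Context (N : 'rV[R]_n -> R) (NF : finsler_norm N) (r : R) (r_gt0 : 0 < r).
Context (expB : diffeo_onto_image (M := G) [set x | N x < r] expG).
Implicit Types (g h : G) (v w x y u : 'rV[R]_n).
Local Notation e := (@expG R n G).
Local Notation bracket := (lie_bracket (G := G)).

Let exp_hom v := exp_hom NF r_gt0 expB v.
Let is_derive_Ad_exp v w := is_derive_Ad_exp NF r_gt0 expB v w.
Let ldiff_exp_half x u := ldiff_exp_half NF r_gt0 expB x u.

Lemma ldiff_exp_half_powers x u :
  (fun k => ldiff e ((2^-1 : R) ^+ k *: x) u) @ \oo --> u.
Proof.
rewrite -[X in _ --> X](ldiff_exp0 NF r_gt0 expB u).
have H := @ldiff_exp_cvg R n G N NF r r_gt0 expB 0 u nat \oo _ _ (cvg_half_powers x).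
exact: H.
Qed.

Lemma half_powerS (k : nat) x : 2^-1 *: ((2^-1 : R) ^+ k *: x) = (2^-1 : R) ^+ k.+1 *: x.
Proof. by rewrite scalerA exprS. Qed.

Context (NAd : Ad_invariant (G := G) N).

Lemma finsler_half_add x y : N (2^-1 *: (x + y)) <= 2^-1 * (N x + N y).
Proof.
have h2 : 0 <= 2^-1 :> R by lra.
by rewrite (finsler_homogeneous NF _ h2) ler_wpM2l// (finsler_triangle NF).
Qed.

Lemma ldiff_exp_half_le x u : N (ldiff e x u) <= N (ldiff e (2^-1 *: x) u).
Proof.
rewrite ldiff_exp_half; apply: le_trans (finsler_half_add _ _) _.
rewrite NAd; move: (N _) => z; lra.
Qed.

Lemma ldiff_exp_half_powers_le x u (k : nat) :
  N (ldiff e ((2^-1 : R) ^+ k *: x) u) <= N u.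
Proof.
have cN : (fun j => N (ldiff e ((2^-1 : R) ^+ j *: x) u)) @ \oo --> N u.
  have H := finsler_cvg NF (@ldiff_exp_half_powers x u); exact: H.
have cc : (fun _ : nat => N (ldiff e ((2^-1 : R) ^+ k *: x) u)) @ \oo -->
    N (ldiff e ((2^-1 : R) ^+ k *: x) u) by exact: cvg_cst.
apply: (ler_cvg_to cc cN); exists k => // j /= kj.
elim: j kj => [|j IH]; first by rewrite leqn0 => /eqP ->.
rewrite leq_eqVlt => /predU1P[<-//|]; rewrite ltnS => /IH h.
by apply: le_trans h _; rewrite -half_powerS; exact: ldiff_exp_half_le.
Qed.

Lemma ldiff_exp_le x u : N (ldiff e x u) <= N u.
Proof. by have := ldiff_exp_half_powers_le x u 0; rewrite expr0 scale1r. Qed.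

Lemma is_derive_Ad_exp_at x y t :
  is_derive t (1 : R) (fun s : R => Ad (e (s *: x)) y) (bracket x (Ad (e (t *: x)) y)).
Proof.
apply/is_derive_translate.
have := is_derive_Ad_exp x (Ad (e (t *: x)) y).
congr (is_derive _ _ _ _); apply/funext => s.
by rewrite -AdM -exp_hom.
Qed.

(** Modulo the image of [bracket x], the curve [Ad (e (t x)) y] is constant, because its derivative
    lies in that image. The averaging formula then makes the classes of [ldiff e] at [x / 2^k] all
    equal, and they tend to the class of [u]. *)
Lemma exists_lie_bracket_ldiff x u : exists z, bracket x z = u - ldiff e x u.
Proof.
pose A : 'M[R]_n := lin1_mx (bracket x).
have AE y : y *m A = bracket x y by exact: mul_rV_lin1.
(* Right multiplication by [C] is the quotient map: its kernel is the row space of [A], that is, the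
   image of [bracket x]. *)
pose C := cokermx A.
have AdC t y : Ad (e (t *: x)) y *m C = y *m C.
  have d0 s : is_derive s (1 : R) (fun s : R => Ad (e (s *: x)) y *m C) 0.
    have E0 : mulmxr C (bracket x (Ad (e (s *: x)) y)) = 0.
      by rewrite /= -AE -mulmxA mulmx_coker mulmx0.
    have d1 := linear_is_derive (mulmxr C) (is_derive_Ad_exp_at x y s).
    by apply: (is_derive_eq d1); exact: E0.
  have := derive0_cst d0 t 0; rewrite scale0r (exp0 NF r_gt0 expB) => ->.
  by rewrite Ad1.
have step (s : R) : ldiff e (s *: x) u *m C = ldiff e (2^-1 *: (s *: x)) u *m C.
  rewrite ldiff_exp_half -scalemxAl mulmxDl -(expN NF r_gt0 expB).
  rewrite scalerA -scaleNr AdC; apply/rowP => i; rewrite !mxE; lra.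
have all k : ldiff e ((2^-1 : R) ^+ k *: x) u *m C = ldiff e x u *m C.
  elim: k => [|k IH]; first by rewrite expr0 scale1r.
  by rewrite -IH (step (2^-1 ^+ k)) half_powerS.
have cL : (fun k => ldiff e ((2^-1 : R) ^+ k *: x) u *m C) @ \oo --> u *m C.
  have H := linear_rV_cvg (L := mulmxr C) (@ldiff_exp_half_powers x u); exact: H.
have E : u *m C = ldiff e x u *m C.
  rewrite (funext all) in cL; apply: (cvg_unique _ cL); first exact: norm_hausdorff.
  exact: cvg_cst.
have : (u - ldiff e x u <= A)%MS by rewrite submxE mulmxBl -/C E subrr.
by move=> /submxP[z ->]; exists z; rewrite -AE.
Qed.

(* Gauss lemma: [d - ldiff e (f t) d] is some [bracket (f t) z], so replacing
   [f s] by [Ad (e ((s - t) z)) (f s)], of the same norm, changes the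
   derivative at [t] from [d] to [ldiff e (f t) d]. *)
Lemma gauss_lemma (f : R -> 'rV[R]_n) (t : R) d : is_derive t (1 : R) f d ->
  derivable (fun s => N (f s)) t 1 -> 'D_1 (fun s => N (f s)) t <= N (ldiff e (f t) d).
Proof.
move=> /is_derive_translate/is_derive0P df dN.
have [z hz] := exists_lie_bracket_ldiff (f t) d.
rewrite add0r in df.
have cA : (fun h : R => h^-1 *: (Ad (e (h *: z)) (f t) - f t)) @ 0^' --> bracket z (f t).
  have := (is_derive0P _ _).1 (is_derive_Ad_exp z (f t)).
  by rewrite scale0r (exp0 NF r_gt0 expB) Ad1.
have ch : (fun h : R => h *: z) @ 0^' --> (0 : 'rV[R]_n).
  rewrite -(scale0r z); apply: cvgZr_tmp; exact: nbhs_dnbhs.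
have ce : (fun h : R => e (h *: z)) @ 0^' --> e 0.
  exact: cvg_comp ch (@exp_continuous _ _ _ _ NF _ r_gt0 expB _).
have cAd : (fun h : R => Ad (e (h *: z)) (h^-1 *: (f (h + t) - f t))) @ 0^' --> d.
  rewrite -[X in _ --> X](Ad1 (G := G)) -[in X in _ --> X](exp0 NF r_gt0 expB).
  exact: Ad_cvg.
have cS : (fun h : R => h^-1 *: (Ad (e (h *: z)) (f (h + t)) - f t)) @ 0^' --> ldiff e (f t) d.
  have -> : ldiff e (f t) d = d + bracket z (f t) by rewrite lie_bracketC hz opprB addrC subrK.
  have E (h : R) : Ad (e (h *: z)) (h^-1 *: (f (h + t) - f t)) + h^-1 *: (Ad (e (h *: z)) (f t) - f t) =
      h^-1 *: (Ad (e (h *: z)) (f (h + t)) - f t).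
    by rewrite linearZ linearB -scalerDr addrA subrK.
  have nE : \forall h \near 0^', Ad (e (h *: z)) (h^-1 *: (f (h + t) - f t)) +
      h^-1 *: (Ad (e (h *: z)) (f t) - f t) = h^-1 *: (Ad (e (h *: z)) (f (h + t)) - f t) by exact: nearW.
  exact: (cvg_to_eq _ nE erefl (cvgD cAd cA)).
(* Only right limits are compared: the factor [h^-1] can be taken out of [N] for positive [h]
   only. *)
have cN : (fun h : R => N (h^-1 *: (Ad (e (h *: z)) (f (h + t)) - f t))) @ 0^'+ --> N (ldiff e (f t) d).
  apply: cvg_dnbhs_at_right; have H := finsler_cvg NF cS; exact: H.
have cD : (fun h : R => h^-1 *: (N (f (h + t)) - N (f t))) @ 0^'+ --> 'D_1 (fun s => N (f s)) t.
  apply: cvg_dnbhs_at_right.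
  have dNt : is_derive t (1 : R) (fun s => N (f s)) ('D_1 (fun s => N (f s)) t) by [].
  by have /is_derive_translate/is_derive0P := dNt; rewrite add0r.
apply: (ler_cvg_to cD cN).
near=> h; have h0 : 0 < h by near: h; exact: nbhs_right_gt.
have hi : 0 <= h^-1 by rewrite invr_ge0 ltW.
rewrite (finsler_homogeneous NF _ hi).
suff H : h^-1 * (N (f (h + t)) - N (f t)) <= h^-1 * N (Ad (e (h *: z)) (f (h + t)) - f t).
  exact: H.
rewrite ler_pM2l ?invr_gt0// lerBlDl; apply: le_trans (finsler_triangle NF _ _).
by rewrite (addrC (f t)) subrK NAd.
Unshelve. all: by end_near. Qed.

Lemma strictly_convex_mid (sc : strictly_convex N) a b c : c = 2^-1 *: (a + b) ->
  N a = N c -> N b = N c -> a = c /\ b = c.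
Proof.
(* [strictly_convex] says nothing about the zero vector, where definiteness of [N] gives the
   conclusion. *)
move=> cE Na Nb; have [c0|cn0] := eqVneq c 0.
  by move: Na Nb; rewrite c0 (finsler0 NF) => /(finsler_eq0 NF) -> /(finsler_eq0 NF) ->.
have Nc := finsler_gt0 NF cn0.
have Ni : 0 <= (N c)^-1 by rewrite invr_ge0 ltW.
have [_ ext] := sc c cn0.
have unit_ w : N w = N c -> [set y | N y <= 1] ((N c)^-1 *: w).
  by move=> Nw; rewrite /= (finsler_homogeneous NF)// Nw mulVf// gt_eqF.
have h01 : 0 < (2^-1 : R) < 1 by apply/andP; split; lra.
have E : (N c)^-1 *: c = 2^-1 *: ((N c)^-1 *: a) + (1 - 2^-1) *: ((N c)^-1 *: b).
  rewrite {2}cE; apply/rowP => i; rewrite !mxE; field.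
  by rewrite gt_eqF.
have [e1 e2] := ext _ _ _ (unit_ a Na) (unit_ b Nb) h01 E.
have inj : injective ( *:%R (N c)^-1 : 'rV[R]_n -> 'rV[R]_n).
  by apply: scalerI; rewrite invr_eq0 gt_eqF.
by split; apply: inj.
Qed.

Lemma ldiff_exp_eq_bracket0 x u : strictly_convex N -> N (ldiff e x u) = N u -> bracket x u = 0.
Proof.
move=> sc Nx.
have NE k : N (ldiff e ((2^-1 : R) ^+ k *: x) u) = N u.
  elim: k => [|k IH]; first by rewrite expr0 scale1r.
  apply/eqP; rewrite eq_le ldiff_exp_half_powers_le /= -[leLHS]IH -half_powerS.
  exact: ldiff_exp_half_le.
have step k : ldiff e ((2^-1 : R) ^+ k.+1 *: x) u = ldiff e ((2^-1 : R) ^+ k *: x) u /\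
    Ad (e ((2^-1 : R) ^+ k.+1 *: x))^-1%g (ldiff e ((2^-1 : R) ^+ k.+1 *: x) u) =
    ldiff e ((2^-1 : R) ^+ k *: x) u.
  have E := ldiff_exp_half ((2^-1 : R) ^+ k *: x) u; rewrite half_powerS in E.
  have [||h1 h2] := strictly_convex_mid sc E; first by rewrite NAd !NE.
    by rewrite !NE.
  by [].
have const k : ldiff e ((2^-1 : R) ^+ k *: x) u = ldiff e x u.
  by elim: k => [|k IH]; [rewrite expr0 scale1r|rewrite (step k).1].
have Dxu : ldiff e x u = u.
  have c1 := @ldiff_exp_half_powers x u; rewrite (funext const) in c1.
  have c2 : (fun _ : nat => ldiff e x u) @ \oo --> ldiff e x u by exact: cvg_cst.
  by apply: (cvg_unique _ c2 c1); exact: norm_hausdorff.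
(* The sign comes from the inverse in the averaging formula. Along these times, which tend to 0, the
   difference quotients with limit [bracket x u] vanish. *)
have AdE k : Ad (e (- ((2^-1 : R) ^+ k.+1) *: x)) u = u.
  rewrite scaleNr (expN NF r_gt0 expB) -{2}Dxu -(const k) -(step k).2.
  by rewrite const Dxu.
have /is_derive0P := is_derive_Ad_exp x u.
rewrite scale0r (exp0 NF r_gt0 expB) Ad1 => c1.
have s0 : (fun k => - (2^-1 : R) ^+ k.+1) @ \oo --> 0^'.
  have h : (fun k => - (2^-1 : R) ^+ k.+1) @ \oo --> (0 : R).
    rewrite -[X in _ --> X]oppr0; apply: cvgN; rewrite cvg_shiftS.
    by apply: cvg_expr; rewrite ger0_norm ?invr_ge0// invf_lt1// ltr1n.
  move=> A /= hA; have [m _ hm] := h _ hA; exists m => // k /= mk; apply: (hm k mk).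
  have nz : - (2^-1 : R) ^+ k.+1 != 0 by rewrite oppr_eq0 expf_neq0// invr_eq0 pnatr_eq0.
  exact: nz.
have c3 := cvg_comp _ _ s0 c1.
have c4 : (fun _ : nat => 0 : 'rV[R]_n) @ \oo --> bracket x u.
  apply: cvg_trans c3; apply: near_eq_cvg; apply: nearW => k /=.
  by rewrite AdE subrr scaler0.
have c5 : (fun _ : nat => 0 : 'rV[R]_n) @ \oo --> (0 : 'rV[R]_n) by exact: cvg_cst.
by apply: (cvg_unique _ c4 c5); exact: norm_hausdorff.
Qed.

(** The derivative of the left side at [s] is [Ad (e (s v))] applied to [bracket v w]. *)
Lemma commuting_Ad v w t : bracket v w = 0 -> Ad (e (t *: v)) w = w.
Proof.
move=> vw0.
have d0 s : is_derive s (1 : R) (fun s : R => Ad (e (s *: v)) w) 0.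
  apply/is_derive_translate.
  have d1 := linear_is_derive (Ad (e (s *: v))) (is_derive_Ad_exp v w).
  have E : (fun h : R => Ad (e (s *: v)) (Ad (e (h *: v)) w)) = (fun h : R => Ad (e ((h + s) *: v)) w).
    by apply/funext => h; rewrite -AdM -exp_hom addrC.
  rewrite -E; apply: (is_derive_eq d1); rewrite vw0; exact: linear0.
have := derive0_cst d0 t 0; rewrite scale0r (exp0 NF r_gt0 expB) => ->.
by rewrite Ad1.
Qed.

(** The two exponential lines commute, so [t |-> e (- t v) * e (t w)] is a homomorphism; its
    velocity is [w - v], hence it is the exponential line of [w - v]. *)
Lemma exp_commuting v w : bracket v w = 0 -> e w = (e v * e (w - v))%g.
Proof.
move=> vw0.
have com s t : (e (s *: v) * e (t *: w))%g = (e (t *: w) * e (s *: v))%g.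
  have := exp_conj NF r_gt0 expB (e (s *: v)) (t *: w).
  by rewrite linearZ /= commuting_Ad// => E; rewrite -{2}E mulgVK.
pose f (t : R) := (e (- t *: v) * e (t *: w))%g.
have hf : hom f.
  move=> s t; rewrite /f opprD (exp_hom v) (exp_hom w) -!mulgA; congr (_ * _)%g.
  by rewrite !mulgA com.
have [d1 l1] := gdiff_opp (f := fun t : R => e (t *: v)) (t := 0)
  (eq_rect_r (gdiff _) (gdiff_exp_line NF r_gt0 expB v) (oppr0 R)).
have [d2 l2] := gdiff_mul d1 (gdiff_exp_line NF r_gt0 expB w).
have lf : ldiff f 0 1 = w - v.
  apply: etrans (l2 1) _; rewrite scale0r (exp0 NF r_gt0 expB) invg1 Ad1 l1 oppr0.
  by rewrite linearN /= (ldiff_exp_line NF r_gt0 expB) (ldiff_exp_line NF r_gt0 expB) addrC.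
have := exp_unique NF r_gt0 expB 1 hf d2 lf.
rewrite /f scaleN1r !scale1r (expN NF r_gt0 expB) => <-.
by rewrite mulVKg.
Qed.

End ExponentialGeometry.

(** * Lengths of paths *)

Section SmoothPaths.
Context {R : realType} {n : nat} {G : lieGroupType R n}.
Context (N : 'rV[R]_n -> R) (NF : finsler_norm N).
Local Notation dom p := (chart_dom (chart_at (p : G))).
Local Notation o := (chart_at (1%g : G) 1%g).
Local Notation mu := (@lebesgue_measure R).

Lemma speed_gdiff (alpha : R -> G) t : gdiff alpha t -> speed N alpha t = N (ldiff alpha t 1).
Proof.
move=> da; have dp := chart_at_dom (alpha t).
have [d1 _] := diff_chart_gdiff da dp.
have [_ l] := gdiff_chart (gdiff_cont da) dp d1.
rewrite /speed; congr (N _); apply: etrans _ (esym (l 1)).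
rewrite /tangent_map mulVg /velocity.
by rewrite (deriveE _ d1).
Qed.

Lemma lipschitz_abs_continuous (W : normedModType R) (f : R -> W) a b (K : R) : 0 <= K ->
  (forall x y, a <= x -> x <= y -> y <= b -> `|f y - f x| <= K * (y - x)) ->
  abs_continuous a b f.
Proof.
move=> K0 hK e e0; have K1 : 0 < K + 1 by lra.
exists (e / (K + 1)); first exact: divr_gt0.
move=> s hs _ ls; apply: le_lt_trans (_ : _ <= (K + 1) * \sum_(I <- s) (I.2 - I.1)) _.
  rewrite mulr_sumr big_seq [leRHS]big_seq; apply: ler_sum => I /hs/and3P[aI II Ib].
  by apply: le_trans (hK _ _ aI II Ib) _; rewrite ler_wpM2r ?subr_ge0// lerDl.
by rewrite mulrC -ltr_pdivlMr.
Qed.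

(** The velocity in the chart is continuous, hence bounded on the compact interval, and the curve is
    Lipschitz there. *)
Lemma gdiff_abs_continuous (alpha : R -> G) p c d : c <= d ->
  (forall t, gdiff alpha t) -> continuous (fun t => ldiff alpha t 1) ->
  alpha @` `[c, d] `<=` dom p -> abs_continuous c d (chart_at p \o alpha).
Proof.
move=> cd da cl sub.
have inp t : c <= t <= d -> dom p (alpha t).
  by move=> tcd; apply: sub; exists t => //=; rewrite in_itv.
pose m t := 'd (left_chart (alpha t) 1%g p) o (ldiff alpha t 1).
have cm t : c <= t <= d -> {for t, continuous m}.
  move=> tcd; have dgo : dom p (alpha t * chart_inv (chart_at 1%g) o)%g.
    by rewrite cinv1o mulg1; exact: inp.
  have co : (fun _ : R => o) @ t --> o by exact: cvg_cst.
  have H := left_diff_cvg (gdiff_cont (da t)) co (cl t) cod1o dgo; exact: H.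
have [t0 t0cd ht0] : exists2 t0, t0 \in `[c, d] & forall t, t \in `[c, d] -> `|m t| <= `|m t0|.
  apply: (EVT_max (f := fun t => `|m t|) cd); apply: continuous_in_subspaceT => t.
  rewrite inE /= in_itv /= => tcd.
  have cn : {for m t, continuous (Num.norm : 'rV[R]_n -> R)} by exact: norm_continuous.
  exact: (continuous_comp (cm t tcd) cn).
apply: (@lipschitz_abs_continuous _ _ c d `|m t0|) => // x y cx xy yd.
have inxy t : x <= t <= y -> c <= t <= d by move=> /andP[? ?]; apply/andP; split; lra.
apply: (mean_value_le (df := m) xy) => // t /inxy tcd.
  have [d1 e1] := diff_chart_gdiff (da t) (inp t tcd).
  split; first exact: diff_derivable d1.
  by rewrite (deriveE _ d1); exact: e1.
by apply: ht0; rewrite in_itv.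
Qed.

Lemma gdiff_rectifiable (alpha : R -> G) a b : a <= b ->
  (forall t, gdiff alpha t) -> continuous (fun t => ldiff alpha t 1) ->
  rectifiable N alpha a b.
Proof.
move=> ab da cl; split.
- by apply: continuous_subspaceT => t; exact: gdiff_cont (da t).
- by move=> p c d ac cd db; exact: gdiff_abs_continuous.
- have -> : speed N alpha = (fun t => N (ldiff alpha t 1)).
    by apply/funext => t; exact: speed_gdiff.
  apply: continuous_compact_integrable; first exact: segment_compact.
  apply: continuous_subspaceT => t; have H := finsler_cvg NF (cl t); exact: H.
Qed.

Lemma dist_le (alpha : R -> G) a b g h : a <= b -> rectifiable N alpha a b ->
  alpha a = g -> alpha b = h -> (dist N g h <= path_length N alpha a b)%E.
Proof. by move=> *; apply: ereal_inf_lbound; exists alpha, a, b. Qed.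

End SmoothPaths.

(** * Lipschitz bounds for left translations in charts *)

Section LeftTranslation.
Context {R : realType} {n : nat} {G : lieGroupType R n}.
Implicit Types (p q s g h : G).
Local Notation dom p := (chart_dom (chart_at (p : G))).
Local Notation cod p := (chart_cod (chart_at (p : G))).
Local Notation cinv p := (chart_inv (chart_at (p : G))).

Lemma left_chart_lipschitz g q s (u : 'rV[R]_n) : cod q u -> dom s (g * cinv q u)%g ->
  exists L d : R, [/\ 0 <= L, 0 < d, ball u d `<=` cod q & forall x y : 'rV[R]_n, ball u d x -> ball u d y ->
    `|left_chart g q s x - left_chart g q s y| <= L * `|x - y|].
Proof.
move=> qu su.
pose U := cod q `&` (fun u => g * cinv q u)%g @^-1` dom s.
have oU : open U.
  rewrite openE => z [qz sz]; rewrite /interior; apply: filterI; first exact: near_cod.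
  have c1 : (fun u => g * cinv q u)%g @ z --> (g * cinv q z)%g.
    exact: mulgl_cvg (chart_inv_cont qz).
  exact: (c1 _ (near_dom sz)).
have D z : U z -> differentiable (left_chart g q s) z.
  by move=> [qz sz]; exact: (is_diff_left_chart (chart_at_dom g) qz sz).1.
have cU : Ck 1 U (left_chart g q s).
  split; first exact: D.
  move=> v z Uz; have [qz sz] := Uz.
  have cg := @cvg_cst _ g _ (nbhs z) (nbhs_filter z).
  have cv := @cvg_cst _ v _ (nbhs z) (nbhs_filter z).
  have cz := @cvg_id _ (nbhs z).
  have H := left_diff_cvg cg cz cv qz sz.
  have E : \forall x \near z, 'd (left_chart g q s) x v = 'D_v (left_chart g q s) x.
    by apply: filterS (open_nbhs_nbhs (conj oU Uz)) => x /D dx; exact: (esym (deriveE _ dx)).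
  have K := cvg_to_eq (nbhs_filter z) E (esym (deriveE _ (D z Uz))) (H (nbhs_filter z)).
  exact: K.
have [L [d [L0 d0 sub lip]]] := locally_lipschitz oU (conj qu su) cU.
by exists L, d; split => // x /sub[].
Qed.

Lemma near_eq_gdiff (V : normedModType R) (f k : V -> G) (x : V) :
  (\forall y \near x, f y = k y) -> gdiff f x ->
  gdiff k x /\ forall u, ldiff k x u = ldiff f x u.
Proof.
move=> E [cf df]; have Ex : f x = k x := nbhs_singleton E.
have El : \forall y \near x, log_quot f x y = log_quot k x y.
  by apply: filterS E => y Ey; rewrite /log_quot Ex Ey.
have [d1 e1] := diff_near_eq El df.
have L u : ldiff k x u = ldiff f x u.
  exact (etrans (ldiffE k x u) (etrans (congr1 (fun D : V -> _ => D u) e1) (esym (ldiffE f x u)))).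
have ck : {for x, continuous k} by exact: near_eq_continuous E cf.
exact (conj (GDiff ck d1) L).
Qed.

Lemma abs_continuous_lipschitz (W W' : normedModType R) (f : R -> W) (k : R -> W') a b (L : R) :
  0 <= L -> (forall s t : R, a <= s <= b -> a <= t <= b -> `|k s - k t| <= L * `|f s - f t|) ->
  abs_continuous a b f -> abs_continuous a b k.
Proof.
move=> L0 lip cf eps eps0.
have L1 : 0 < L + 1 by lra.
have [d d0 hd] := cf (eps / (L + 1)) (divr_gt0 eps0 L1).
exists d => // s s1 s2 s3; have H := hd s s1 s2 s3.
apply: le_lt_trans (_ : _ <= (L + 1) * \sum_(I <- s) `|f I.2 - f I.1|) _; last first.
  by rewrite mulrC -ltr_pdivlMr.
rewrite mulr_sumr big_seq [leRHS]big_seq; apply: ler_sum => I /s1/and3P[aI II Ib].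
have h1 : a <= I.1 <= b by apply/andP; split => //; lra.
have h2 : a <= I.2 <= b by apply/andP; split => //; lra.
by apply: le_trans (lip _ _ h2 h1) _; rewrite ler_wpM2r// lerDl.
Qed.

End LeftTranslation.

(** * Regularity of rectifiable paths *)

Section RectifiablePaths.
Context {R : realType} {n : nat} {G : lieGroupType R n}.
Context (N : 'rV[R]_n -> R).
Local Notation dom p := (chart_dom (chart_at (p : G))).
Local Notation mu := (@lebesgue_measure R).

Lemma rectifiable_near (alpha : R -> G) a b t (V : set G) : {within `[a, b], continuous alpha} ->
  a <= t <= b -> nbhs (alpha t) V ->
  exists2 d : R, 0 < d & forall s, a <= s <= b -> `|s - t| < d -> V (alpha s).
Proof.
move=> /subspace_continuousP ca tab nV.
have tin : `[a, b]%classic t by rewrite /= in_itv.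
have /nbhs_ballP[d /= d0 hd] : nbhs t (fun s => `[a, b]%classic s -> V (alpha s)) by exact: ca tin _ nV.
exists d => // s sab sd; apply: hd; last by rewrite /= in_itv.
by rewrite /ball /= distrC.
Qed.

Lemma rectifiable_continuous (alpha : R -> G) a b t : {within `[a, b], continuous alpha} ->
  a < t < b -> {for t, continuous alpha}.
Proof.
move=> ca tab V nV.
have tab' : a <= t <= b by case/andP: tab => ? ?; apply/andP; split; lra.
have [d d0 hd] := rectifiable_near ca tab' nV.
have nd : \forall s \near t, `|s - t| < d.
  by apply/nbhs_ballP; exists d => // s; rewrite /ball /= distrC.
apply: filterS2 nd (near_itv_oo tab) => s sd /andP[as_ sb].
by apply: hd sd; apply/andP; split; lra.
Qed.

Lemma rectifiable_ae_gdiff (alpha : R -> G) a b p c d : rectifiable N alpha a b ->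
  a <= c -> c <= d -> d <= b -> (forall t, c <= t <= d -> dom p (alpha t)) ->
  {ae mu, forall t, c < t < d -> gdiff alpha t}.
Proof.
move=> [ca aca _] ac cd db hp.
have sub : alpha @` `[c, d] `<=` dom p by move=> _ [t /= + <-]; rewrite in_itv; exact: hp.
have H := abs_continuous_ae_derivable cd (aca p c d ac cd db sub).
apply: filterS H; first exact: (ae_filter_ringOfSetsType mu).
move=> t ht tcd; have [ct td] := andP tcd.
have ct' : {for t, continuous alpha} by apply: (rectifiable_continuous ca); apply/andP; split; lra.
have pt : dom p (alpha t) by apply: hp; apply/andP; split; lra.
have D : differentiable (chart_at p \o alpha) t by apply/derivable1_diffP; exact: ht tcd.
exact: (gdiff_chart ct' pt D).1.
Qed.

End RectifiablePaths.

(** * The logarithm on the exponential ball *)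

Section Logarithm.
Context {R : realType} {n : nat} {G : lieGroupType R n}.
Context (N : 'rV[R]_n -> R) (NF : finsler_norm N) (r : R) (r_gt0 : 0 < r).
Context (expB : diffeo_onto_image (M := G) [set x | N x < r] expG).
Context (NAd : Ad_invariant (G := G) N).
Implicit Types (g h : G) (v w x y u : 'rV[R]_n).
Local Notation e := (@expG R n G).
Local Notation B := [set x | N x < r].
Local Notation log := ('pinv_(fun=> 0) B e).
Local Notation dom p := (chart_dom (chart_at (p : G))).
Local Notation cod p := (chart_cod (chart_at (p : G))).
Local Notation cinv p := (chart_inv (chart_at (p : G))).
Local Notation mu := (@lebesgue_measure R).

Lemma logK h : (e @` B) h -> e (log h) = h.
Proof. by move=> Bh; apply: (@pinvK _ _ (fun=> 0) B e); rewrite inE. Qed.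

Lemma expK v : N v < r -> log (e v) = v.
Proof.
have [_ inj _ _] := expB; move=> Bv.
by apply: (@pinvKV _ _ (fun=> 0) B e inj); rewrite inE.
Qed.

Lemma log_ball h : (e @` B) h -> N (log h) < r.
Proof. by move=> [v Bv <-]; rewrite expK. Qed.

Lemma near_exp_ball h : (e @` B) h -> \forall k \near h, (e @` B) k.
Proof. by have [_ _ oV _] := expB; move=> Bh; apply: open_nbhs_nbhs. Qed.

Definition log_dom q : set 'rV[R]_n := cod q `&` cinv q @^-1` (e @` B).

Lemma log_dom_open q : open (log_dom q).
Proof.
rewrite openE => z [qz Bz]; rewrite /interior; apply: filterI; first exact: near_cod.
exact: (chart_inv_cont qz (near_exp_ball Bz)).
Qed.

Lemma log_Ck q k : Ck k (log_dom q) (log \o cinv q).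
Proof. by have [_ _ _ h] := expB; exact: h. Qed.

Lemma log_domP q h : dom q h -> (e @` B) h -> log_dom q (chart_at q h).
Proof. by move=> qh Bh; split; [exact: chart_codP|rewrite /preimage /= chartK]. Qed.

(** The image of the ball is open, so [e (log (beta s)) = beta s] for all [s] near [t], and this
    identity can be differentiated. *)
Lemma derivable_log (beta : R -> G) t : gdiff beta t -> (e @` B) (beta t) ->
  exists2 d, is_derive t (1 : R) (fun s => log (beta s)) d &
    ldiff beta t 1 = ldiff e (log (beta t)) d.
Proof.
move=> db Bt; have qt := chart_at_dom (beta t).
have [d1 _] := diff_chart_gdiff db qt.
have d2 : differentiable (log \o cinv (beta t)) (chart_at (beta t) (beta t)).
  exact: (Ck_differentiable (log_Ck (beta t) 1) (log_domP qt Bt)).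
have cb := gdiff_cont db.
have E : \forall s \near t, (log \o cinv (beta t)) ((chart_at (beta t) \o beta) s) = log (beta s).
  have nq : \forall s \near t, dom (beta t) (beta s) by apply: cb; exact: near_dom.
  by apply: filterS nq => s qs; rewrite /= chartK.
have [d3 _] := @diff_comp_near_eq _ _ _ _ (chart_at (beta t) \o beta) (log \o cinv (beta t)) _ t _ erefl E d1 d2.
have d4 : derivable (fun s => log (beta s)) t (1 : R) by exact: diff_derivable d3.
have D := derivableP d4.
exists ('D_1 (fun s => log (beta s)) t); first exact: D.
have [g1 l1] := ldiff_exp_comp NF r_gt0 expB D.
have El : \forall s \near t, e (log (beta s)) = beta s.
  have nB : \forall s \near t, (e @` B) (beta s) by apply: cb; exact: near_exp_ball.
  by apply: filterS nB => s; exact: logK.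
have [_ l2] := near_eq_gdiff El g1.
exact: (etrans (l2 1) l1).
Qed.

(** Rectifiability controls a path through charts only. This bound, relative to the chart at [h],
    transfers absolute continuity to the logarithm of the translated path. *)
Lemma log_translate_lipschitz g h : (e @` B) (g * h)%g ->
  exists L : R, exists V : set G, [/\ 0 <= L, nbhs h V,
    forall k, V k -> dom h k /\ (e @` B) (g * k)%g &
    forall k k', V k -> V k' ->
      `|log (g * k)%g - log (g * k')%g| <= L * `|chart_at h k - chart_at h k'|].
Proof.
move=> Bgh; have hh := chart_at_dom h; have gg := chart_at_dom (g * h)%g.
have c1 : dom (g * h)%g (g * cinv h (chart_at h h))%g by rewrite chartK.
have [L1 [d1 [L10 d10 _ lip1]]] := left_chart_lipschitz (chart_codP hh) c1.
have [L2 [d2 [L20 d20 _ lip2]]] :=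
  locally_lipschitz (@log_dom_open (g * h)%g) (log_domP gg Bgh) (log_Ck (g * h)%g 1).
have cg : (fun k => g * k)%g @ h --> (g * h)%g by apply: mulgl_cvg; exact: cvg_id.
have ch : (chart_at (g * h)%g \o (fun k => g * k)%g) @ h --> chart_at (g * h)%g (g * h)%g.
  exact: cvg_comp cg (chart_cont gg).
exists (L2 * L1), [set k | [/\ dom h k, (e @` B) (g * k)%g, dom (g * h)%g (g * k)%g,
  ball (chart_at h h) d1 (chart_at h k) &
  ball (chart_at (g * h)%g (g * h)%g) d2 (chart_at (g * h)%g (g * k)%g)]]; split.
- exact: mulr_ge0.
- have n1 : \forall k \near h, dom h k := near_dom hh.
  have n2 : \forall k \near h, (e @` B) (g * k)%g by apply: cg; exact: near_exp_ball.
  have n3 : \forall k \near h, dom (g * h)%g (g * k)%g by apply: cg; exact: near_dom.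
  have n4 : \forall k \near h, ball (chart_at h h) d1 (chart_at h k).
    by apply: (chart_cont hh); exact: nbhsx_ballx.
  have n5 : \forall k \near h, ball (chart_at (g * h)%g (g * h)%g) d2 (chart_at (g * h)%g (g * k)%g).
    by apply: ch; exact: nbhsx_ballx.
  by apply: filterS2 (filterI n1 n2) (filterI n3 (filterI n4 n5)) => k [? ?] [? [? ?]]; split.
- by move=> k [].
- move=> k k' [h1 h2 h3 h4 h5] [k1 k2 k3 k4 k5].
  have H2 := lip2 _ _ h5 k5; rewrite /= !chartK// in H2; apply: le_trans H2 _.
  rewrite -mulrA ler_wpM2l//.
  by have := lip1 _ _ h4 k4; rewrite /left_chart !chartK.
Qed.

(** The conclusion has the shape of the local hypothesis of [itv_local_to_global]. *)
Lemma log_translate_local (alpha : R -> G) a b g t : rectifiable N alpha a b -> a <= t <= b ->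
  (e @` B) (g * alpha t)%g -> exists2 d : R, 0 < d & forall s u : R, a <= s -> s <= u -> u <= b ->
    `|s - t| < d -> `|u - t| < d ->
    [/\ forall x : R, s <= x <= u -> (e @` B) (g * alpha x)%g,
        abs_continuous s u (fun x : R => log (g * alpha x)%g) &
        {ae mu, forall x : R, s < x < u -> gdiff alpha x}].
Proof.
move=> ra tab Bt; have [ca aca _] := ra.
have [L [V [L0 nV VB lip]]] := log_translate_lipschitz Bt.
have [d d0 hd] := rectifiable_near ca tab nV; exists d => // s u as_ su ub sd ud.
have inV (x : R) : s <= x <= u -> V (alpha x).
  move=> /andP[sx xu]; apply: hd; first by apply/andP; split; lra.
  move: sd ud; rewrite !ltr_norml => /andP[? ?] /andP[? ?]; apply/andP; split; lra.
have indom (x : R) : s <= x <= u -> dom (alpha t) (alpha x) by move=> /inV/VB[].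
split; first by move=> x /inV/VB[].
- apply: (@abs_continuous_lipschitz _ _ _ (chart_at (alpha t) \o alpha) _ _ _ L) => //.
    by move=> x y xsu ysu; apply: lip; exact: inV.
  apply: aca => //.
  by move=> _ [x /= + <-]; rewrite in_itv; exact: indom.
- exact: rectifiable_ae_gdiff ra as_ su ub indom.
Qed.

End Logarithm.

(** * The lower bound for lengths of paths *)

Section LowerBound.
Context {R : realType} {n : nat} {G : lieGroupType R n}.
Context (N : 'rV[R]_n -> R) (NF : finsler_norm N) (r : R) (r_gt0 : 0 < r).
Context (expB : diffeo_onto_image (M := G) [set x | N x < r] expG).
Context (NAd : Ad_invariant (G := G) N).
Implicit Types (g h k : G) (v w : 'rV[R]_n).
Local Notation e := (@expG R n G).
Local Notation B := [set x | N x < r].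
Local Notation log := ('pinv_(fun=> 0) B e).
Local Notation mu := (@lebesgue_measure R).

Lemma speed_ge0 (alpha : R -> G) t : 0 <= speed N alpha t.
Proof. exact: finsler_ge0 NF _. Qed.

Lemma path_length_ge0 (alpha : R -> G) a b : (0 <= path_length N alpha a b)%E.
Proof. by apply: integral_ge0 => t _; rewrite lee_fin speed_ge0. Qed.

Lemma speed_integrable (alpha : R -> G) a b s u : rectifiable N alpha a b -> a <= s -> u <= b ->
  mu.-integrable `[s, u] (EFin \o speed N alpha).
Proof.
move=> [_ _ H] as_ ub; apply: integrableS H => //; try exact: measurable_itv.
by apply: subset_itv; rewrite bnd_simp.
Qed.

Lemma path_length_cat (alpha : R -> G) s t u : mu.-integrable `[s, u] (EFin \o speed N alpha) ->
  s <= t -> t <= u ->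
  path_length N alpha s u = (path_length N alpha s t + path_length N alpha t u)%E.
Proof.
move=> H st tu; rewrite /path_length.
have E : `[s, u]%classic = `[s, t]%classic `|` `]t, u]%classic.
  by apply: itv_bndbnd_setU; rewrite bnd_simp.
have mf := measurable_int _ H.
rewrite E ge0_integral_setU; last first.
- apply/disj_setPS => x [] /=; rewrite !in_itv /= => /andP[_ xt] /andP[tx _]; lra.
- by move=> x _; rewrite lee_fin speed_ge0.
- by rewrite -E.
- exact: measurable_itv.
- exact: measurable_itv.
congr (_ + _)%E; apply: integral_itv_obnd_cbnd.
apply: measurable_funS mf; first exact: measurable_itv.
by apply: subset_itv; rewrite bnd_simp.
Qed.

Lemma log_norm_le (alpha : R -> G) a b g s u : rectifiable N alpha a b -> a <= s -> s <= u -> u <= b ->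
  (forall x : R, s <= x <= u -> (e @` B) (g * alpha x)%g) ->
  abs_continuous s u (fun x : R => log (g * alpha x)%g) ->
  {ae mu, forall x : R, s < x < u -> gdiff alpha x} ->
  ((N (log (g * alpha u)%g) - N (log (g * alpha s)%g))%:E <= path_length N alpha s u)%E.
Proof.
move=> ra as_ su ub inB acl aed.
have aN : abs_continuous s u (fun x : R => N (log (g * alpha x)%g)).
  apply: abs_continuous_lipschitz (finsler_bound_ge0 NF) _ acl => x y _ _.
  exact: finsler_dist NF _ _.
apply: (abs_continuous_le_integral su aN (speed_integrable ra as_ ub)).
apply: filterS aed; first exact: (ae_filter_ringOfSetsType mu).
move=> x dx xsu dN; have dax := dx xsu.
have Bx : (e @` B) (g * alpha x)%g by apply: inB; case/andP: xsu => *; apply/andP; split; lra.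
have [db lb] := gdiff_translate g dax.
have [d Dd Ed] := derivable_log NF r_gt0 expB db Bx.
have H := gauss_lemma NF r_gt0 expB NAd Dd dN.
apply: le_trans H _; rewrite (speed_gdiff N dax) -(lb 1).
by rewrite Ed.
Qed.

(* The distance to [1] in the image of the ball, truncated so as to extend
   continuously to [G]. *)
Definition capped_log rho k : R := if `[< (e @` B) k >] then Num.min (N (log k)) rho else rho.

(** The image of the closed [rho]-ball is compact, hence closed since [G] is Hausdorff, and it
    misses [k]. Off this image [capped_log] equals [rho]. *)
Lemma near_capped_log rho k : rho < r -> ~ (e @` B) k -> \forall h \near k, capped_log rho h = rho.
Proof.
move=> rr Bk.
have cK : closed (e @` [set x | N x <= rho]).
  apply: compact_closed; first exact: manifold_hausdorff.
  apply: continuous_compact; last exact: finsler_ball_compact NF rho.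
  by apply: continuous_subspaceT; exact: (exp_continuous NF r_gt0 expB).
have nk : ~ (e @` [set x | N x <= rho]) k.
  by move=> [x xr xk]; apply: Bk; exists x => //=; exact: le_lt_trans xr rr.
have nn : \forall h \near k, ~ (e @` [set x | N x <= rho]) h.
  by apply: open_nbhs_nbhs; split => //; exact: closed_openC.
apply: filterS nn => h nh; rewrite /capped_log; case: asboolP => // Bh.
have [lr|lr] := leP (N (log h)) rho; last by [].
by exfalso; apply: nh; exists (log h) => //; exact: (logK Bh).
Qed.

Lemma capped_log_le (alpha : R -> G) a b g rho : rho < r -> rectifiable N alpha a b -> a <= b ->
  ((capped_log rho (g * alpha b)%g - capped_log rho (g * alpha a)%g)%:E <= path_length N alpha a b)%E.
Proof.
move=> rr ra ab.
(* The bounds belong to [P] because adding the lengths of consecutive pieces requires the speed to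
   be integrable on their union. *)
pose P (s u : R) := [/\ s <= u, a <= s, u <= b &
  ((capped_log rho (g * alpha u)%g - capped_log rho (g * alpha s)%g)%:E <= path_length N alpha s u)%E].
suff [] : P a b by [].
apply: itv_local_to_global => //.
  move=> s t u [st as_ tb H1] [tu at_ ub H2]; split; [lra|lra|lra|].
  rewrite (path_length_cat (speed_integrable ra as_ ub) st tu).
  apply: le_trans (leeD H1 H2); rewrite -EFinD lee_fin; lra.
move=> t tab; have [Bt|Bt] := pselect ((e @` B) (g * alpha t)%g).
  have [d d0 hd] := log_translate_local expB ra tab Bt.
  exists d => // s u as_ su ub sd ud; have [inB acl aed] := hd s u as_ su ub sd ud.
  split => //; have := log_norm_le ra as_ su ub inB acl aed.
  have L0 := path_length_ge0 alpha s u.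
  have Bs : (e @` B) (g * alpha s)%g by apply: inB; rewrite lexx.
  have Bu : (e @` B) (g * alpha u)%g by apply: inB; rewrite lexx andbT.
  rewrite /capped_log !asboolT//.
  (* Truncation is nondecreasing and does not enlarge an increase; in the case of no increase,
     nonnegativity of the length suffices. *)
  have [le1|le1] := leP (N (log (g * alpha u)%g)) (N (log (g * alpha s)%g)) => H.
    apply: le_trans L0; rewrite lee_fin subr_le0.
    by rewrite le_min !ge_min le1 lexx orbT.
  apply: le_trans H; rewrite lee_fin.
  have := ltW le1; move: (N _) (N _) => x y yx.
  by case: (leP x rho) => ?; case: (leP y rho) => ?; lra.
have [ca _ _] := ra.
have nV : nbhs (alpha t) [set k | capped_log rho (g * k)%g = rho].
  have cg : (fun k => g * k)%g @ alpha t --> (g * alpha t)%g by apply: mulgl_cvg; exact: cvg_id.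
  exact: (cg _ (near_capped_log rr Bt)).
have [d d0 hd] := rectifiable_near ca tab nV.
exists d => // s u as_ su ub sd ud; split => //.
have -> : capped_log rho (g * alpha u)%g = rho by apply: hd => //; apply/andP; split; lra.
have -> : capped_log rho (g * alpha s)%g = rho by apply: hd => //; apply/andP; split; lra.
by rewrite subrr path_length_ge0.
Qed.

Lemma length_ge (alpha : R -> G) a b g v : N v < r -> rectifiable N alpha a b -> a <= b ->
  alpha a = g -> alpha b = (g * e v)%g -> ((N v)%:E <= path_length N alpha a b)%E.
Proof.
move=> vr ra ab ga gb.
(* Any cap from [N v] up to, but not including, [r] would do: the truncation must not affect [N v],
   and the capped ball must stay compact inside the given one. *)
have r2 : (N v + r) / 2 < r by lra.
have N0 := finsler0 NF.
have H := capped_log_le g^-1%g r2 ra ab.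
have B0 : (e @` B) 1%g by exists 0; rewrite ?(exp0 NF r_gt0 expB)//= N0.
have E0 : log 1%g = 0 by rewrite -(exp0 NF r_gt0 expB) (expK expB)// N0.
have Bv : (e @` B) (e v) by exists v.
have m1 : Num.min (N v) ((N v + r) / 2) = N v by apply/min_idPl; lra.
have m2 : Num.min (N 0) ((N v + r) / 2) = 0.
  by rewrite N0; apply/min_idPl; have := finsler_ge0 NF v; lra.
by move: H; rewrite ga gb mulVg mulKg /capped_log !asboolT// (expK expB)// E0 m1 m2 subr0.
Qed.

End LowerBound.

(** * Distances between exponentials *)

Section Distance.
Context {R : realType} {n : nat} {G : lieGroupType R n}.
Context (N : 'rV[R]_n -> R) (NF : finsler_norm N) (r : R) (r_gt0 : 0 < r).
Context (expB : diffeo_onto_image (M := G) [set x | N x < r] expG).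
Context (NAd : Ad_invariant (G := G) N).
Implicit Types (g h k : G) (v w x y u : 'rV[R]_n).
Local Notation e := (@expG R n G).
Local Notation B := [set x | N x < r].
Local Notation log := ('pinv_(fun=> 0) B e).
Local Notation mu := (@lebesgue_measure R).

Lemma path_length_le (alpha : R -> G) (K : R) :
  (forall t, gdiff alpha t) -> continuous (fun t => ldiff alpha t 1) ->
  (forall t : R, 0 <= t <= 1 -> N (ldiff alpha t 1) <= K) ->
  (path_length N alpha 0 1 <= K%:E)%E.
Proof.
move=> da cl hK.
have [_ _ /measurable_int mf] := gdiff_rectifiable NF ler01 da cl.
have -> : (K%:E = \int[mu]_(t in `[0%R, 1%R]) (cst K%:E) t)%E.
  have mI : mu `[0%R, 1%R] = 1%E by rewrite lebesgue_measure_itv/= lte_fin ltr01 sube0.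
  transitivity (K%:E * mu `[0%R, 1%R])%E; first by rewrite mI mule1.
  by apply: esym; apply: integral_cst; exact: measurable_itv.
rewrite /path_length; apply: ge0_le_integral => //.
- by move=> t _; rewrite lee_fin (speed_ge0 NF).
- by move=> t /=; rewrite in_itv /= => t01; rewrite lee_fin (speed_gdiff N (da t)) hK.
Qed.

Lemma dist_le_gdiff (alpha : R -> G) (K : R) :
  (forall t, gdiff alpha t) -> continuous (fun t => ldiff alpha t 1) ->
  (forall t : R, 0 <= t <= 1 -> N (ldiff alpha t 1) <= K) ->
  (dist N (alpha 0%R) (alpha 1%R) <= K%:E)%E.
Proof.
move=> da cl hK; apply: le_trans (path_length_le da cl hK).
by apply: dist_le (gdiff_rectifiable NF ler01 da cl) _ _.
Qed.

Lemma dist_ge g v : N v < r -> ((N v)%:E <= dist N g (g * e v)%g)%E.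
Proof.
move=> vr; apply: le_ereal_inf_tmp => _ [alpha [a [b [ab ra ga gb ->]]]].
exact: (length_ge NF r_gt0 expB NAd vr ra ab ga gb).
Qed.

Lemma gdiff_translate_exp_line g v t : gdiff (fun s : R => g * e (s *: v))%g t /\
  ldiff (fun s : R => g * e (s *: v))%g t 1 = v.
Proof.
have [d l] := hom_gdiff (exp_hom NF r_gt0 expB v) (gdiff_exp_line NF r_gt0 expB v) t.
have [d' l'] := gdiff_translate g d; split; first exact: d'.
exact: etrans (l' 1) (etrans (l 1) (ldiff_exp_line NF r_gt0 expB v)).
Qed.

Lemma translate_exp_line_continuous g v :
  continuous (fun t => ldiff (fun s : R => g * e (s *: v))%g t 1).
Proof.
have -> : (fun t => ldiff (fun s : R => g * e (s *: v))%g t 1) = cst v.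
  by apply/funext => t; exact: (gdiff_translate_exp_line g v t).2.
by move=> t; exact: cvg_cst.
Qed.

Lemma path_length_exp_line_le g v :
  (path_length N (fun t : R => g * e (t *: v))%g 0 1 <= (N v)%:E)%E.
Proof.
apply: path_length_le.
- by move=> t; exact: (gdiff_translate_exp_line g v t).1.
- exact: translate_exp_line_continuous.
- by move=> t _; rewrite (gdiff_translate_exp_line g v t).2.
Qed.

Lemma exp_line_rectifiable g v : rectifiable N (fun t : R => g * e (t *: v))%g 0 1.
Proof.
apply: (gdiff_rectifiable NF ler01); last exact: translate_exp_line_continuous.
by move=> t; exact: (gdiff_translate_exp_line g v t).1.
Qed.

Lemma dist_translate_exp g v : N v < r -> dist N g (g * e v)%g = (N v)%:E.
Proof.
move=> vr; apply/eqP; rewrite eq_le dist_ge// andbT.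
apply: le_trans (path_length_exp_line_le g v).
apply: (dist_le _ (exp_line_rectifiable g v)) => //.
- by rewrite scale0r (exp0 NF r_gt0 expB) mulg1.
- by rewrite scale1r.
Qed.

Lemma dist_log g h : (e @` B) h -> dist N g (g * h)%g = (N (log h))%:E.
Proof. by move=> Bh; rewrite -{1}(logK Bh) dist_translate_exp//; exact: (log_ball expB Bh). Qed.

Lemma exp_line_minimizing g v : N v < r -> minimizing N (fun t : R => g * e (t *: v))%g 0 1.
Proof.
move=> vr; split; first exact: exp_line_rectifiable.
rewrite scale0r (exp0 NF r_gt0 expB) mulg1 scale1r.
apply/eqP; rewrite eq_le dist_translate_exp// path_length_exp_line_le /=.
apply: (length_ge NF r_gt0 expB NAd (g := g) vr (exp_line_rectifiable g v)) => //.
- by rewrite scale0r (exp0 NF r_gt0 expB) mulg1.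
- by rewrite scale1r.
Qed.

Lemma near_exp_scale_mul x y :
  \forall t \near (0 : R), (e @` B) (e (t *: x) * e (t *: y))%g.
Proof.
have c v : (fun t : R => e (t *: v)) @ (0 : R) --> (1%g : G).
  have H := gdiff_cont (gdiff_exp_line NF r_gt0 expB v).
  by move: H; rewrite /prop_for /continuous_at scale0r (exp0 NF r_gt0 expB).
have cm : (fun t : R => e (t *: x) * e (t *: y))%g @ (0 : R) --> (1 * 1 : G)%g.
  exact: mulg_cvg (c x) (c y).
rewrite mulg1 in cm.
have B0 : (e @` B) 1%g by exists 0; rewrite ?(exp0 NF r_gt0 expB)//= (finsler0 NF).
by apply: cm; exact: near_exp_ball.
Qed.

(** The ball is [Ad]-invariant, so [Ad g (log h)] is still in the range of the chosen branch of the
    logarithm. *)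
Lemma log_conj g h : (e @` B) h -> (e @` B) (g * h * g^-1)%g /\ log (g * h * g^-1)%g = Ad g (log h).
Proof.
move=> Bh; have E : (g * h * g^-1)%g = e (Ad g (log h)).
  by rewrite -(exp_conj NF r_gt0 expB) (logK Bh).
have lt : N (Ad g (log h)) < r by rewrite NAd; exact: (log_ball expB Bh).
by rewrite E; split; [exists (Ad g (log h))|exact: (expK expB)].
Qed.

(** Left invariance leads to [h = e (- t x) * e (t y)], whereas the statement has the factors in the
    other order. The two products are conjugate by [e (t x)], so their logarithms have the same
    norm. *)
Lemma dist_exp_BCH x y : \forall t \near (0 : R),
  let z := BCH (G := G) B (t *: y) (- (t *: x)) in
  [/\ dist N (e (t *: x)) (e (t *: y)) = dist N 1%g (e (t *: y) * e (- (t *: x)))%g,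
      dist N 1%g (e (t *: y) * e (- (t *: x)))%g = dist N 1%g (e z)
    & dist N 1%g (e z) = (N z)%:E].
Proof.
apply: filterS (near_exp_scale_mul (- x) y) => t; rewrite scalerN => Bh.
set z := BCH _ _ _.
set h := (e (- (t *: x)) * e (t *: y))%g in Bh.
have Ek : (e (t *: y) * e (- (t *: x)))%g = (e (t *: x) * h * (e (t *: x))^-1)%g.
  by rewrite /h (expN NF r_gt0 expB) mulVKg.
have [Bk lk] := log_conj (e (t *: x)) Bh.
have zE : z = log (e (t *: x) * h * (e (t *: x))^-1)%g by rewrite -Ek.
have ez : e z = (e (t *: y) * e (- (t *: x)))%g by rewrite zE (logK Bk).
have dk : dist N 1%g (e z) = (N z)%:E.
  by rewrite ez Ek zE -(dist_log 1%g Bk) mul1g.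
split; [|by rewrite ez|exact: dk].
rewrite -ez dk zE lk NAd -(dist_log (e (t *: x)) Bh) /h (expN NF r_gt0 expB).
by rewrite mulVKg.
Qed.

Lemma gdiff_exp_segment v u t : gdiff (fun s : R => e (v + s *: u)) t /\
  ldiff (fun s : R => e (v + s *: u)) t 1 = ldiff e (v + t *: u) u.
Proof.
have D := is_derive_line (is_derive_id (v + t *: u) u).
exact: (ldiff_exp_comp NF r_gt0 expB D).
Qed.

Lemma ldiff_exp_segment_continuous v u :
  continuous (fun t : R => ldiff (fun s : R => e (v + s *: u)) t 1).
Proof.
have -> : (fun t : R => ldiff (fun s : R => e (v + s *: u)) t 1) = (fun t => ldiff e (v + t *: u) u).
  by apply/funext => t; exact: (gdiff_exp_segment v u t).2.
move=> t; have ct : (fun s : R => v + s *: u) @ t --> v + t *: u.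
  apply: cvgD; first exact: cvg_cst.
  by apply: cvgZr_tmp; exact: cvg_id.
have H := ldiff_exp_cvg NF r_gt0 expB (u := u) ct; exact: H.
Qed.

Lemma dist_exp_le v w (K : R) :
  (forall t : R, 0 <= t <= 1 -> N (ldiff e (v + t *: (w - v)) (w - v)) <= K) ->
  (dist N (e v) (e w) <= K%:E)%E.
Proof.
move=> hK.
have := @dist_le_gdiff (fun s : R => e (v + s *: (w - v))) K
  (fun t => (gdiff_exp_segment v (w - v) t).1) (@ldiff_exp_segment_continuous v (w - v)).
rewrite scale0r addr0 scale1r subrKC; apply=> t t01.
by rewrite (gdiff_exp_segment v (w - v) t).2 hK.
Qed.

(** Let [t0] maximize the speed [l] of the path along the segment. The length is at most [l t0], so
    equality of distance forces [l t0 = N u], and one such point is enough: it gives [[v + t0 u, u]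
    = 0], which is [[v, u] = 0]. *)
Lemma dist_exp_eq_bracket0 v w : strictly_convex N ->
  dist N (e v) (e w) = (N (w - v))%:E -> lie_bracket (G := G) v w = 0.
Proof.
move=> sc dE; set u := w - v.
pose l (t : R) := N (ldiff e (v + t *: u) u).
have [t0 _ ht0] : exists2 t0, t0 \in `[0%R, 1%R] & forall t, t \in `[0%R, 1%R] -> l t <= l t0.
  apply: (EVT_max (f := l) ler01); apply: continuous_subspaceT => t.
  have H := finsler_cvg NF (@ldiff_exp_segment_continuous v u t).
  have El : l = (fun t => N (ldiff (fun s : R => e (v + s *: u)) t 1)).
    by apply/funext => s; rewrite (gdiff_exp_segment v u s).2.
  by rewrite El; exact: H.
have lu : l t0 = N u.
  apply/eqP; rewrite eq_le (ldiff_exp_le NF r_gt0 expB NAd) /= -lee_fin -dE.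
  by apply: dist_exp_le => t t01; apply: ht0; rewrite in_itv.
have H := ldiff_exp_eq_bracket0 NF r_gt0 expB NAd sc lu.
have uu z : lie_bracket (G := G) z z = 0.
  have E := lie_bracketC (G := G) z z; apply/rowP => i; move/rowP/(_ i): E.
  by rewrite !mxE; lra.
have uv : lie_bracket (G := G) u v = 0.
  have E : lie_bracket (G := G) u (v + t0 *: u) = lie_bracket (G := G) u v + t0 *: lie_bracket (G := G) u u.
    by rewrite addrC linearP addrC.
  by rewrite lie_bracketC E uu scaler0 addr0 in H; rewrite -[LHS]opprK H oppr0.
have -> : w = v + u by rewrite /u subrKC.
by rewrite linearD /= uu add0r lie_bracketC uv oppr0.
Qed.

End Distance.

Theorem corollary2p17 (R : realType) (n : nat) (G : lieGroupType R n)
    (G_connected : connected [set: G])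
    (N : 'rV[R]_n -> R) (N_finsler : finsler_norm N)
    (N_invariant : Ad_invariant (G := G) N)
    (r : R) (r_gt0 : 0 < r) :
  let d : G -> G -> \bar R := dist N in
  let e : 'rV[R]_n -> G := expG in
  let B : set 'rV[R]_n := [set x | N x < r] in
  diffeo_onto_image B e ->
  [/\ (forall g h : G, (e @` B) h ->
         d g (g * h)%g = (N ('pinv_(fun=> 0) B e h))%:E),
      (forall (g : G) (v : 'rV[R]_n), B v ->
         minimizing N (fun t : R => (g * e (t *: v))%g) 0 1),
      (forall x y : 'rV[R]_n, \forall t \near (0 : R),
         let z := BCH (G := G) B (t *: y) (- (t *: x)) in
         [/\ d (e (t *: x)) (e (t *: y)) =
               d 1%g (e (t *: y) * e (- (t *: x)))%g,
             d 1%g (e (t *: y) * e (- (t *: x)))%g = d 1%g (e z)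
           & d 1%g (e z) = (N z)%:E]),
      (forall v w : 'rV[R]_n,
         (d (e v) (e w) <= (N (w - v))%:E)%E /\
         (lie_bracket (G := G) v w = 0 -> B (w - v) ->
            d (e v) (e w) = (N (w - v))%:E))
    & (strictly_convex N -> forall v w : 'rV[R]_n,
         d (e v) (e w) = (N (w - v))%:E -> lie_bracket (G := G) v w = 0)].
Proof.
move=> d e B expB; split.
- by move=> g h; exact: (dist_log N_finsler r_gt0 expB N_invariant).
- by move=> g v; exact: (exp_line_minimizing N_finsler r_gt0 expB N_invariant).
- exact: (dist_exp_BCH N_finsler r_gt0 expB N_invariant).
- move=> v w; split.
    apply: (dist_exp_le N_finsler r_gt0 expB) => t _.
    exact: (ldiff_exp_le N_finsler r_gt0 expB N_invariant).
  move=> vw0 Bwv; rewrite /d /e (exp_commuting N_finsler r_gt0 expB vw0).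
  exact: (dist_translate_exp N_finsler r_gt0 expB N_invariant).
- by move=> sc v w; exact: (dist_exp_eq_bracket0 N_finsler r_gt0 expB N_invariant).
Qed.
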